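(* Let $t_n=(-1)^{s_2(n)}$, where $s_2(n)$ is the number of ones in the binary expansion of $n$, and let $\mathbf{a}=(a_n)_{n\ge0}$ with $a_n=(3+t_n)/2\in\{1,2\}$. Let $\varrho_{\mathbf{a}}:\mathcal{A}\to\mathcal{A}^+$ be the corresponding substitution (see context). Then: (i) The subshift $(X_{\varrho_{\mathbf{a}}},\sigma)$ and the tiling dynamical system $(\Omega_{\varrho_{\mathbf{a}}},\mathbb{R})$ are strictly ergodic. (ii) There exists a unique (up to scaling) natural tile length function for $\varrho_{\mathbf{a}}$ which is strictly positive. (iii) The inflation factor $\lambda$ corresponding to $\varrho_{\mathbf{a}}$ is transcendental.
   Context: Let $\mathbf{a}=(a_i)_{i\ge0}$ be a bounded sequence of nonnegative integers, $N:=\max_i a_i$ (here $N=2$). Alphabet. Let $\mathcal{S}=\{*,0,1,\dots,N\}^{\mathbb{Z}}$ with the product topology and let $\sigma$ be the left shift, $\sigma(x)_n=x_{n+1}$. Let $\mathbf{0}\in\mathcal{S}$ be given by $\mathbf{0}_m=a_m$ for $m\ge 0$ and $\mathbf{0}_m=*$ for $m<0$. Define $\iota_{\mathbf{a}}:\mathbb{N}_0\to\mathcal{S}$ by $\iota_{\mathbf{a}}([i])=\sigma^i(\mathbf{0})$ ($[i]$ denotes $i\in\mathbb{N}_0$ viewed as a letter). The alphabet is the closure $\mathcal{A}=\overline{\iota_{\mathbf{a}}(\mathbb{N}_0)}\subset\mathcal{S}$ with the subspace topology. Write $[i]$ for the letter $\iota_{\mathbf{a}}([i])$ and $[\infty_{\mathbf{b}}]$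 for a letter $\mathbf{b}\in\mathcal{A}\setminus\iota_{\mathbf{a}}(\mathbb{N}_0)$. For such $\mathbf{b}=(b_n)_{n\in\mathbb{Z}}$, no entry is $*$ and $\sigma^{\pm1}(\mathbf{b})\in\mathcal{A}\setminus\iota_{\mathbf{a}}(\mathbb{N}_0)$. Substitution. $\varrho_{\mathbf{a}}([0])=[0]^{a_0}[1]$; $\varrho_{\mathbf{a}}([i])=[0]^{a_i}[i-1][i+1]$ for $i>0$; $\varrho_{\mathbf{a}}([\infty_{\mathbf{b}}])=[0]^{b_0}[\infty_{\sigma^{-1}(\mathbf{b})}][\infty_{\sigma(\mathbf{b})}]$. Here $[0]^m$ is $m$ copies of $[0]$ in a row. It is extended to words by concatenation. Write $\varrho=\varrho_{\mathbf{a}}$. Subshift. $\mathcal{A}^n$ (words of length $n$) has the product topology, $\mathcal{A}^+=\bigcup_{n\ge1}\mathcal{A}^n$ the disjoint union topology, $\mathcal{A}^*=\mathcal{A}^+\cup\{\text{empty word}\}$. The language $\mathcal{L}(\varrho)$ is the closure in $\mathcal{A}^*$ of the set of all subwords (blocks of consecutive letters) of the words $\varrho^k(c)$, $k\ge 0$, $c\in\mathcal{A}$. $X_\varrho=\{x\in\mathcal{A}^{\mathbb{Z}}:\text{every finite subword of }x\text{ lies in }\mathcal{L}(\varrho)\}$, with the left shift, also denoted $\sigma$. A strictly positive natural tile length function is a continuous $\ell:\mathcal{A}\to(0,\infty)$ for which there is $\lambda>1$ with $\sum_{b\in\varrho(c)}\ell(b)=\lambda\,\ell(c)$ for all $c\in\mathcal{A}$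 (sum over letters of $\varrho(c)$ with multiplicity). The number $\lambda$ is the inflation factor. Tiling dynamical system. $(\Omega_\varrho,\mathbb{R})$ is the space of tilings of $\mathbb{R}$ obtained from elements of $X_\varrho$ by replacing each letter $c$ by a tile (labelled by $c$) of length $\ell(c)$, together with all translates, with the translation action of $\mathbb{R}$. It is identified with the suspension flow of $(X_\varrho,\sigma)$ with roof function $h(x)=\ell(x_0)$, i.e. the quotient of $X_\varrho\times\mathbb{R}$ by the equivalence relation generated by $(x,t+\ell(x_0))\sim(\sigma(x),t)$, with flow induced by translation of the second coordinate. Strictly ergodic: minimal (every orbit is dense) and uniquely ergodic (exactly one invariant Borel probability measure). *)

(* Defs.v *)
From HB Require Import structures.
From mathcomp Require Import all_boot all_order all_algebra.
From mathcomp Require Import all_classical all_reals all_analysis.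
From mathcomp Require Import zify.
From Stdlib Require Import Relation_Operators.
Import Order.TTheory GRing.Theory Num.Theory.
Import numFieldNormedType.Exports.

Set Warnings "-notation-overridden,-ambiguous-paths,-notation-incompatible-prefix".
Set Implicit Arguments.
Unset Strict Implicit.
Unset Printing Implicit Defensive.

Local Open Scope classical_set_scope.
Local Open Scope ring_scope.
Local Open Scope quotient_scope.

(* The k-th power of the left shift sigma = [shift 1]. *)
Definition shift (T : Type) (k : int) (x : int -> T) : int -> T :=
  fun n => x (n + k).

Lemma shift0 (T : Type) (x : int -> T) : shift 0 x = x.
Proof. by apply/funext => n; rewrite /shift addr0. Qed.

Lemma shiftD (T : Type) (j k : int) (x : int -> T) :
  shift j (shift k x) = shift (j + k) x.
Proof. by apply/funext => n; rewrite /shift addrA. Qed.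

(* The symbol * is [None]. *)
Definition star_symbol (N : nat) := discrete_topology (option 'I_N.+1).

Definition star_space (N : nat) := {ptws int -> star_symbol N}.

HB.instance Definition _ N :=
  Topological.copy (star_space N) {ptws int -> star_symbol N}.

Definition base_seq N (a : nat -> 'I_N.+1) : star_space N :=
  fun m => if m is Posz n then Some (a n) else None.

Definition iota_seq N (a : nat -> 'I_N.+1) (i : nat) : star_space N :=
  shift i%:Z (base_seq a).

Definition alphabet N (a : nat -> 'I_N.+1) : set (star_space N) :=
  closure (range (iota_seq a)).

Lemma alphabet_iota N (a : nat -> 'I_N.+1) i : alphabet a (iota_seq a i).
Proof. by apply: (@subset_closure _ (range (iota_seq a))); exists i. Qed.

Definition letter N (a : nat -> 'I_N.+1) (i : nat) : alphabet a :=
  SigSub (mem_set (@alphabet_iota N a i)).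

Definition is_finite_letter N (a : nat -> 'I_N.+1) (c : alphabet a) :=
  exists i, c = letter a i.

Lemma ptws_continuous (I : Type) (U : topologicalType)
    (V : I -> topologicalType) (f : U -> prod_topology V) :
  (forall i, continuous (fun x => f x i)) -> continuous f.
Proof.
move=> fc x; apply/cvg_sup => i W [B [[C oC <-] Bfx] sBW].
by apply: filterS sBW _; apply: fc; exact: open_nbhs_nbhs.
Qed.

Lemma ptws_proj_continuous (I : eqType) (V : I -> topologicalType) (i : I) :
  continuous (fun f : prod_topology V => f i).
Proof. exact: (@proj_continuous I V i). Qed.

Lemma shift_continuous (V : topologicalType) (k : int) :
  continuous (shift k : {ptws int -> V} -> {ptws int -> V}).
Proof.
apply: ptws_continuous => n; exact: (@ptws_proj_continuous _ (fun=> V) (n + k)).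
Qed.

Lemma near_symbol N (x : star_space N) (n : int) :
  \forall y \near x, y n = x n.
Proof.
apply: (@ptws_proj_continuous _ (fun=> star_symbol N) n x [set x n]).
exact: discrete_set1.
Qed.

Lemma star_space_hausdorff N : hausdorff_space (star_space N).
Proof.
by apply: hausdorff_product => i; exact: discrete_hausdorff.
Qed.

Lemma iota_seq_pos N (a : nat -> 'I_N.+1) (i n : nat) :
  iota_seq a i n%:Z = Some (a (n + i)%N).
Proof. by []. Qed.

Lemma iota_seq_star N (a : nat -> 'I_N.+1) i (n : int) :
  (iota_seq a i n == None) = (n + i%:Z < 0).
Proof. by rewrite /iota_seq /shift /base_seq; case: (n + i%:Z). Qed.

Lemma iota_seq_inj N (a : nat -> 'I_N.+1) : injective (iota_seq a).
Proof.
move=> i j eij.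
have H n : (n + i%:Z < 0) = (n + j%:Z < 0) by rewrite -!(iota_seq_star a) eij.
apply/eqP; rewrite eqn_leq; apply/andP; split.
  have := H (- j%:Z); rewrite addNr ltxx addrC subr_lt0 ltz_nat.
  have := H (- i%:Z); rewrite addNr ltxx [- _ + _]addrC subr_lt0 ltz_nat.
  by move=> /esym/negbT; rewrite -leqNgt.
have := H (- j%:Z); rewrite addNr ltxx addrC subr_lt0 ltz_nat.
by move/negbT; rewrite -leqNgt.
Qed.

(* The letters that are not finite are the limit letters [oo_b]. *)
Lemma limit_letter_no_star N (a : nat -> 'I_N.+1) (c : alphabet a) (n : int) :
  ~ is_finite_letter c -> (val c : star_space N) n != None.
Proof.
move=> cfin; apply/eqP => cn.
have ecl (p : star_space N) : p = val c -> alphabet a p by move=> ->; exact: set_valP.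
pose K := [set iota_seq a i | i in `I_(absz n).+1].
have clK : closed K.
  apply: (accessible_finite_set_closed (T := star_space N)).1.
    exact/hausdorff_accessible/star_space_hausdorff.
  exact/finite_image/finite_II.
have : closure K (val c).
  move=> B nB; have nB' : nbhs (val c : star_space N)
      (B `&` [set y | y n = (val c : star_space N) n]).
    by apply: filterI => //; exact: near_symbol.
  have [_ [[i _ <-] [Bi /= ein]]] := ecl _ erefl _ nB'.
  exists (iota_seq a i); split=> //; exists i => //=.
  move: ein; rewrite cn => /eqP; rewrite iota_seq_star.
  by case: n {cn nB' clK K} => n; rewrite ?NegzE ?ltr0n // addrC subr_lt0 ltz_nat => /ltnW.
rewrite -(closure_id _).1// => -[i _ ic].
by apply: cfin; exists i; apply/val_inj; rewrite -ic.
Qed.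

Lemma alphabet_shift N (a : nat -> 'I_N.+1) (c : alphabet a) :
  alphabet a (shift 1 (val c)).
Proof.
move=> B nB; have ac : alphabet a (val c) := set_valP c.
have /shift_continuous nB' := nB.
have [_ [[i _ <-] Bi]] := ac _ nB'.
exists (iota_seq a i.+1); split; first by exists i.+1.
by move: Bi => /=; rewrite /iota_seq shiftD addrC -PoszD addn1.
Qed.

Lemma limit_letter_unshift N (a : nat -> 'I_N.+1) (c : alphabet a) :
  ~ is_finite_letter c -> alphabet a (shift (-1) (val c)).
Proof.
move=> cfin B nB; have ac : alphabet a (val c) := set_valP c.
have /shift_continuous nB' := nB.
have nB2 : nbhs (val c : star_space N) ((shift (-1) @^-1` B) `&`
    [set y | y (-1) = (val c : star_space N) (-1)]).
  by apply: filterI => //; exact: near_symbol.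
have [_ [[[|i] _ <-] [Bi /= ei]]] := ac _ nB2.
  by case/eqP: (limit_letter_no_star (-1) cfin); exact: (esym ei).
exists (iota_seq a i); split; first by exists i.
move: Bi => /=; rewrite /iota_seq shiftD.
by rewrite (_ : -1 + i.+1%:Z = i%:Z) // -addn1 PoszD addrCA addNr addr0.
Qed.

Definition limit_prev N (a : nat -> 'I_N.+1) (c : alphabet a)
    (h : ~ is_finite_letter c) : alphabet a :=
  SigSub (mem_set (@limit_letter_unshift N a c h)).

Definition next_letter N (a : nat -> 'I_N.+1) (c : alphabet a) : alphabet a :=
  SigSub (mem_set (@alphabet_shift N a c)).

(* The value 0 for the symbol * is never used, by [limit_letter_no_star]. *)
Definition entry0 N (c : star_space N) : nat :=
  if c 0 is Some k then k else 0%N.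

Definition subst N (a : nat -> 'I_N.+1) (c : alphabet a) : seq (alphabet a) :=
  match pselect (is_finite_letter c) with
  | left h =>
      match projT1 (cid h) with
      | 0%N => nseq (a 0%N) (letter a 0%N) ++ [:: letter a 1%N]
      | j.+1 => nseq (a j.+1) (letter a 0%N) ++ [:: letter a j; letter a j.+2]
      end
  | right h =>
      nseq (entry0 (val c)) (letter a 0%N) ++ [:: limit_prev h; next_letter c]
  end.

Lemma letter_inj N (a : nat -> 'I_N.+1) : injective (letter a).
Proof. by move=> i j /(congr1 val)/= /iota_seq_inj. Qed.

Lemma subst_letter0 N (a : nat -> 'I_N.+1) :
  subst (letter a 0%N) = nseq (a 0%N) (letter a 0%N) ++ [:: letter a 1%N].
Proof.
rewrite /subst; case: pselect => [h|[]]; last by exists 0%N.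
by case: cid => i /= /letter_inj <-.
Qed.

Lemma subst_letterS N (a : nat -> 'I_N.+1) j :
  subst (letter a j.+1) =
  nseq (a j.+1) (letter a 0%N) ++ [:: letter a j; letter a j.+2].
Proof.
rewrite /subst; case: pselect => [h|[]]; last by exists j.+1.
by case: cid => i /= /letter_inj <-.
Qed.

Lemma subst_limit N (a : nat -> 'I_N.+1) (c : alphabet a)
    (h : ~ is_finite_letter c) :
  subst c = nseq (entry0 (val c)) (letter a 0%N) ++ [:: limit_prev h; next_letter c].
Proof.
rewrite /subst; case: pselect => // h'.
by rewrite (Prop_irrelevance h' h).
Qed.

Definition subst_word N (a : nat -> 'I_N.+1) (w : seq (alphabet a)) :
    seq (alphabet a) :=
  flatten [seq subst c | c <- w].

Arguments subst_word {N} a w.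

(* Finite words with the disjoint union of the product topologies; the empty
   word (n = 0) is an isolated point. *)
Definition word (T : Type) := {n : nat & {ptws 'I_n -> T}}.

HB.instance Definition _ (T : topologicalType) :=
  Topological.copy (word T) {n : nat & {ptws 'I_n -> T}}.

Definition word_of_seq (T : Type) (s : seq T) : word T :=
  existT (fun n => {ptws 'I_n -> T}) (size s) (tnth (in_tuple s)).

Definition subword_at (T : Type) (x : int -> T) (m : int) (n : nat) : word T :=
  existT (fun n => {ptws 'I_n -> T}) n (fun i : 'I_n => x (m + i%:Z)).

Definition subst_subwords N (a : nat -> 'I_N.+1) : set (word (alphabet a)) :=
  [set word_of_seq s | s in
    [set s | exists k c, infix s (iter k (subst_word a) [:: c])]].

Arguments subst_subwords {N} a _.

Definition language N (a : nat -> 'I_N.+1) : set (word (alphabet a)) :=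
  closure (subst_subwords a).

Arguments language {N} a _.

Definition subshift N (a : nat -> 'I_N.+1) : set {ptws int -> alphabet a} :=
  [set x | forall (m : int) (n : nat), language a (subword_at x m n)].

Arguments subshift {N} a _.

Lemma subshift_shift N (a : nat -> 'I_N.+1) (k : int) (x : subshift a) :
  subshift a (shift k (val x)).
Proof.
move=> m n; have := set_valP x (m + k) n.
rewrite /subword_at /shift; congr (language a (existT _ _ _)).
by apply/funext => i; rewrite addrAC.
Qed.

Lemma alphabet_compact N (a : nat -> 'I_N.+1) : compact [set: alphabet a].
Proof.
have fin : finite_set [set: star_symbol N] :=
  @finite_finset (option 'I_N.+1) setT.
have cS : compact [set: star_space N].
  have := @tychonoff int (fun=> star_symbol N) (fun=> setT)
    (fun=> @finite_compact (star_symbol N) setT fin).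
  by congr compact; apply/seteqP; split.
have cA : compact (alphabet a).
  by apply: (subclosed_compact _ cS) => //; exact: closed_closure.
move=> F PF FT.
have [p [Ap clp]] : (alphabet a `&` cluster ((val : alphabet a -> star_space N) @ F)) !=set0.
  by apply: cA; apply: (@filterS _ F _ setT) => // c _; exact: (set_valP c).
exists (SigSub (mem_set Ap)); split=> // A B FA [_ [[V oV <-] Vp] VB].
have [_ [[c Ac <-] Vc]] : ((val : alphabet a -> star_space N) @` A) `&` V !=set0.
  apply: clp; last exact: open_nbhs_nbhs.
  by apply: (@filterS _ F _ A) => // c Ac; exists c.
by exists c; split=> //; exact: VB.
Qed.

Lemma word_of_seqE (T : Type) (d : T) (s : seq T) n (f : 'I_n -> T) :
  size s = n -> (forall i : 'I_n, nth d s i = f i) ->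
  word_of_seq s = existT (fun n => {ptws 'I_n -> T}) n f.
Proof.
move=> en; subst n => sf; congr existT; apply/funext => i.
by rewrite (tnth_nth d) sf.
Qed.

Lemma subword_at_continuous (T : topologicalType) (m : int) (n : nat) :
  continuous (fun x : {ptws int -> T} => subword_at x m n : word T).
Proof.
have gc : continuous (fun x : {ptws int -> T} =>
    ((fun i : 'I_n => x (m + i%:Z)) : {ptws 'I_n -> T})).
  apply: ptws_continuous => i; exact: (@ptws_proj_continuous int (fun=> T)).
move=> x B nB.
exact: (gc x ((fun f => existT (fun n => {ptws 'I_n -> T}) n f) @^-1` B) nB).
Qed.

Lemma subst_word_cat N (a : nat -> 'I_N.+1) (v w : seq (alphabet a)) :
  subst_word a (v ++ w) = subst_word a v ++ subst_word a w.
Proof. by rewrite /subst_word map_cat flatten_cat. Qed.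

Lemma size_subst_word N (a : nat -> 'I_N.+1) (w : seq (alphabet a)) :
  (size w <= size (subst_word a w))%N.
Proof.
elim: w => //= c w IH; rewrite /subst_word /= size_cat.
apply: (@leq_add 1) => //; rewrite /subst; case: pselect => h.
  by case: (projT1 _) => [|j]; rewrite size_cat addnC.
by rewrite size_cat addnC.
Qed.

Lemma iter_subst_letter1 N (a : nat -> 'I_N.+1) k :
  exists2 v, iter k (subst_word a) [:: letter a 1%N] = v ++ [:: letter a k.+1]
           & (k <= size v)%N.
Proof.
elim: k => [|k [v /= -> kv]]; first by exists [::].
exists (subst_word a v ++ nseq (a k.+1) (letter a 0%N) ++ [:: letter a k]).
  by rewrite subst_word_cat /subst_word /= cats0 subst_letterS -!catA.
rewrite !size_cat /= addnA addn1 ltnS.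
by apply: leq_trans (leq_addr _ _); exact: leq_trans (size_subst_word v).
Qed.

Lemma subshift_nonempty N (a : nat -> 'I_N.+1) : subshift a !=set0.
Proof.
pose d := letter a 0%N.
pose w j := iter j.*2 (subst_word a) [:: letter a 1%N].
pose y j : {ptws int -> alphabet a} := fun m => nth d (w j) (absz (m + j%:Z)).
have wj j : (j.*2 < size (w j))%N.
  by rewrite /w; have [v -> jv] := iter_subst_letter1 a j.*2; rewrite size_cat addn1.
have cX : compact [set: {ptws int -> alphabet a}].
  have := @tychonoff int (fun=> alphabet a : topologicalType) (fun=> setT)
    (fun=> alphabet_compact (a := a)).
  by congr compact; apply/seteqP; split.
have [x [_ clx]] : ([set: {ptws int -> alphabet a}] `&` cluster (y @ \oo)) !=set0.
  by apply: cX; exact: filterT.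
exists x => m n B nB.
have : nbhs x [set z | B (subword_at z m n)] by exact: subword_at_continuous.
have F : (y @ \oo) [set z | subst_subwords a (subword_at z m n)].
  exists (absz m + n)%N => // j /= mnj.
  have [p ep] : exists p : nat, m + j%:Z = p%:Z.
    by exists (absz (m + j%:Z)); rewrite gez0_abs //; lia.
  have pn : (p + n < size (w j))%N by apply: leq_ltn_trans (wj j); lia.
  have sz : size (take n (drop p (w j))) = n.
    by rewrite size_takel // size_drop; lia.
  exists (take n (drop p (w j))).
    exists j.*2, (letter a 1); apply/infixP.
    exists (take p (w j)), (drop n (drop p (w j))).
    by rewrite cat_take_drop cat_take_drop.
  apply: (word_of_seqE (d := d)) => // i.
  by rewrite nth_take // nth_drop /y addrAC ep.
by move=> /(clx _ _ F)[z [Lz Bz]]; exists (subword_at z m n).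
Qed.

Definition subshift_space N (a : nat -> 'I_N.+1) : Type := subshift a.

HB.instance Definition _ N (a : nat -> 'I_N.+1) :=
  Topological.copy (subshift_space a) (subshift a).

HB.instance Definition _ N (a : nat -> 'I_N.+1) :=
  isPointed.Build (subshift_space a)
    (SigSub (mem_set (projT2 (cid (@subshift_nonempty N a))))).

(* The Z-action generated by the shift: [subshift_act 1] is sigma. *)
Definition subshift_act N (a : nat -> 'I_N.+1) (k : int)
    (x : subshift_space a) : subshift_space a :=
  SigSub (mem_set (@subshift_shift N a k x)).

Arguments subshift_act {N} a k x.

(* Actions of an acting set G (Z or R below) on a topological space. *)
Definition minimal_action (G : Type) (T : topologicalType) (act : G -> T -> T) :=
  forall x : T, dense (range (act ^~ x)).

Definition borel (T : ptopologicalType) := g_sigma_algebraType (@open T).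

HB.instance Definition _ (T : ptopologicalType) := Measurable.on (borel T).

Definition invariant_measure (R : realType) (G : Type) (T : ptopologicalType)
    (act : G -> T -> T) (mu : probability (borel T) R) :=
  forall (g : G) (A : set (borel T)), measurable A ->
    mu (act g @^-1` A) = mu A.

(* Measures are functions on all sets; only their values on measurable sets are
   meaningful, hence the form of uniqueness. *)
Definition uniquely_ergodic (R : realType) (G : Type) (T : ptopologicalType)
    (act : G -> T -> T) :=
  exists2 mu : probability (borel T) R, invariant_measure act mu &
    forall nu : probability (borel T) R, invariant_measure act nu ->
      forall A : set (borel T), measurable A -> nu A = mu A.

Definition strictly_ergodic (R : realType) (G : Type) (T : ptopologicalType)
    (act : G -> T -> T) :=
  minimal_action act /\ uniquely_ergodic R act.

(* A strictly positive natural tile length function, with its inflation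
   factor lambda. *)
Definition natural_tile_length (R : realType) N (a : nat -> 'I_N.+1)
    (l : alphabet a -> R) (lambda : R) :=
  [/\ continuous l, forall c, 0 < l c, 1 < lambda &
      forall c, \sum_(b <- subst c) l b = lambda * l c].

Definition susp_step (R : realType) N (a : nat -> 'I_N.+1)
    (l : alphabet a -> R) (p q : subshift_space a * R) :=
  exists (x : subshift_space a) (t : R),
    p = (x, t + l (val x 0)) /\ q = (subshift_act a 1 x, t).

Definition susp_rel (R : realType) N (a : nat -> 'I_N.+1)
    (l : alphabet a -> R) (p q : subshift_space a * R) : bool :=
  `[< clos_refl_sym_trans _ (susp_step l) p q >].

Lemma susp_rel_refl (R : realType) N (a : nat -> 'I_N.+1)
  (l : alphabet a -> R) : reflexive (susp_rel l).
Proof. by move=> p; apply/asboolP; exact: rst_refl. Qed.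

Lemma susp_rel_sym (R : realType) N (a : nat -> 'I_N.+1)
  (l : alphabet a -> R) : symmetric (susp_rel l).
Proof. by move=> p q; apply/asboolP/asboolP; exact: rst_sym. Qed.

Lemma susp_rel_trans (R : realType) N (a : nat -> 'I_N.+1)
  (l : alphabet a -> R) : transitive (susp_rel l).
Proof.
by move=> q p r /asboolP pq /asboolP qr; apply/asboolP; exact: rst_trans pq qr.
Qed.

Definition susp_equiv (R : realType) N (a : nat -> 'I_N.+1)
    (l : alphabet a -> R) : equiv_rel (subshift_space a * R) :=
  EquivRel _ (susp_rel_refl l) (@susp_rel_sym R N a l) (@susp_rel_trans R N a l).

Definition tiling_space (R : realType) N (a : nat -> 'I_N.+1)
    (l : alphabet a -> R) := {eq_quot (susp_equiv l)}.

HB.instance Definition _ (R : realType) N (a : nat -> 'I_N.+1)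
    (l : alphabet a -> R) := Quotient.on (tiling_space l).

HB.instance Definition _ (R : realType) N (a : nat -> 'I_N.+1)
    (l : alphabet a -> R) :=
  Topological.copy (tiling_space l) (quotient_topology (tiling_space l)).

HB.instance Definition _ (R : realType) N (a : nat -> 'I_N.+1)
    (l : alphabet a -> R) :=
  isPointed.Build (tiling_space l) (\pi_(tiling_space l) (point, 0)).

Definition tiling_flow (R : realType) N (a : nat -> 'I_N.+1)
    (l : alphabet a -> R) (s : R) (w : tiling_space l) : tiling_space l :=
  \pi_(tiling_space l) ((repr w).1, (repr w).2 + s).

Arguments tiling_flow {R N a} l s w.

Lemma tiling_flow_pi (R : realType) N (a : nat -> 'I_N.+1)
    (l : alphabet a -> R) (s : R) (x : subshift_space a) (t : R) :
  tiling_flow l s (\pi_(tiling_space l) (x, t)) = \pi_(tiling_space l) (x, t + s).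
Proof.
have H p q : clos_refl_sym_trans _ (susp_step l) p q ->
    clos_refl_sym_trans _ (susp_step l) (p.1, p.2 + s) (q.1, q.2 + s).
  elim=> {p q} [p q [y [u [-> ->]]]|p|p q _ IH|p q r _ IH1 _ IH2] /=.
  - by apply: rst_step; exists y, (u + s); rewrite addrAC.
  - exact: rst_refl.
  - exact: rst_sym.
  - exact: rst_trans IH1 IH2.
have /eqquotP/asboolP h : \pi_(tiling_space l) (repr (\pi_(tiling_space l) (x, t))) =
    \pi_(tiling_space l) (x, t) := reprK _.
by apply/eqquotP/asboolP; exact: H h.
Qed.

(* Number of ones in the binary expansion; the summand is the i-th digit and
   all digits of index i >= n vanish since n < 2 ^ n. *)
Definition binary_ones (n : nat) : nat :=
  (\sum_(i < n) ((n %/ 2 ^ i) %% 2))%N.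

Definition thue_morse (n : nat) : int := (-1) ^+ binary_ones n.

Definition tm_seq (n : nat) : 'I_3 := inord (absz ((3 + thue_morse n) %/ 2)%Z).

Lemma tm_seqE (n : nat) : (tm_seq n)%:Z * 2 = 3 + thue_morse n.
Proof.
rewrite /tm_seq /thue_morse -signr_odd.
by case: odd; rewrite ?expr1 ?expr0 inordK.
Qed.

(* Main.v *)
Require Import Defs.
From HB Require Import structures.
From mathcomp Require Import all_boot all_order all_algebra perm.
From mathcomp Require Import all_classical all_reals all_analysis.
From mathcomp Require Import measurable_realfun.
From mathcomp Require Import zify ring lra.
From Stdlib Require Import Relation_Operators.
From Stdlib Require Eqdep_dec PeanoNat.
Import Order.TTheory GRing.Theory Num.Theory.
Import numFieldNormedType.Exports.

(** Let [q] be the root in ]0, 1[ of [a_0 q + a_1 q^2 + a_2 q^3 + ... = 1].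

Tile lengths. On the finite letters the eigenvalue equation of a natural tile
length [l] is the recurrence [lambda l_i = a_i l_0 + l_(i-1) + l_(i+1)]. Write
[lambda = q + q^-1]. Because [l] is bounded, summing the recurrence against
[q^(i+1)] leaves exactly the equation of [q] ([natural_inflation_root]). So
[lambda] is unique, and [l] is unique up to scaling by the recurrence and by the
density of the finite letters ([natural_tile_length_unique]). Conversely
[l(b) = (sum over m in Z of q^|m| w(b_m)) / (q^-1 - q)], with [w(k) = k] and a suitable
weight of the symbol [None], is a natural tile length: it depends little on far
entries, hence is continuous ([natural_tile_length_exists]).

The subshift. The letter [0] occurs in the image of every letter, and every
window of a point is, up to far entries of its letters, a factor of an iterate of
[0]. This gives minimality ([subshift_minimal]). It also gives the convergence of
averages of quasi-additive functions along long factors: the extreme averages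
over supertiles of level [k] are pulled together at each level by the supertile of
[0] that all supertiles contain ([quasi_additive_average]). Birkhoff sums of
continuous functions are approximated by such functions of words, hence converge
uniformly ([uniform_average]). The limits for clopen sets define the invariant
measure, which is countably additive by compactness ([clopen_base_extension]),
and uniform convergence makes it unique.

The flow. Minimality follows from that of the subshift. The product of the
invariant measure and the Lebesgue measure on [X * R] is invariant under the deck
transformation of the suspension, so restricting it to a fundamental domain
gives a flow-invariant measure ([flow_invariant_exists]). For its uniqueness, the
flow is sampled at the multiples of a small [eta]: the number of samples in a box
is, up to small errors, the time spent there, a Birkhoff sum over the subshift
([flow_average]).

Transcendence. For the Thue-Morse sequence [t], the generating function
[T(x) = sum of t_j x^j] is the product of the [1 - x^(2^i)], and the equation of [q]
becomes [T(q) q (1 - q) = 2 - 5 q] ([tm_relation]). If [lambda] were algebraic, so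
would be [q], and [T(q)] would be a rational function of [q]. Mahler's method excludes
this. Linear algebra provides a nonzero [P] in [Z[X, Y]], of degree at most [n] in each
variable, such that [P(x, T(x))] vanishes at 0 to order at least [n^2]; it is not
identically 0, as [T] tends to 0 faster than any power of [1 - x] at 1
([bipoly_tm_neq0]). At [x = q^(2^k)], where [T(x)] is still a rational function of [q],
it is nonzero but smaller than a nonzero value of an integer polynomial of that
degree and length can be at an algebraic number ([liouville]). *)

Set Implicit Arguments.
Unset Strict Implicit.
Unset Printing Implicit Defensive.

Local Open Scope classical_set_scope.
Local Open Scope ring_scope.
Local Open Scope quotient_scope.
Local Notation shift := Defs.shift.
Local Notation evalz p x := (map_poly intr p).[x].

(** * Factors of iterated substitutions *)

Lemma prefix_flatten (T : eqType) (f : T -> seq T) (M : nat) (v w y : seq T) :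
  (forall c, (size (f c) <= M)%N) -> flatten (map f v) = w ++ y ->
  exists b q, w = flatten (map f b) ++ q /\ (size q <= M)%N.
Proof.
move=> fM; elim: v w y => [|c v IH] w y /=.
  by case: w => // _; exists [::], [::].
have [le_w|lt_w] := leqP (size (f c)) (size w) => e.
  have ew : take (size (f c)) w = f c.
    by have := congr1 (take (size (f c))) e; rewrite take_size_cat // takel_cat.
  have : flatten (map f v) = drop (size (f c)) w ++ y.
    have := congr1 (drop (size (f c))) e; rewrite drop_size_cat // drop_cat.
    case: ltngtP le_w => // ee _.
    by rewrite ee subnn drop0 drop_size.
  move=> /IH[b [q [ed qM]]]; exists (c :: b), q; split=> //=.
  by rewrite -catA -ed -{1}(cat_take_drop (size (f c)) w) ew.
exists [::], w; split=> //; exact: leq_trans (ltnW lt_w) (fM c).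
Qed.

(** A factor of a concatenation of blocks consists of whole blocks, except for an
incomplete block at each end. Bounding these two ends is what makes boundary
effects negligible in long words. *)
Lemma infix_flatten (T : eqType) (f : T -> seq T) (M : nat) (v w : seq T) :
  (forall c, (size (f c) <= M)%N) -> infix w (flatten (map f v)) ->
  exists p b q, [/\ w = p ++ flatten (map f b) ++ q,
                    (size p <= M)%N & (size q <= M)%N].
Proof.
move=> fM /infixP[x [y]]; elim: v x => [|c v IH] x /=.
  by case: x => //; case: w => // _; exists [::], [::], [::].
have [le_x|lt_x] := leqP (size (f c)) (size x) => e.
  apply: (IH (drop (size (f c)) x)).
  have := congr1 (drop (size (f c))) e; rewrite drop_size_cat // drop_cat.
  case: ltngtP le_x => // ee _.
  by rewrite ee subnn drop0 drop_size.
set x' := drop (size x) (f c).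
have ex : f c = x ++ x'.
  rewrite -{1}(cat_take_drop (size x) (f c)); congr cat.
  by have := congr1 (take (size x)) e; rewrite takel_cat ?(ltnW lt_x) // take_size_cat.
have sx' : (size x' <= M)%N.
  by apply: leq_trans (fM c); rewrite ex size_cat leq_addl.
have {}e : x' ++ flatten (map f v) = w ++ y.
  by move: e; rewrite ex -catA => /eqP; rewrite eqseq_cat // eqxx => /eqP.
have [le_w|/ltnW lt_w] := leqP (size x') (size w).
  have ew : take (size x') w = x'.
    by have := congr1 (take (size x')) e; rewrite take_size_cat // takel_cat.
  have : flatten (map f v) = drop (size x') w ++ y.
    have := congr1 (drop (size x')) e; rewrite drop_size_cat // drop_cat.
    case: ltngtP le_w => // ee _.
    by rewrite ee subnn drop0 drop_size.
  move=> /(prefix_flatten fM)[b [q [ed qM]]]; exists x', b, q; split=> //.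
  by rewrite -ed -{1}(cat_take_drop (size x') w) ew.
exists w, [::], [::]; split=> //; first by rewrite /= cats0.
exact: leq_trans lt_w sx'.
Qed.

Section WordAverages.
Context {R : realType} {T : eqType}.
Variables (s : T -> seq T) (z : T) (K : nat).
Hypotheses (s_size : forall c, (size (s c) <= K)%N) (s_z : forall c, z \in s c).

Definition sub_word (w : seq T) := flatten (map s w).

Lemma sub_word_cat u v : sub_word (u ++ v) = sub_word u ++ sub_word v.
Proof. by rewrite /sub_word map_cat flatten_cat. Qed.

Lemma iter_sub_word_cat k u v :
  iter k sub_word (u ++ v) = iter k sub_word u ++ iter k sub_word v.
Proof. by elim: k => //= k ->; rewrite sub_word_cat. Qed.

Lemma iter_sub_word_flatten k v :
  iter k sub_word v = flatten [seq iter k sub_word [:: c] | c <- v].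
Proof.
elim: v => [|c v IH]; first by elim: k => //= k ->.
by rewrite -cat1s iter_sub_word_cat IH.
Qed.

Lemma size_iter_sub_word k v :
  (size (iter k sub_word v) <= K ^ k * size v)%N.
Proof.
elim: k => [|k IH] /=; first by rewrite mul1n.
have H w : (size (sub_word w) <= K * size w)%N.
  elim: w => // c w IHw; rewrite /sub_word /= size_cat mulnS.
  exact: leq_add.
by apply: leq_trans (H _) _; rewrite expnS -mulnA leq_mul2l IH orbT.
Qed.

(** Supertiles of level [k] are the words [iter k sub_word [:: d]]. If [n < k], the
whole word is short enough to serve as one of the two ends. *)
Lemma infix_iter_sub_word k n c w : infix w (iter n sub_word [:: c]) ->
  exists p b q, [/\ w = p ++ iter k sub_word b ++ q,
                    (size p <= K ^ k)%N & (size q <= K ^ k)%N].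
Proof.
have K0 : (0 < K)%N.
  by apply: leq_trans (s_size z); have := s_z z; case: (s z).
have sM d j : (size (iter j sub_word [:: d]) <= K ^ j)%N.
  by have := size_iter_sub_word j [:: d]; rewrite muln1.
have [le_kn|lt_nk] := leqP k n => iw.
  move: iw; rewrite -(subnKC le_kn) iterD iter_sub_word_flatten.
  move=> /(infix_flatten (fun d => sM d k))[p [b [q [-> hp hq]]]].
  by exists p, b, q; split=> //; rewrite -iter_sub_word_flatten.
exists w, [::], [::]; split => //; first by rewrite iter_sub_word_flatten /= cats0.
apply: (leq_trans (size_infix iw)); apply: (leq_trans (sM c n)).
by rewrite leq_pexp2l // ltnW.
Qed.

(** * Averages of quasi-additive functions of words *)

Variables (l : T -> R) (lambda lo hi : R).
Hypotheses (lo_gt0 : 0 < lo) (lo_le : forall c, lo <= l c)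
  (le_hi : forall c, l c <= hi) (lambda_gt1 : 1 < lambda)
  (l_eigen : forall c, \sum_(b <- s c) l b = lambda * l c).

Definition weight (w : seq T) : R := \sum_(b <- w) l b.

Lemma weight_cat u v : weight (u ++ v) = weight u + weight v.
Proof. by rewrite /weight big_cat. Qed.

Lemma weight_sub_word w : weight (sub_word w) = lambda * weight w.
Proof.
elim: w => [|c w IH]; first by rewrite /weight !big_nil mulr0.
rewrite -cat1s sub_word_cat !weight_cat IH mulrDr; congr (_ + _).
by rewrite /weight l_eigen big_nil addr0 big_seq1.
Qed.

Lemma weight_iter k w : weight (iter k sub_word w) = lambda ^+ k * weight w.
Proof.
elim: k => [|k IH] /=; first by rewrite mul1r.
by rewrite weight_sub_word IH exprS mulrA.
Qed.

Lemma weight_ge w : (size w)%:R * lo <= weight w.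
Proof.
elim: w => [|c w IH]; first by rewrite mul0r /weight big_nil.
rewrite -cat1s weight_cat size_cat natrD mulrDl mul1r lerD //.
by rewrite /weight big_seq1.
Qed.

Lemma weight_le w : weight w <= (size w)%:R * hi.
Proof.
elim: w => [|c w IH]; first by rewrite mul0r /weight big_nil.
rewrite -cat1s weight_cat size_cat natrD mulrDl mul1r lerD //.
by rewrite /weight big_seq1.
Qed.

(** Whatever the letter [c], the letter [z] carries at least the share [delta] of the
weight of [s c]. *)
Let delta := l z / (lambda * hi).

Section QuasiAdditive.
Variables (S : seq T -> R) (B D : R).
Hypotheses (S_quasi : forall u v, `|S (u ++ v) - S u - S v| <= D)
  (S_letter : forall c, `|S [:: c]| <= B).

(** Adding [D] makes the quasi-additive function [S] subadditive. *)
Let F k c := S (iter k sub_word [:: c]) + D.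

(** A bound for the ratio of [F] to the weight on the supertiles of level [k]. A
supertile of level [k.+1] contains the supertile of level [k] of [z], on which the
ratio is known, and by subadditivity the gap between this ratio and the bound
lowers the next bound in proportion [delta]. *)
Fixpoint upper_rate k : R :=
  if k is k'.+1 then
    upper_rate k' - delta * (upper_rate k' - F k' z / (lambda ^+ k' * l z))
  else (B + D) / lo.

Let l_gt0 c : 0 < l c. Proof. exact: lt_le_trans (lo_le c). Qed.
Let lambda_gt0 : 0 < lambda. Proof. exact: lt_trans lambda_gt1. Qed.
Let lk_gt0 k : 0 < lambda ^+ k. Proof. by rewrite exprn_gt0. Qed.
Let hi_gt0 : 0 < hi. Proof. exact: lt_le_trans (le_hi z). Qed.
Let delta_gt0 : 0 < delta.
Proof. by rewrite divr_gt0 // mulr_gt0. Qed.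
Let D_ge0 : 0 <= D. Proof. exact: le_trans (S_quasi [::] [::]). Qed.
Let B_ge0 : 0 <= B. Proof. exact: le_trans (S_letter z). Qed.

Let S_sub u v : S (u ++ v) + D <= (S u + D) + (S v + D).
Proof. by have := S_quasi u v; rewrite ler_norml => /andP[_]; lra. Qed.

Let S_nil : S [::] <= D.
Proof. by have := S_quasi [::] [::]; rewrite ler_norml /= => /andP[]; lra. Qed.

Let S_sum k c w : S (iter k sub_word (c :: w)) + D <= \sum_(b <- c :: w) F k b.
Proof.
elim: w c => [|d w IH] c; first by rewrite big_seq1.
rewrite -cat1s iter_sub_word_cat big_cat big_seq1 /=.
by apply: le_trans (S_sub _ _) _; rewrite lerD2l.
Qed.

Lemma upper_rateP k c : F k c <= upper_rate k * (lambda ^+ k * l c).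
Proof.
elim: k c => [|k IH] c.
  rewrite /F /= mul1r mulrAC ler_pdivlMr //.
  have := S_letter c; rewrite ler_norml => /andP[_ hS].
  have h1 : S [:: c] + D <= B + D by rewrite lerD2r.
  have h0 : 0 <= B + D by rewrite addr_ge0.
  apply: (le_trans (ler_wpM2r (ltW lo_gt0) h1)).
  by apply: ler_wpM2l.
have -> : F k.+1 c = S (iter k sub_word (s c)) + D.
  by rewrite /F iterSr /= /sub_word /= cats0.
have : S (iter k sub_word (s c)) + D <= \sum_(b <- s c) F k b.
  by case: (s c) (s_z c) => // d w _; exact: S_sum.
move=> /le_trans; apply.
rewrite (big_rem _ (s_z c)) /=.
have : \sum_(b <- rem z (s c)) F k b <=
    upper_rate k * lambda ^+ k * (lambda * l c - l z).
  rewrite -l_eigen (big_rem _ (s_z c)) /= addrAC subrr add0r mulr_sumr.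
  by apply: ler_sum => b _; rewrite -mulrA.
set v := upper_rate k; set Fz := F k z; set L := lambda ^+ k.
have L0 : 0 < L := lk_gt0 k.
pose X := v - Fz / (L * l z).
have X0 : 0 <= X by rewrite subr_ge0 ler_pdivrMr ?mulr_gt0 //; exact: IH.
have eF : Fz = (v - X) * (L * l z).
  by rewrite /X opprB addrC subrK divfK // lt0r_neq0 // mulr_gt0.
move=> h; rewrite exprS -/L -/X eF; move: X X0 {eF} => X X0.
have h2 : delta * (lambda * l c) <= l z.
  rewrite /delta mulrAC ler_pdivrMr ?mulr_gt0 // ler_wpM2l //; first exact: ltW.
  by rewrite ler_wpM2l // ltW.
have h3 : 0 <= (X * L) * (l z - delta * (lambda * l c)).
  by apply: mulr_ge0; rewrite ?subr_ge0 // mulr_ge0 // ltW.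
nra.
Qed.

Lemma upper_rateS k : upper_rate k.+1 <= upper_rate k.
Proof.
rewrite /= gerBl mulr_ge0 //; first exact: ltW.
rewrite subr_ge0 ler_pdivrMr ?mulr_gt0 //; exact: upper_rateP.
Qed.

Lemma upper_rate_infix k : exists C, forall n c w,
  infix w (iter n sub_word [:: c]) -> S w <= upper_rate k * weight w + C.
Proof.
have Sp p : (size p <= K ^ k)%N -> S p + D <= (B + D) * (K ^ k)%:R + 2 * D.
  move=> hp; apply: (@le_trans _ _ ((B + D) * (size p)%:R + 2 * D)); last first.
    by rewrite lerD2r ler_wpM2l ?addr_ge0 // ler_nat.
  elim: p {hp} => [|c p IH].
    by rewrite mulr0 add0r mulr2n mulrDl mul1r lerD2r.
  have := S_sub [:: c] p; rewrite cat1s -[size (_ :: _)]addn1 natrD => h.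
  by have := S_letter c; rewrite ler_norml => /andP[_]; lra.
have Sb b : S (iter k sub_word b) + D <= upper_rate k * (lambda ^+ k * weight b) + 2 * D.
  case: b => [|c b].
    have -> : iter k sub_word [::] = [::] by rewrite iter_sub_word_flatten.
    by rewrite /weight big_nil !mulr0 add0r mulr2n mulrDl mul1r lerD2r.
  apply: le_trans (S_sum _ _ _) _.
  rewrite /weight -[leLHS]addr0 lerD ?mulr_ge0 //.
  rewrite !mulr_sumr; apply: ler_sum => d _; exact: upper_rateP.
pose M := (K ^ k)%:R : R.
exists (2 * ((B + D) * M + 2 * D) + 2 * D + `|upper_rate k| * (2 * (M * hi))).
move=> n c w /(infix_iter_sub_word k)[p [b [q [-> hp hq]]]].
have h1 := S_sub p (iter k sub_word b ++ q).
have h2 := S_sub (iter k sub_word b) q.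
rewrite !weight_cat weight_iter.
have h3 := Sp _ hp; have h4 := Sp _ hq; have h5 := Sb b.
rewrite -/M in h3 h4.
have wM u : (size u <= K ^ k)%N -> 0 <= weight u <= M * hi.
  move=> hu; apply/andP; split.
    by apply: le_trans (weight_ge u); rewrite mulr_ge0 // ltW.
  apply: le_trans (weight_le u) _; rewrite ler_pM2r //; by rewrite ler_nat.
have /andP[p0 p1] := wM _ hp; have /andP[q0 q1] := wM _ hq.
have h6 : - (`|upper_rate k| * (2 * (M * hi))) <= upper_rate k * (weight p + weight q).
  rewrite lerNl -mulrN; apply: le_trans (ler_norm _) _.
  rewrite normrM normrN ler_wpM2l // ger0_norm ?addr_ge0 //; lra.
have := D_ge0; lra.
Qed.

End QuasiAdditive.

(** The upper rates of [S] and [- S] enclose a common value: their sum tends to 0,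
since at each level it decreases by the share [delta] of its excess over
[2 D / (lambda^k l z)], the contributions of [z] to the two rates being opposite up
to [2 D]. *)
Theorem quasi_additive_average (S : seq T -> R) (B D : R) :
  (forall u v, `|S (u ++ v) - S u - S v| <= D) ->
  (forall c, `|S [:: c]| <= B) ->
  exists kappa : R, forall e : R, 0 < e -> exists n0 : nat,
    forall n c w, infix w (iter n sub_word [:: c]) -> (n0 <= size w)%N ->
    `|S w - kappa * weight w| <= e * weight w.
Proof.
move=> Sq Sl.
pose S' := fun w => - S w.
have Sq' u v : `|S' (u ++ v) - S' u - S' v| <= D.
  have -> : S' (u ++ v) - S' u - S' v = - (S (u ++ v) - S u - S v).
    by rewrite /S'; ring.
  by rewrite normrN.
have Sl' c : `|S' [:: c]| <= B by rewrite /S' normrN.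
pose v := upper_rate S B D; pose v' := upper_rate S' B D.
have l_gt0 c : 0 < l c by exact: lt_le_trans (lo_le c).
have lambda_gt0 : 0 < lambda by exact: lt_trans lambda_gt1.
have lk_gt0 k : 0 < lambda ^+ k * l z by rewrite mulr_gt0 // exprn_gt0.
have hi_gt0 : 0 < hi by exact: lt_le_trans (le_hi z).
have delta_gt0 : 0 < delta by rewrite divr_gt0 // mulr_gt0.
have D_ge0 : 0 <= D by exact: le_trans (Sq [::] [::]).
have vS k : v k.+1 <= v k by exact: upper_rateS.
have vS' k : v' k.+1 <= v' k by exact: upper_rateS.
have vd i j : (i <= j)%N -> v j <= v i.
  by move=> /subnKC <-; elim: (j - i)%N => [|m IH]; rewrite ?addn0 // addnS (le_trans _ IH).
have vd' i j : (i <= j)%N -> v' j <= v' i.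
  by move=> /subnKC <-; elim: (j - i)%N => [|m IH]; rewrite ?addn0 // addnS (le_trans _ IH).
pose G k := 2 * D / (lambda ^+ k * l z).
have G0 k : 0 <= G k.
  by apply: divr_ge0; [rewrite mulr_ge0 | exact: ltW].
have wS k : v k.+1 + v' k.+1 = (v k + v' k) - delta * (v k + v' k - G k).
  rewrite /v /v' /= /G; move: delta (upper_rate _ _ _ _) (upper_rate _ _ _ _).
    move=> d x y; rewrite /S'; move: (lk_gt0 k) => /lt0r_neq0.
    by move: (lambda ^+ k * l z) => L L0; field.
have w_ge k : G k <= v k + v' k.
  have := upper_rateP Sq Sl k z; have := upper_rateP Sq' Sl' k z.
  rewrite -/v -/v' -!ler_pdivrMr // => h1 h2.
  apply: le_trans (lerD h2 h1); rewrite -mulrDl /G /S' ler_pM2r ?invr_gt0 //; lra.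
have w0 k : 0 <= v k + v' k by exact: le_trans (w_ge k).
have wsmall (e : R) : 0 < e -> exists k, v k + v' k <= e.
  move=> e0; apply: contrapT => /forallNP H.
  have {}H k : e < v k + v' k by rewrite ltNge; apply/negP; exact: H.
  have [k0 hk0] : exists k0, forall k, (k0 <= k)%N -> G k <= e / 2.
    have [k0 hk] : exists k0 : nat, 4 * D / (e * l z * (lambda - 1)) < k0%:R.
      by exists (Num.bound (4 * D / (e * l z * (lambda - 1)))); apply: archi_boundP;
         rewrite divr_ge0 ?mulr_ge0 // ?subr_ge0 ltW.
    exists k0 => k le_k; rewrite /G ler_pdivrMr //.
    move: hk; rewrite ltr_pdivrMr ?mulr_gt0 ?subr_gt0 // => hk.
    have bern : k%:R * (lambda - 1) <= lambda ^+ k.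
      elim: (k) => [|m IH]; first by rewrite mul0r.
      rewrite exprS -natr1 mulrDl mul1r.
      have : 1 <= lambda ^+ m by apply: exprn_ege1; exact: ltW.
      have := lambda_gt1; move: (lambda ^+ m) IH => y; nra.
    have hkk : k0%:R * (lambda - 1) <= lambda ^+ k.
      by apply: le_trans bern; rewrite ler_wpM2r ?ler_nat // subr_ge0 ltW.
    have := ler_wpM2l (ltW (mulr_gt0 e0 (l_gt0 z))) hkk.
    nra.
  have lin n : v (k0 + n)%N + v' (k0 + n)%N <= v k0 + v' k0 - n%:R * (delta * (e / 2)).
    elim: n => [|n IH]; first by rewrite addn0 mul0r subr0.
    rewrite addnS wS -natr1.
    have h1 := H (k0 + n)%N; have h2 := hk0 (k0 + n)%N (leq_addr _ _).
    have : delta * (e / 2) <= delta * (v (k0 + n)%N + v' (k0 + n)%N - G (k0 + n)%N).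
      by rewrite ler_pM2l //; lra.
    lra.
  have de : 0 < delta * (e / 2) by rewrite mulr_gt0 // divr_gt0.
  pose n := Num.bound ((v k0 + v' k0) / (delta * (e / 2))).
  have : (v k0 + v' k0) / (delta * (e / 2)) < n%:R.
    by apply: archi_boundP; rewrite divr_ge0 // ltW.
  rewrite ltr_pdivrMr // => hn.
  have := le_trans (w0 (k0 + n)%N) (lin n); lra.
have uv i j : - v' i <= v j.
  have := w0 (maxn i j).
  have := vd _ _ (leq_maxr i j); have := vd' _ _ (leq_maxl i j); lra.
pose U := [set x | exists i, x = - v' i].
have supU : has_sup U.
  split; first by exists (- v' 0%N), 0%N.
  by exists (v 0%N) => _ [i ->].
exists (sup U) => e e0.
have kv i : sup U <= v i by apply: ge_sup; [exact: supU.1 | move=> _ [j ->]].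
have vk i : - v' i <= sup U by apply: sup_ubound; [exact: supU.2 | exists i].
have e2 : 0 < e / 2 by rewrite divr_gt0.
have [k hk] := wsmall _ e2.
have [C1 hC1] := upper_rate_infix Sq Sl k.
have [C2 hC2] := upper_rate_infix Sq' Sl' k.
pose C := `|C1| + `|C2|.
have C0 : 0 <= C by rewrite addr_ge0.
exists (Num.bound (C / (e / 2 * lo))) => n c w iw sw.
have w1 : C <= e / 2 * weight w.
  have : C / (e / 2 * lo) < (size w)%:R.
    apply: lt_le_trans (archi_boundP _) _; last by rewrite ler_nat.
    by rewrite divr_ge0 // mulr_ge0 // ltW.
  rewrite ltr_pdivrMr ?mulr_gt0 // => h.
  have := ler_wpM2l (ltW e2) (weight_ge w); nra.
have := hC1 _ _ _ iw; have := hC2 _ _ _ iw; rewrite -/v -/v'.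
have wge0 : 0 <= weight w.
  by apply: le_trans (weight_ge w); rewrite mulr_ge0 // ltW.
have k1 := kv k; have k2 := vk k.
have C1n := ler_norm C1; have C2n := ler_norm C2.
have C1p := normr_ge0 C1; have C2p := normr_ge0 C2.
rewrite /C in w1.
have m1 : v k * weight w <= (sup U + e / 2) * weight w by rewrite ler_wpM2r //; lra.
have m2 : v' k * weight w <= (- sup U + e / 2) * weight w by rewrite ler_wpM2r //; lra.
rewrite /S' ler_norml => h1 h2; apply/andP; split; lra.
Qed.

End WordAverages.

(** * Letters as two-sided sequences *)

Lemma near_int_ball (T : topologicalType) (x : T) (P : int -> T -> Prop) n :
  (forall j, \forall y \near x, P j y) ->
  \forall y \near x, forall j, (absz j <= n)%N -> P j y.
Proof.
move=> H; elim: n => [|n IH].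
  by apply: filterS (H 0) => y h j; rewrite leqn0 absz_eq0 => /eqP ->.
apply: filterS3 IH (H n.+1%:Z) (H (- n.+1%:Z)) => y h1 h2 h3 j.
rewrite leq_eqVlt => /orP[/eqP e|]; last by rewrite ltnS; exact: h1.
by have [->|->] : j = n.+1%:Z \/ j = - n.+1%:Z by lia.
Qed.

Section Letters.
Context {N : nat}.
Variable a : nat -> 'I_N.+1.

Definition agree (M : nat) (c d : star_space N) :=
  forall i : int, (absz i <= M)%N -> c i = d i.

Lemma near_agree (c : star_space N) M : \forall d \near c, agree M d c.
Proof. by apply: near_int_ball => i; exact: near_symbol. Qed.

Lemma alphabet_approx (c : alphabet a) M :
  exists i, agree M (val (letter a i)) (val c).
Proof.
have ac : alphabet a (val c) := set_valP c.
by have [_ [[i _ <-] h]] := ac _ (near_agree (val c) M); exists i.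
Qed.

Lemma near_agree_letter (c : alphabet a) M : \forall d \near c, agree M (val d) (val c).
Proof.
have : (val : alphabet a -> star_space N) @ c --> (val c : star_space N).
  exact: initial_continuous.
by move=> /(_ _ (near_agree (val c : star_space N) M)).
Qed.

Lemma val_letter0 i (n : nat) : (val (letter a i) : star_space N) n%:Z = Some (a (n + i)%N).
Proof. exact: iota_seq_pos. Qed.

Lemma letter_pos (c : alphabet a) (n : nat) :
  exists j, (val c : star_space N) n%:Z = Some (a j).
Proof.
have [i h] := alphabet_approx c n.
by exists (n + i)%N; rewrite -h // val_letter0.
Qed.

Lemma next_letterE i : next_letter (letter a i) = letter a i.+1.
Proof. by apply/val_inj; rewrite /= /iota_seq shiftD addrC -PoszD addn1. Qed.

Lemma val_next (c : alphabet a) : val (next_letter c) = shift 1 (val c) :> star_space N.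
Proof. by []. Qed.

Lemma entry0_letter i : entry0 (val (letter a i)) = a i.
Proof. by rewrite /entry0 (val_letter0 i 0). Qed.

(** The case distinction in the substitution is thus read off from one entry, which
is why the substitution is continuous. *)
Lemma letter0_star (c : alphabet a) :
  (val c : star_space N) (-1) = None <-> c = letter a 0.
Proof.
split=> [h|->]; last by [].
have [[i ei]|nf] := pselect (is_finite_letter c); last first.
  by have := limit_letter_no_star (-1) nf; rewrite h.
rewrite ei; case: i ei => // i ei; move: h; rewrite ei /= => /eqP.
by rewrite iota_seq_star; lia.
Qed.

(** The positive finite letters and the limit letters behave alike: both have a left
and a right neighbour. Only [letter a 0] lacks the left one. *)
Lemma subst_casesP (c : alphabet a) :
  (c = letter a 0 /\
   subst c = nseq (a 0) (letter a 0) ++ [:: next_letter c]) \/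
  (c <> letter a 0 /\ exists p : alphabet a, val p = shift (-1) (val c) :> star_space N /\
   subst c = nseq (entry0 (val c)) (letter a 0) ++ [:: p; next_letter c]).
Proof.
have [[i ->]|nf] := pselect (is_finite_letter c).
  rewrite next_letterE; case: i => [|i]; [left|right].
    by rewrite subst_letter0.
  split=> [/letter_inj //|]; exists (letter a i); split.
    by rewrite /= /iota_seq shiftD (_ : -1 + i.+1%:Z = i%:Z) //; lia.
  by rewrite subst_letterS entry0_letter.
right; split=> [e|]; first by apply: nf; exists 0.
by exists (limit_prev nf); rewrite (subst_limit nf).
Qed.

End Letters.

(** * Two-sided exponential sums *)

Section TwoSided.
Context {R : realType}.
Variable q : R.
Hypotheses (q_gt0 : 0 < q) (q_lt1 : q < 1).

(** The sum over all integers [i] of [q^|i| W i] is organized as a series over the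
natural numbers by grouping the indices [m] and [- m - 1]. *)
Definition two_sided_term (W : int -> R) (m : nat) : R :=
  q ^+ m * W m%:Z + q ^+ m.+1 * W (- m.+1%:Z).

Definition two_sided (W : int -> R) : R := limn (series (two_sided_term W)).

Lemma geometric_sum_le n m : \sum_(n <= k < m) q ^+ k <= q ^+ n / (1 - q).
Proof.
have q1 : 0 < 1 - q by rewrite subr_gt0.
have [le_nm|/ltnW lt_mn] := leqP n m; last first.
  by rewrite big_geq // divr_ge0 ?exprn_ge0 // ltW.
rewrite ler_pdivlMr // -(subnKC le_nm).
suff -> : (\sum_(n <= k < n + (m - n)) q ^+ k) * (1 - q) = q ^+ n - q ^+ (n + (m - n)).
  by rewrite gerBl exprn_ge0 // ltW.
elim: (m - n)%N => [|j IH]; first by rewrite addn0 big_geq // mul0r subrr.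
rewrite addnS big_nat_recr ?leq_addr //= mulrDl IH exprS; ring.
Qed.

Lemma geometric_small (C e : R) : 0 <= C -> 0 < e -> exists M : nat, forall m, (M <= m)%N -> C * q ^+ m <= e.
Proof.
move=> C0 e0.
have h : (fun n => C * q ^+ n) @ \oo --> 0.
  rewrite -[0](mulr0 C); apply: cvgM; first exact: cvg_cst.
  by apply: cvg_expr; rewrite ger0_norm // ltW.
have [M _ hM] := (@cvgrPdist_le _ _ _ _ _ _ _).1 h _ e0.
exists M => m Mm; have := hM m Mm; rewrite sub0r normrN ger0_norm //.
by rewrite mulr_ge0 // exprn_ge0 // ltW.
Qed.

Variable B : R.

Lemma two_sided_term_le W m : (forall i, `|W i| <= B) ->
  `|two_sided_term W m| <= 2 * B * q ^+ m.
Proof.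
move=> WB; rewrite /two_sided_term.
have qm : 0 <= q ^+ m by rewrite exprn_ge0 // ltW.
apply: le_trans (ler_normD _ _) _; rewrite !normrM exprS normrM !(ger0_norm qm) (gtr0_norm q_gt0).
have h1 := WB m%:Z; have h2 := WB (- m.+1%:Z).
have := ler_wpM2l qm h1; have : q * q ^+ m * `|W (- m.+1%:Z)| <= 1 * q ^+ m * B.
  by apply: ler_pM => //; [rewrite mulr_ge0 // ltW | rewrite ler_wpM2r // ltW].
lra.
Qed.

Lemma two_sided_cvg W : (forall i, `|W i| <= B) ->
  series (two_sided_term W) @ \oo --> two_sided W.
Proof.
move=> WB; suff : cvgn (series (two_sided_term W)) by [].
apply: normed_cvg; apply: (@series_le_cvg _ _ (geometric (2 * B) q)).
- by move=> n /=.
- move=> n /=; rewrite mulr_ge0 ?exprn_ge0 //; last exact: ltW.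
  by rewrite mulr_ge0 // (le_trans _ (WB 0)).
- by move=> n; apply: two_sided_term_le.
- by apply: is_cvg_geometric_series; rewrite ger0_norm // ltW.
Qed.

Lemma two_sided_agree W V M : (forall i, `|W i| <= B) -> (forall i, `|V i| <= B) ->
  (forall i : int, (absz i <= M)%N -> W i = V i) ->
  `|two_sided W - two_sided V| <= 4 * B / (1 - q) * q ^+ M.
Proof.
move=> WB VB WV.
have cv : series (two_sided_term W) n - series (two_sided_term V) n @[n --> \oo] -->
    two_sided W - two_sided V by apply: cvgB; exact: two_sided_cvg.
have cv' : `|series (two_sided_term W) n - series (two_sided_term V) n| @[n --> \oo] -->
    `|two_sided W - two_sided V| by exact: cvg_norm cv.
have B0 : 0 <= B by exact: le_trans (WB 0).
rewrite -(cvg_lim _ cv') //; apply: limr_le; first by apply/cvg_ex; eexists; exact: cv'.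
near=> n; rewrite /series /= -sumrB.
apply: (@le_trans _ _ (\sum_(M <= k < n) 4 * B * q ^+ k)); last first.
  rewrite -mulr_sumr -[leRHS]mulrA ler_wpM2l ?mulr_ge0 // mulrC.
  exact: geometric_sum_le.
have Mn : (M <= n)%N by near: n; exact: nbhs_infty_ge.
rewrite (big_cat_nat (leq0n M) Mn) //=.
rewrite big_nat big1 ?add0r => [|k /andP[_ kM]].
  apply: le_trans (ler_norm_sum _ _ _) _; apply: ler_sum => k _.
  apply: le_trans (ler_normB _ _) _.
  have := two_sided_term_le k WB; have := two_sided_term_le k VB; lra.
by rewrite /two_sided_term !WV ?subrr //; lia.
Unshelve. all: by end_near. Qed.

(** The weights satisfy [q^|i + 1| + q^|i - 1| = (q + q^-1) q^|i|] for all [i] except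
[i = 0], where the two sides differ by [q^-1 - q]. *)
Lemma two_sided_shift W : (forall i, `|W i| <= B) ->
  two_sided (shift 1 W) + two_sided (shift (-1) W) =
  (q + q^-1) * two_sided W - (q^-1 - q) * W 0.
Proof.
move=> WB.
have SB k i : `|shift k W i| <= B by exact: WB.
pose E n := q ^- 1 * q ^+ n * W n%:Z - q ^+ n * W (n%:Z - 1)
  + q ^+ n * W (- n.+1%:Z) - q ^+ n.+1 * W (- n%:Z).
have key n : series (two_sided_term (shift 1 W)) n + series (two_sided_term (shift (-1) W)) n =
  (q + q^-1) * series (two_sided_term W) n - (q^-1 - q) * W 0 + E n.
  elim: n => [|n IH].
    rewrite /series /= !big_geq // /E expr0 oppr0 sub0r; ring.
  rewrite !seriesSr /= addrACA IH mulrDr /E /two_sided_term /shift.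
  have -> : n.+1%:Z - 1 = n%:Z by lia.
  have -> : - n.+2%:Z = - n.+1%:Z + -1 by lia.
  have -> : n%:Z + 1 = n.+1%:Z by lia.
  have -> : - n.+1%:Z + 1 = - n%:Z by lia.
  rewrite !exprS expr0; have q0 : q != 0 by rewrite lt0r_neq0.
  by field.
have E0 : E n @[n --> \oo] --> 0.
  apply/cvgrPdist_le => e e0.
  have B0 : 0 <= B by exact: le_trans (WB 0).
  have C0 : 0 <= (q^-1 + 3) * B by rewrite mulr_ge0 // addr_ge0 // invr_ge0 ltW.
  have [M hM] := geometric_small C0 e0.
  exists M => // n /= /hM h; rewrite sub0r normrN; apply: le_trans h.
  have qn : 0 <= q ^+ n by rewrite exprn_ge0 // ltW.
  have Hb x i : 0 <= x -> `|x * q ^+ n * W i| <= x * q ^+ n * B.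
    by move=> x0; rewrite normrM ger0_norm ?mulr_ge0 // ler_wpM2l // mulr_ge0.
  have -> : E n = q^-1 * q ^+ n * W n%:Z - 1 * q ^+ n * W (n%:Z - 1) + 1 * q ^+ n * W (- n.+1%:Z)
     - q * q ^+ n * W (- n%:Z) by rewrite /E !mul1r -exprS expr1.
  apply: le_trans (ler_normB _ _) _.
  have h1 := ler_normD (q^-1 * q ^+ n * W n%:Z - 1 * q ^+ n * W (n%:Z - 1)) (1 * q ^+ n * W (- n.+1%:Z)).
  have h2 := ler_normB (q^-1 * q ^+ n * W n%:Z) (1 * q ^+ n * W (n%:Z - 1)).
  have h3 : `|q^-1 * q ^+ n * W n%:Z| <= q^-1 * q ^+ n * B by apply: Hb; rewrite invr_ge0 ltW.
  have h4 : `|1 * q ^+ n * W (n%:Z - 1)| <= 1 * q ^+ n * B by apply: Hb.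
  have h5 : `|1 * q ^+ n * W (- n.+1%:Z)| <= 1 * q ^+ n * B by apply: Hb.
  have h6 : `|q * q ^+ n * W (- n%:Z)| <= q * q ^+ n * B by apply: Hb; rewrite ltW.
  have h7 : q * q ^+ n * B <= 1 * q ^+ n * B by rewrite !ler_wpM2r // ltW.
  by move: (q^-1) h1 h2 h3 h4 h5 h6 h7 => r; lra.
have rhs : (q + q^-1) * series (two_sided_term W) n - (q^-1 - q) * W 0 + E n @[n --> \oo] -->
    (q + q^-1) * two_sided W - (q^-1 - q) * W 0 + 0.
  apply: cvgD => //; apply: cvgB; last exact: cvg_cst.
  by apply: cvgM; [exact: cvg_cst | exact: two_sided_cvg].
have lhs : (q + q^-1) * series (two_sided_term W) n - (q^-1 - q) * W 0 + E n @[n --> \oo] -->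
    two_sided (shift 1 W) + two_sided (shift (-1) W).
  under eq_fun do rewrite -key; apply: cvgD; exact: two_sided_cvg.
by rewrite -(cvg_lim _ lhs) // (cvg_lim _ rhs) // addr0.
Qed.

Lemma two_sided_ge W : (forall i, `|W i| <= B) ->
  (forall m : nat, 1 <= W m%:Z) -> (forall i, - (1 - q) <= W i) ->
  1 - q <= two_sided W.
Proof.
move=> WB W1 Wq; rewrite -(cvg_lim _ (two_sided_cvg WB)) //.
apply: limr_ge; first by apply/cvg_ex; eexists; exact: two_sided_cvg.
suff H n : 1 - q <= series (two_sided_term W) n.+1.
  by exists 1%N => // -[] // n _; exact: H.
elim: n => [|n IH].
  rewrite /series /= big_nat1 /two_sided_term expr0 mul1r expr1.
  have := W1 0%N; have := Wq (- 1%:Z); have := q_gt0; have := q_lt1; nra.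
rewrite seriesSr; apply: le_trans IH _; rewrite lerDl /two_sided_term [q ^+ n.+2]exprS.
have qn : 0 <= q ^+ n.+1 by rewrite exprn_ge0 // ltW.
have : 0 <= W n.+1 + q * W (- n.+2%:Z).
  have := W1 n.+1; have := Wq (- n.+2%:Z); have := q_gt0; have := q_lt1; nra.
by move=> /(mulr_ge0 qn); rewrite mulrDr mulrCA mulrA.
Qed.

End TwoSided.

(** * The inflation factor and the tile lengths *)

Section InflationSeries.
Context {R : realType} {N : nat}.
Variable a : nat -> 'I_N.+1.
Hypothesis a_gt0 : forall n, (0 < a n)%N.

(** Its sum takes the value 1 at the point [q] for which [q + q^-1] is the inflation
factor. *)
Definition inflation_series (x : R) : R^nat := series (fun j => (a j)%:R * x ^+ j.+1).

Lemma inflation_seriesS x n :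
  inflation_series x n.+1 = inflation_series x n + (a n)%:R * x ^+ n.+1.
Proof. by rewrite /inflation_series seriesSr. Qed.

Lemma inflation_series0 x : inflation_series x 0 = 0.
Proof. by rewrite /inflation_series /series /= big_geq. Qed.

Lemma a_ge1 n : 1 <= (a n)%:R :> R.
Proof. by rewrite ler1n. Qed.

Lemma a_leN n : (a n)%:R <= N%:R :> R.
Proof. by rewrite ler_nat -ltnS. Qed.

Lemma inflation_series_gap x y n : 0 <= x -> x <= y ->
  inflation_series x n.+1 + (y - x) <= inflation_series y n.+1.
Proof.
move=> x0 xy; elim: n => [|n IH].
  rewrite !inflation_seriesS !inflation_series0 !add0r !expr1.
  by have := a_ge1 0; nra.
rewrite 2!(inflation_seriesS _ n.+1) addrAC lerD //.
by rewrite ler_wpM2l // lerXn2r ?nnegrE // (le_trans x0).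
Qed.

Lemma inflation_series_lip x y n : 0 <= x -> x <= y -> y <= 3 / 4 ->
  inflation_series y n <= inflation_series x n + 16 * N%:R * (y - x).
Proof.
move=> x0 xy y34.
have y0 : 0 <= y by exact: le_trans xy.
have pw m : y ^+ m.+1 - x ^+ m.+1 <= m.+1%:R * (3 / 4) ^+ m * (y - x).
  elim: m => [|m IH]; first by rewrite !expr1 expr0; lra.
  rewrite [y ^+ m.+2]exprS [x ^+ m.+2]exprS.
  have h1 : y * (y ^+ m.+1 - x ^+ m.+1) <= (3 / 4) * (m.+1%:R * (3 / 4) ^+ m * (y - x)).
    apply: ler_pM => //; by rewrite subr_ge0 lerXn2r ?nnegrE.
  have h2 : x ^+ m.+1 <= (3 / 4) ^+ m.+1.
    by rewrite lerXn2r ?nnegrE //; lra.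
  have h3 : x ^+ m.+1 * (y - x) <= (3 / 4) ^+ m.+1 * (y - x) by rewrite ler_wpM2r // subr_ge0.
  rewrite -[m.+2%:R]natr1; rewrite [(3 / 4) ^+ m.+1]exprS in h2 h3 *; move: (m.+1%:R : R) ((3 / 4 : R) ^+ m) (y ^+ m.+1) (x ^+ m.+1) h1 h3.
  move=> M Q Y X; nra.
suff : inflation_series y n - inflation_series x n <=
    N%:R * ((16 - (4 * n%:R + 16) * (3 / 4) ^+ n) * (y - x)).
  have : 0 <= N%:R * ((4 * n%:R + 16) * (3 / 4) ^+ n * (y - x)).
    apply: mulr_ge0 => //; apply: mulr_ge0; last by rewrite subr_ge0.
    by apply: mulr_ge0; [rewrite addr_ge0 // mulr_ge0 | rewrite exprn_ge0].
  lra.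
elim: n => [|n IH]; first by rewrite !inflation_series0 expr0; lra.
rewrite !inflation_seriesS.
have h1 : (a n)%:R * (y ^+ n.+1 - x ^+ n.+1) <= N%:R * (n.+1%:R * (3 / 4) ^+ n * (y - x)).
  apply: ler_pM => //; last exact: a_leN.
  by rewrite subr_ge0 lerXn2r ?nnegrE.
rewrite -natr1 in h1 *; rewrite [(3 / 4) ^+ n.+1]exprS.
move: ((3 / 4 : R) ^+ n) h1 IH => Q; lra.
Qed.

Lemma inflation_series_nd x n : 0 <= x -> inflation_series x n <= inflation_series x n.+1.
Proof. by move=> x0; rewrite inflation_seriesS lerDl mulr_ge0 // exprn_ge0. Qed.

Lemma inflation_root_exists : exists q : R,
  [/\ 0 < q, q < 1 & inflation_series q @ \oo --> (1 : R)].
Proof.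
(* As [a_0] and [a_1] are positive and [3 / 4 + (3 / 4)^2 > 1], the root lies below
   [3 / 4], where the series has a bounded derivative. *)
pose S := [set x : R | 0 <= x <= 3 / 4 /\ forall n, inflation_series x n <= 1].
have S0 : S 0.
  split; first by apply/andP; split; lra.
  move=> n; suff -> : inflation_series 0 n = 0 by [].
  by elim: n => [|n IH]; rewrite ?inflation_series0 // inflation_seriesS IH expr0n /= mulr0 addr0.
have supS : has_sup S.
  by split; [exists 0 | exists (3 / 4) => x [/andP[_ ?]]].
pose q := sup S.
have q0 : 0 <= q by apply: sup_ubound => //; exact: supS.2.
have q34 : q <= 3 / 4 by apply: ge_sup; [exact: supS.1 | move=> x [/andP[_ ?]]].
have N0 : (0 : R) < N%:R.
  by apply: lt_le_trans (a_leN 0); apply: lt_le_trans (a_ge1 0).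
have C0 : 0 < 16 * N%:R :> R by rewrite mulr_gt0.
have qle n : inflation_series q n <= 1.
  apply/ler_addgt0Pr => e e0.
  have [x [/andP[x0 x34] xS] qx] := sup_adherent (divr_gt0 e0 C0) supS.
  have xq : x <= q by apply: sup_ubound; [exact: supS.2 | split=> //; exact/andP].
  apply: le_trans (inflation_series_lip n x0 xq q34) _; apply: lerD; first exact: xS.
  rewrite mulrC -ler_pdivlMr //; move: qx; rewrite -/q; lra.
have q34' : q < 3 / 4.
  rewrite ltNge; apply/negP => h; have := qle 2.
  rewrite !inflation_seriesS inflation_series0 add0r expr1 expr2.
  by have := a_ge1 0; have := a_ge1 1; nra.
have near1 e : 0 < e -> exists n, 1 - e < inflation_series q n.
  move=> e0; apply: contrapT => /forallNP H.
  pose d := Num.min (e / (16 * N%:R)) (3 / 4 - q).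
  have d0 : 0 < d by rewrite lt_min divr_gt0 //= subr_gt0.
  have de : d <= e / (16 * N%:R) by rewrite ge_min lexx.
  have dq : d <= 3 / 4 - q by rewrite ge_min lexx orbT.
  suff : S (q + d) by move=> /(sup_ubound supS.2); rewrite -/q; lra.
  split; first by apply/andP; split; lra.
  move=> n; have qd : q <= q + d by lra.
  have qd34 : q + d <= 3 / 4 by lra.
  apply: le_trans (inflation_series_lip n q0 qd qd34) _.
  have /negP := H n; rewrite -leNgt => h.
  move: de; rewrite ler_pdivlMr // => de; lra.
have nd : {homo inflation_series q : n m / (n <= m)%N >-> n <= m}.
  by apply/nondecreasing_seqP => n; exact: inflation_series_nd.
exists q; split; last 1 first.
- apply/cvgrPdist_lt => e /near1[n hn]; exists n => // m /= /nd h.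
  by rewrite ger0_norm ?subr_ge0 //; lra.
- rewrite lt0r q0 andbT; apply/eqP => q00.
  have [|n] := near1 1; first by [].
  rewrite subrr q00; suff -> : inflation_series 0 n = 0 by rewrite ltxx.
  by elim: n => [|n IH]; rewrite ?inflation_series0 // inflation_seriesS IH expr0n /= mulr0 addr0.
- lra.
Qed.

Lemma inflation_root_unique (x y : R) : 0 < x -> 0 < y ->
  inflation_series x @ \oo --> (1 : R) -> inflation_series y @ \oo --> (1 : R) -> x = y.
Proof.
have H (u v : R) : 0 < u -> inflation_series u @ \oo --> (1 : R) ->
    inflation_series v @ \oo --> (1 : R) -> v <= u.
  move=> u0 cu cv; rewrite leNgt; apply/negP => uv.
  have : (v - u) + 1 <= 1; last by lra.
  have cu' : (v - u) + inflation_series u n @[n --> \oo] --> (v - u) + 1.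
    by apply: cvgD => //; exact: cvg_cst.
  rewrite -{2}(cvg_lim _ cv) // -(cvg_lim _ cu') //; apply: ler_lim.
  - by apply/cvg_ex; eexists; exact: cu'.
  - by apply/cvg_ex; eexists; exact: cv.
  exists 1%N => // -[//|n] _ /=; rewrite addrC.
  by apply: inflation_series_gap; exact: ltW.
by move=> x0 y0 cx cy; apply/eqP; rewrite eq_le !H.
Qed.

End InflationSeries.

Section TileLength.
Context {R : realType} {N : nat}.
Variable a : nat -> 'I_N.+1.
Hypothesis a_gt0 : forall n, (0 < a n)%N.

Lemma entry0_gt0 (c : alphabet a) : (0 < entry0 (val c))%N.
Proof. by have [j h] := letter_pos c 0; rewrite /entry0 h. Qed.

Section Explicit.
Variable q : R.
Hypotheses (q_gt0 : 0 < q) (q_lt1 : q < 1)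
  (q_root : inflation_series a q @ \oo --> (1 : R)).

(** The weight of an absent entry is the one for which the lengths satisfy the
eigenvalue equation at [letter a 0] too, see [two_sided_boundary]. *)
Definition symbol_weight (x : star_symbol N) : R :=
  if x is Some k then (k : nat)%:R else - (1 - q).

Definition letter_weight (c : star_space N) : int -> R := fun i => symbol_weight (c i).

Let kappa := q^-1 - q.

(** The eigenvalue equation reads [(q + q^-1) l c - l (next c) - l (prev c) = c_0]; it is
solved by the two-sided exponential sum of the entries, the kernel of the
resolvent of the sum of the two shifts. Dividing by [kappa] gives [letter a 0]
length 1. *)
Definition tile_length (c : alphabet a) : R :=
  two_sided q (letter_weight (val c)) / kappa.

Let q1 : 1 < q^-1. Proof. by rewrite invf_gt1. Qed.
Let kappa_gt0 : 0 < kappa.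
Proof. by rewrite subr_gt0 (lt_trans q_lt1). Qed.

Lemma letter_weight_le c i : `|letter_weight c i| <= N.+1%:R.
Proof.
rewrite /letter_weight; case: (c i) => [k|] /=.
  by rewrite ger0_norm // ler_nat ltnW.
rewrite normrN ger0_norm ?subr_ge0 1?ltW //.
have : 1 <= N.+1%:R :> R by rewrite ler1n.
by have := q_gt0; lra.
Qed.

Lemma letter_weight_ge c i : - (1 - q) <= letter_weight c i.
Proof.
rewrite /letter_weight; case: (c i) => [k|] //=.
by rewrite (@le_trans _ _ 0) // oppr_le0 subr_ge0 ltW.
Qed.

Lemma letter_weight_shift k (c : star_space N) :
  letter_weight (shift k c) = shift k (letter_weight c).
Proof. by []. Qed.

Lemma tile_length_ge c : (1 - q) / kappa <= tile_length c.
Proof.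
rewrite ler_pM2r ?invr_gt0 //; apply: (two_sided_ge q_gt0 q_lt1 (letter_weight_le (val c))) => i.
  have [j h] := letter_pos c i.
  by rewrite /letter_weight h /= ler1n a_gt0.
exact: letter_weight_ge.
Qed.

Lemma tile_length_agree (e : R) : 0 < e -> exists M, forall c d : alphabet a,
  agree M (val c) (val d) -> `|tile_length c - tile_length d| <= e.
Proof.
move=> e0.
have C0 : 0 <= 4 * N.+1%:R / (1 - q) :> R by rewrite divr_ge0 ?mulr_ge0 ?subr_ge0 // ltW.
have [M hM] := geometric_small q_gt0 q_lt1 C0 (mulr_gt0 e0 kappa_gt0).
exists M => c d cd; rewrite -mulrBl normrM [`|kappa^-1|]ger0_norm ?invr_ge0 ?(ltW kappa_gt0) //.
rewrite ler_pdivrMr //; apply: le_trans (hM M (leqnn _)).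
apply: (two_sided_agree q_gt0 q_lt1) => i; try exact: letter_weight_le.
by move=> hi; rewrite /letter_weight cd.
Qed.

Lemma tile_length_letter0 : tile_length (letter a 0) = 1.
Proof.
rewrite /tile_length.
suff -> : two_sided q (letter_weight (val (letter a 0))) = kappa by rewrite divff // lt0r_neq0.
have e n : series (two_sided_term q (letter_weight (val (letter a 0)))) n =
    q^-1 * inflation_series a q n - q * (1 - q ^+ n).
  elim: n => [|n IH]; first by rewrite /inflation_series /series /= !big_geq // expr0; ring.
  rewrite seriesSr IH inflation_seriesS /two_sided_term {1}/letter_weight val_letter0 addn0.
  have -> : letter_weight (val (letter a 0)) (- n.+1%:Z) = - (1 - q).
    rewrite /letter_weight; suff -> : (val (letter a 0) : star_space N) (- n.+1%:Z) = None by [].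
    by apply/eqP; rewrite /= iota_seq_star; lia.
  rewrite /symbol_weight.
  have q0 : q != 0 by rewrite lt0r_neq0.
  by rewrite !exprS; field.
have h := two_sided_cvg q_gt0 q_lt1 (letter_weight_le (val (letter a 0))).
rewrite -(cvg_lim _ h) //; apply: cvg_lim => //.
rewrite (funext e).
have -> : kappa = q^-1 * 1 - q * (1 - 0) by rewrite /kappa; ring.
apply: cvgB; first by apply: cvgM => //; exact: cvg_cst.
apply: cvgM; first exact: cvg_cst.
by apply: cvgB; [exact: cvg_cst | apply: cvg_expr; rewrite ger0_norm // ltW].
Qed.

(** The letter [letter a 0] has no left neighbour. Its eigenvalue equation holds all
the same because the sequence in that place gets length zero, by the equation
of [q]. *)
Lemma two_sided_boundary :
  two_sided q (letter_weight (shift (-1) (base_seq a))) = 0.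
Proof.
set W := letter_weight _.
have e n : series (two_sided_term q W) n.+1 = inflation_series a q n - 1 + q ^+ n * (q * q).
  elim: n => [|n IH].
    rewrite seriesSr inflation_series0 /series /= big_geq // /two_sided_term /W /letter_weight /=.
    rewrite expr0 expr1; ring.
  rewrite seriesSr IH inflation_seriesS /two_sided_term.
  have -> : W n.+1%:Z = (a n)%:R.
    by rewrite /W /letter_weight /shift (_ : n.+1%:Z + -1 = n%:Z) //; lia.
  have -> : W (- n.+2%:Z) = - (1 - q) by [].
  rewrite !exprS; ring.
have h := two_sided_cvg q_gt0 q_lt1 (letter_weight_le (shift (-1) (base_seq a))).
rewrite -(cvg_lim _ h) //; apply: cvg_lim => //.
rewrite -(cvg_shiftn 1%N); under eq_fun do rewrite addn1 e.
have qn : q ^+ n @[n --> \oo] --> (0 : R) by apply: cvg_expr; rewrite ger0_norm // ltW.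
suff h2 : inflation_series a q n - 1 + q ^+ n * (q * q) @[n --> \oo] --> 1 - 1 + 0 * (q * q).
  by rewrite subrr mul0r addr0 in h2.
apply: cvgD; first by apply: cvgB => //; exact: cvg_cst.
by apply: cvgM => //; exact: cvg_cst.
Qed.

Lemma tile_length_subst c :
  \sum_(b <- subst c) tile_length b = (q + q^-1) * tile_length c.
Proof.
have k0 : kappa != 0 by rewrite lt0r_neq0.
have key := two_sided_shift q_gt0 q_lt1 (letter_weight_le (val c)).
have sumE x s : \sum_(b <- nseq x (letter a 0) ++ s) tile_length b =
    x%:R + \sum_(b <- s) tile_length b.
  rewrite big_cat /=; congr (_ + _).
  by elim: x => [|x IH]; rewrite ?big_nil // big_cons IH tile_length_letter0 -natr1 addrC.
have cE : letter_weight (val c) 0 = (entry0 (val c))%:R.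
  by have [j h] := letter_pos c 0; rewrite /letter_weight /entry0 h.
rewrite cE in key.
have [[c0 ->]|[c0 [p [vp ->]]]] := subst_casesP c; rewrite sumE ?big_cons big_nil addr0.
  have ce : (entry0 (val c) : nat) = a 0%N by rewrite c0 entry0_letter.
  have bd : two_sided q (shift (-1) (letter_weight (val c))) = 0.
    have -> : shift (-1) (letter_weight (val c)) = letter_weight (shift (-1) (base_seq a)).
      by apply/funext => i; rewrite c0 /letter_weight /shift /= /iota_seq /shift addr0.
    exact: two_sided_boundary.
  rewrite bd addr0 ce in key.
  have q0 : q != 0 by rewrite lt0r_neq0.
  by rewrite /tile_length val_next letter_weight_shift key -/kappa; field; rewrite k0.
move: key; rewrite /tile_length vp val_next !letter_weight_shift.
set x := two_sided q (shift 1 _); set y := two_sided q (shift (-1) _).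
move=> key; have -> : x = (q + q^-1) * two_sided q (letter_weight (\val c)) - kappa * (entry0 (\val c))%:R - y.
  by rewrite -key; ring.
have q0 : q != 0 by rewrite lt0r_neq0.
by field; rewrite k0.
Qed.

End Explicit.

Lemma natural_tile_length_exists : exists (l : alphabet a -> R) lambda, natural_tile_length l lambda /\
  (forall e : R, 0 < e -> exists M, forall c d : alphabet a, agree M (val c) (val d) -> `|l c - l d| <= e) /\
  exists lo, 0 < lo /\ forall c, lo <= l c.
Proof.
have [q [q0 q1 qr]] := @inflation_root_exists R N a a_gt0.
have qi : 1 < q^-1 by rewrite invf_gt1.
have kappa_gt0 : 0 < q^-1 - q by rewrite subr_gt0 (lt_trans q1).
have ag := tile_length_agree q0 q1.
have lo : 0 < (1 - q) / (q^-1 - q) by rewrite divr_gt0 // subr_gt0.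
exists (tile_length q), (q + q^-1); split; last first.
  by split => //; exists ((1 - q) / (q^-1 - q)); split=> // c; exact: tile_length_ge.
split.
- move=> c B /nbhs_ballP[e /= e0 eB]; have [M hM] := ag _ (divr_gt0 e0 (ltr0Sn R 1)).
  have FF : Filter (nbhs (c : alphabet a)) := nbhs_filter c.
  have := near_agree_letter c M; apply: filterS => d hd; apply: eB; rewrite /ball /= distrC.
  by apply: le_lt_trans (hM d c hd) _; rewrite ltr_pdivrMr // ltr_pMr // ltr1n.
- by move=> c; apply: lt_le_trans lo _; exact: tile_length_ge.
- lra.
- by move=> c; exact: tile_length_subst.
Qed.

Lemma continuous_letter_bounded (l : alphabet a -> R) : continuous l ->
  exists B, forall c, `|l c| <= B.
Proof.
move=> cl.
have : compact (l @` setT).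
  by apply: continuous_compact; [exact: continuous_subspaceT | exact: alphabet_compact].
move=> /compact_bounded[B [_ hB]].
exists (B + 1) => c; apply: (hB (B + 1)); first by rewrite ltrDl.
by exists c.
Qed.

Lemma continuous_letter_eq (l l' : alphabet a -> R) : continuous l -> continuous l' ->
  (forall i, l (letter a i) = l' (letter a i)) -> forall c, l c = l' c.
Proof.
move=> cl cl' ll c; apply/eqP; rewrite -subr_eq0 -normr_le0; apply/ler_addgt0Pr => e e0.
rewrite add0r.
have e2 : 0 < e / 2 by rewrite divr_gt0.
have nb (f : alphabet a -> R) : continuous f -> nbhs c (f @^-1` ball (f c) (e / 2)).
  by move=> cf; apply: cf; exact: nbhsx_ballx.
have := filterI (nb _ cl) (nb _ cl').
move=> [U [[V oV VU] Uc] UB].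
have ac : alphabet a (val c) := set_valP c.
have Vc : V (val c) by rewrite -VU in Uc.
have [_ [[i _ <-] Vi]] := ac _ (open_nbhs_nbhs (conj oV Vc)).
have [|b1 b2] := UB (letter a i); first by rewrite -VU.
move: b1 b2; rewrite /ball /= -ll => b1 b2.
have -> : l c - l' c = (l c - l (letter a i)) - (l' c - l (letter a i)) by ring.
apply: le_trans (ler_normB _ _) _; lra.
Qed.

Section Natural.
Variables (l : alphabet a -> R) (lambda : R).
Hypothesis nl : natural_tile_length l lambda.

Lemma natural_letter0 : lambda * l (letter a 0) = (a 0%N)%:R * l (letter a 0) + l (letter a 1).
Proof.
have [_ _ _ h] := nl; rewrite -h subst_letter0 big_cat big_seq1 /=; congr (_ + _).
by elim: (a 0%N : nat) => [|n IH] /=; rewrite ?big_nil ?mul0r // big_cons IH -natr1 mulrDl mul1r addrC.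
Qed.

Lemma natural_letterS i : lambda * l (letter a i.+1) =
  (a i.+1)%:R * l (letter a 0) + l (letter a i) + l (letter a i.+2).
Proof.
have [_ _ _ h] := nl; rewrite -h subst_letterS big_cat big_cons big_seq1 /= addrA; congr (_ + _ + _).
by elim: (a i.+1 : nat) => [|n IH] /=; rewrite ?big_nil ?mul0r // big_cons IH -natr1 mulrDl mul1r addrC.
Qed.

Lemma natural_inflation_gt2 : (1 < a 0)%N -> 2 < lambda.
Proof.
move=> a0; have [_ l0 _ _] := nl.
have := natural_letter0; have := l0 (letter a 0); have := l0 (letter a 1).
have : 2 <= (a 0%N)%:R :> R by rewrite ler_nat.
nra.
Qed.

(** The lengths of the finite letters satisfy the recurrence
[lambda l_i = a_i l_0 + l_(i-1) + l_(i+1)]. Multiplied by [q^(i+1)] and summed, it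
telescopes, and the remainder vanishes in the limit because [l] is bounded. *)
Lemma natural_inflation_root : 2 < lambda -> exists q : R,
  [/\ 0 < q, q < 1, lambda = q + q^-1 & inflation_series a q @ \oo --> (1 : R)].
Proof.
move=> l2; have [cl l0 _ _] := nl.
pose d : R := Num.sqrt (lambda ^+ 2 - 4).
have d2 : d ^+ 2 = lambda ^+ 2 - 4 by rewrite sqr_sqrtr //; nra.
have d0 : 0 < d by rewrite sqrtr_gt0; nra.
have dl : d < lambda.
  rewrite ltNge; apply/negP => dl; have : lambda ^+ 2 <= d ^+ 2; last by rewrite d2; lra.
  by apply: lerXn2r => //; rewrite nnegrE; lra.
pose q := (lambda - d) / 2.
have q0 : 0 < q by rewrite /q; lra.
have qr : q ^+ 2 - lambda * q + 1 = 0.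
  have -> : q ^+ 2 - lambda * q + 1 = (d ^+ 2 - lambda ^+ 2 + 4) / 4 by rewrite /q; field.
  by rewrite d2; ring.
have q1 : q < 1 by rewrite /q; nra.
have lq : lambda = q + q^-1.
  have qn0 : q != 0 by rewrite lt0r_neq0.
  have -> : q + q^-1 = (q ^+ 2 + 1) / q by field.
  by rewrite (_ : q ^+ 2 + 1 = lambda * q) ?mulfK //; lra.
exists q; split=> //.
pose x i := l (letter a i).
pose y i := if i is j.+1 then x j else 0.
have key n : inflation_series a q n * x 0%N = x 0%N - q ^+ n * x n + q ^+ n.+1 * y n.
  elim: n => [|n IH]; first by rewrite inflation_series0 /=; ring.
  rewrite inflation_seriesS mulrDl IH.
  have -> : (a n)%:R * q ^+ n.+1 * x 0%N = q ^+ n.+1 * (lambda * x n - y n - x n.+1).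
    have -> : lambda * x n = (a n)%:R * x 0%N + y n + x n.+1.
      by case: (n) => [|m]; rewrite /y /x ?natural_letterS // natural_letter0 addr0.
    move: (x n.+1) (y n) (x 0%N) => ? ? ?; ring.
  have -> : q ^+ n.+1 * (lambda * x n - y n - x n.+1) = q ^+ n * (q * lambda) * x n - q ^+ n.+1 * y n - q ^+ n.+1 * x n.+1.
    by rewrite exprS; ring.
  have -> : q * lambda = q ^+ 2 + 1 by lra.
  rewrite /= !exprS; ring.
have x0 : 0 < x 0%N by exact: l0.
have [B hB] := continuous_letter_bounded cl.
have xB i : `|x i| <= B by exact: hB.
have B0 : 0 <= B by exact: le_trans (xB 0%N).
have yB i : `|y i| <= B by case: i => [|i] /=; rewrite ?normr0.
apply/cvgrPdist_le => e e0.
have C0 : 0 <= 2 * B / x 0%N by rewrite divr_ge0 ?mulr_ge0 // ltW.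
have [M hM] := geometric_small q0 q1 C0 e0.
exists M => // n /= /hM; apply: le_trans.
have -> : 1 - inflation_series a q n = (q ^+ n * x n - q ^+ n.+1 * y n) / x 0%N.
  have -> : inflation_series a q n = (x 0%N - q ^+ n * x n + q ^+ n.+1 * y n) / x 0%N.
    by rewrite -key mulfK // lt0r_neq0.
  by field; rewrite lt0r_neq0.
rewrite normrM [`|(x 0%N)^-1|]ger0_norm ?invr_ge0 1?(ltW x0) // mulrAC ler_pM2r ?invr_gt0 //.
apply: le_trans (ler_normB _ _) _.
rewrite !normrM [`|q ^+ n|]ger0_norm ?[`|q ^+ n.+1|]ger0_norm ?exprn_ge0 ?(ltW q0) //.
have qn : 0 <= q ^+ n by rewrite exprn_ge0 // ltW.
have -> : 2 * B * q ^+ n = q ^+ n * B + q ^+ n * B by move: (q ^+ n) => ?; ring.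
apply: lerD; first by rewrite ler_wpM2l.
apply: ler_pM => //; first by rewrite exprn_ge0 // ltW.
by rewrite exprS ger_pMl ?exprn_gt0 // ltW.
Qed.

End Natural.

(** The root [q], hence the inflation factor, does not depend on the length function;
the recurrence then determines the lengths of the finite letters from that of
[letter a 0], and continuity those of the limit letters. *)
Lemma natural_tile_length_unique (l l' : alphabet a -> R) lambda lambda' : (1 < a 0)%N ->
  natural_tile_length l lambda -> natural_tile_length l' lambda' ->
  exists2 r : R, 0 < r & forall c, l' c = r * l c.
Proof.
move=> a0 nl nl'.
have [q [q0 q1 lq qr]] := natural_inflation_root nl (natural_inflation_gt2 nl a0).
have [q' [q0' q1' lq' qr']] := natural_inflation_root nl' (natural_inflation_gt2 nl' a0).
have qq := inflation_root_unique a_gt0 q0 q0' qr qr'.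
have {lq'}ll : lambda' = lambda by rewrite lq lq' qq.
have [cl l0 _ _] := nl; have [cl' l0' _ _] := nl'.
pose r := l' (letter a 0) / l (letter a 0).
have r0 : 0 < r by rewrite divr_gt0.
exists r => //; apply: continuous_letter_eq => //.
  move=> c; have FF : Filter (nbhs (c : alphabet a)) := nbhs_filter c.
  by apply: cvgM; [exact: cvg_cst | exact: cl].
have E0 : l' (letter a 0) = r * l (letter a 0) by rewrite /r divfK // lt0r_neq0.
suff H i : l' (letter a i) = r * l (letter a i) /\ l' (letter a i.+1) = r * l (letter a i.+1).
  by move=> i; have [] := H i.
elim: i => [|i [IH1 IH2]].
  split=> //; have := natural_letter0 nl; have := natural_letter0 nl'.
  rewrite ll E0 => h1 h2.
  have -> : l' (letter a 1) = lambda * (r * l (letter a 0)) - (a 0%N)%:R * (r * l (letter a 0)) by rewrite h1; ring.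
  have -> : l (letter a 1) = lambda * l (letter a 0) - (a 0%N)%:R * l (letter a 0) by rewrite h2; ring.
  ring.
split=> //; have := natural_letterS nl i; have := natural_letterS nl' i.
rewrite ll E0 IH1 IH2 => h1 h2.
have -> : l' (letter a i.+2) = lambda * (r * l (letter a i.+1)) - (a i.+1)%:R * (r * l (letter a 0)) - r * l (letter a i) by rewrite h1; ring.
have -> : l (letter a i.+2) = lambda * l (letter a i.+1) - (a i.+1)%:R * l (letter a 0) - l (letter a i) by rewrite h2; ring.
ring.
Qed.

(** By uniqueness it is enough to look at the explicit length function, a two-sided
sum in which far entries count little. *)
Lemma natural_tile_length_agree (l : alphabet a -> R) lambda : (1 < a 0)%N ->
  natural_tile_length l lambda -> forall e : R, 0 < e -> exists M, forall c d : alphabet a,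
  agree M (val c) (val d) -> `|l c - l d| <= e.
Proof.
move=> a0 nl e e0; have [l1 [lambda1 [nl1 [ag _]]]] := natural_tile_length_exists.
have [r r0 lr] := natural_tile_length_unique a0 nl1 nl.
have [M hM] := ag _ (divr_gt0 e0 r0).
by exists M => c d /hM; rewrite !lr -mulrBr normrM gtr0_norm // -ler_pdivlMl // mulrC.
Qed.

Lemma natural_tile_length_ge (l : alphabet a -> R) lambda : (1 < a 0)%N ->
  natural_tile_length l lambda -> exists lo, 0 < lo /\ forall c, lo <= l c.
Proof.
move=> a0 nl; have [l1 [lambda1 [nl1 [_ [lo [lo0 hlo]]]]]] := natural_tile_length_exists.
have [r r0 lr] := natural_tile_length_unique a0 nl1 nl.
by exists (r * lo); split=> [|c]; rewrite ?mulr_gt0 // lr ler_pM2l.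
Qed.

End TileLength.

(** * Words up to agreement of the central entries of their letters *)

Section WordAgreement.
Context {N : nat}.
Variable a : nat -> 'I_N.+1.

Lemma agree_sym M (c d : star_space N) : agree M c d -> agree M d c.
Proof. by move=> h i /h. Qed.
Lemma agree_trans M (c d e : star_space N) : agree M c d -> agree M d e -> agree M c e.
Proof. by move=> h h' i hi; rewrite h // h'. Qed.
Lemma agree_le M M' (c d : star_space N) : (M <= M')%N -> agree M' c d -> agree M c d.
Proof. by move=> MM h i hi; apply: h; exact: leq_trans MM. Qed.

Fixpoint word_agree M (s t : seq (alphabet a)) : Prop :=
  match s, t with
  | [::], [::] => True
  | c :: s, d :: t => agree M (val c) (val d) /\ word_agree M s t
  | _, _ => False
  end.

Lemma word_agree_refl M s : word_agree M s s.
Proof. by elim: s. Qed.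

Lemma word_agree_size M s t : word_agree M s t -> size s = size t.
Proof. by elim: s t => [|c s IH] [|d t] //= [_ /IH ->]. Qed.

Lemma word_agree_cat M s s' t t' : word_agree M s t -> word_agree M s' t' ->
  word_agree M (s ++ s') (t ++ t').
Proof. by elim: s t => [|c s IH] [|d t] //= [h /IH H] /H. Qed.

Lemma word_agree_nth M d s t i : word_agree M s t -> (i < size s)%N ->
  agree M (val (nth d s i)) (val (nth d t i)).
Proof. by elim: s t i => [|c s IH] [|e t] [|i] //= [h h'] // hi; exact: IH. Qed.

Lemma word_agree_catl M p s t : word_agree M (p ++ s) t ->
  exists p' s', [/\ t = p' ++ s', word_agree M p p' & word_agree M s s'].
Proof.
elim: p t => [|c p IH] t /=; first by exists [::], t.
case: t => // d t [h /IH[p' [s' [-> hp hs]]]].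
by exists (d :: p'), s'.
Qed.

Lemma word_agree_infix M u s t : word_agree M s t -> infix u s ->
  exists2 u', infix u' t & word_agree M u u'.
Proof.
move=> h /infixP[p [q e]]; move: h; rewrite e.
move=> /word_agree_catl[p' [s' [-> _ /word_agree_catl[u' [q' [-> hu _]]]]]].
by exists u' => //; apply/infixP; exists p', q'.
Qed.

(** The image of a letter depends on its entries of index -1, 0 and 1 and moves the
entries by at most one place. *)
Lemma subst_agree M (c d : alphabet a) : agree M.+1 (val c) (val d) ->
  word_agree M (subst c) (subst d).
Proof.
move=> cd.
have sh (k : int) : (absz k <= 1)%N -> agree M (shift k (val c)) (shift k (val d)).
  by move=> hk i hi; apply: cd; lia.
have e0 : entry0 (val c) = entry0 (val d) by rewrite /entry0 cd.
have nx : agree M (val (next_letter c)) (val (next_letter d)) by exact: sh.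
have [[c0 ->]|[c0 [p [vp ->]]]] := subst_casesP c;
  have [[d0 ->]|[d0 [p' [vp' ->]]]] := subst_casesP d.
- by apply: word_agree_cat; [exact: word_agree_refl | split].
- by case: d0; apply/letter0_star; rewrite -cd //; exact/letter0_star.
- by case: c0; apply/letter0_star; rewrite cd //; exact/letter0_star.
- rewrite e0; apply: word_agree_cat; first exact: word_agree_refl.
  by split; [rewrite vp vp'; exact: sh | split].
Qed.

Lemma iter_subst_agree M k (s t : seq (alphabet a)) : word_agree (M + k) s t ->
  word_agree M (iter k (subst_word a) s) (iter k (subst_word a) t).
Proof.
elim: k M s t => [|k IH] M s t; first by rewrite addn0.
rewrite addnS -addSn => /IH /=; move: (iter _ _ s) (iter _ _ t).
elim=> [|c u IHu] [|d v] //= [h /IHu h']; rewrite -2!(cat1s _ u, cat1s _ v) /subst_word /=.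
by apply: word_agree_cat => //; exact: subst_agree.
Qed.

Lemma mem_iter_subst i : exists k, letter a i \in iter k (subst_word a) [:: letter a 0].
Proof.
case: i => [|i]; first by exists 0%N; rewrite mem_head.
exists i.+1; rewrite iterSr {2}/subst_word /= cats0 subst_letter0.
have H k u v : iter k (subst_word a) (u ++ v) =
    iter k (subst_word a) u ++ iter k (subst_word a) v.
  exact: iter_sub_word_cat.
rewrite H mem_cat; apply/orP; right.
by have [v -> _] := iter_subst_letter1 a i; rewrite mem_cat mem_head orbT.
Qed.

(** Every letter is close to a finite letter, and every finite letter occurs in some
iterate of [letter a 0]. *)
Lemma infix_letter0 M u k (c : alphabet a) : infix u (iter k (subst_word a) [:: c]) ->
  exists K u', infix u' (iter K (subst_word a) [:: letter a 0]) /\ word_agree M u u'.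
Proof.
move=> hu; have [i hi] := alphabet_approx c (M + k).
have /(iter_subst_agree (M := M)) : word_agree (M + k) [:: c] [:: letter a i].
  by split=> //; exact: agree_sym.
move=> /word_agree_infix /(_ hu)[u' hu' uu'].
have [j hj] := mem_iter_subst i; exists (k + j)%N, u'; split=> //.
apply: infix_trans hu' _; rewrite iterD.
have /path.splitPr[p q] := hj; apply/infixP.
exists (iter k (subst_word a) p), (iter k (subst_word a) q).
by rewrite -cat1s !(iter_sub_word_cat (@subst N a)).
Qed.

Hypothesis a_gt0 : forall n, (0 < a n)%N.

Lemma size_subst (c : alphabet a) : (size (subst c) <= N.+2)%N.
Proof.
have eN : (entry0 (val c) <= N)%N.
  by rewrite /entry0; case: (_ 0) => // k; rewrite -ltnS.
have [[c0 ->]|[c0 [p [vp ->]]]] := subst_casesP c; rewrite size_cat size_nseq /=; last by rewrite addn2 !ltnS.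
by rewrite addn1; exact: leqW (ltn_ord (a 0)).
Qed.

Lemma letter0_subst (c : alphabet a) : letter a 0 \in subst c.
Proof.
have [[c0 ->]|[c0 [p [vp ->]]]] := subst_casesP c; rewrite mem_cat mem_nseq eqxx andbT.
  by rewrite a_gt0.
by rewrite entry0_gt0.
Qed.

(** Such a word contains a supertile of level [K.+1], and [letter a 0] occurs in the
image of every letter. *)
Lemma long_word_contains K w n (c : alphabet a) : infix w (iter n (subst_word a) [:: c]) ->
  (2 * N.+2 ^ K.+1 < size w)%N -> infix (iter K (subst_word a) [:: letter a 0]) w.
Proof.
move=> /(infix_iter_sub_word size_subst letter0_subst K.+1)[p [b [q [-> hp hq]]]].
case: b => [|d b].
  have -> : iter K.+1 (sub_word (@subst N a)) [::] = [::] by elim: K.+1 => //= k ->.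
  by rewrite /= size_cat ltnNge mul2n -addnn leq_add.
move=> _; rewrite iterSr {2}/sub_word /=.
have /path.splitPr[p' q'] := letter0_subst d.
apply/infixP; rewrite -catA -cat1s -catA !(iter_sub_word_cat (@subst N a)).
by rewrite -!catA; eexists (p ++ _), _; rewrite -!catA; congr (_ ++ _ ++ _).
Qed.

End WordAgreement.

(** * The topology of the subshift *)

Lemma ptws_cvg (U I : Type) (V : I -> topologicalType) (F : set_system U) (FF : Filter F)
    (f : U -> prod_topology V) (g : prod_topology V) :
  (forall i, (fun x => f x i) @ F --> g i) -> f @ F --> g.
Proof.
move=> fc; apply/cvg_sup => i W [B [[C oC <-] Bfx] sBW].
by apply: filterS sBW _; apply: fc; exact: open_nbhs_nbhs.
Qed.

Lemma set_val_cvg (U : Type) (T : topologicalType) (A : set T) (F : set_system U) (FF : Filter F)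
    (f : U -> A) (g : A) :
  (fun x => val (f x)) @ F --> val g -> f @ F --> g.
Proof.
move=> fc W [B [[C oC <-] Bfx] sBW].
by apply: filterS sBW _; apply: fc; exact: open_nbhs_nbhs.
Qed.

Section Subshift.
Context {N : nat}.
Variable a : nat -> 'I_N.+1.
Local Notation X := (subshift_space a).

Definition at_ (x : X) (j : int) : alphabet a := val x j.

Definition sagree M (x y : X) :=
  forall j : int, (absz j <= M)%N -> agree M (val (at_ x j)) (val (at_ y j)).

Lemma sagree_refl M x : sagree M x x. Proof. by []. Qed.
Lemma sagree_sym M x y : sagree M x y -> sagree M y x.
Proof. by move=> h j /h; exact: agree_sym. Qed.
Lemma sagree_trans M x y z : sagree M x y -> sagree M y z -> sagree M x z.
Proof. by move=> h h' j hj; apply: agree_trans (h _ hj) (h' _ hj). Qed.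
Lemma sagree_le M M' x y : (M <= M')%N -> sagree M' x y -> sagree M x y.
Proof. by move=> MM h j hj; apply: (agree_le MM); apply: h; exact: leq_trans hj MM. Qed.

Lemma at_continuous j : continuous (at_ ^~ j).
Proof.
move=> x; apply: (@continuous_comp _ _ _ (fun y : X => val y) (fun f : {ptws int -> alphabet a} => f j)).
  exact: initial_continuous.
exact: (@ptws_proj_continuous _ (fun=> alphabet a : topologicalType)).
Qed.

Lemma near_sagree (x : X) M : \forall y \near x, sagree M y x.
Proof.
apply: (near_int_ball (P := fun j y => agree M (val (at_ y j)) (val (at_ x j)))) => j.
exact: (at_continuous (near_agree_letter (at_ x j) M)).
Qed.

(** The topology of the subshift is initial for the entries of the letters, so the
filter generated by the relations [sagree] converges as soon as each entry does. *)
Lemma nbhs_sagree (x : X) (O : set X) : nbhs x O ->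
  exists M, forall y, sagree M y x -> O y.
Proof.
pose F : set_system X := [set A | exists M, forall y, sagree M y x -> A y].
have FF : Filter F.
  split; first by exists 0%N.
    move=> A B [M1 h1] [M2 h2]; exists (maxn M1 M2) => y hy; split.
      by apply: h1; apply: sagree_le hy; exact: leq_maxl.
    by apply: h2; apply: sagree_le hy; exact: leq_maxr.
  by move=> A B AB [M h]; exists M => y /h /AB.
suff : (id : X -> X) @ F --> x by apply.
apply: (@set_val_cvg _ _ (subshift a)).
apply: (@ptws_cvg _ int (fun=> alphabet a : topologicalType)) => j.
apply: set_val_cvg; apply: (@ptws_cvg _ int (fun=> star_symbol N)) => i.
move=> B nB; exists (maxn (absz i) (absz j)) => y hy.
have : (val (at_ y j) : star_space N) i = (val (at_ x j) : star_space N) i.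
  by apply: hy; rewrite ?leq_maxl ?leq_maxr.
rewrite /at_ /= => ->; exact: nbhs_singleton nB.
Qed.

(** Since the language is a closure, a window of a point is only a limit of factors
of supertiles; finitely many entries of its letters are however attained. *)
Lemma language_window (x : X) (p : int) (n M : nat) : exists s k (c : alphabet a),
  [/\ infix s (iter k (subst_word a) [:: c]), size s = n &
      forall d i, (i < n)%N -> agree M (val (nth d s i)) (val (at_ x (p + i%:Z)))].
Proof.
have := set_valP x p n.
pose B : set (word (alphabet a)) := [set w | exists f : 'I_n -> alphabet a,
  w = existT (fun n => {ptws 'I_n -> alphabet a}) n f /\
  forall i, agree M (val (f i)) (val (at_ x (p + i%:Z)))].
have nB : nbhs (subword_at (val x) p n : word (alphabet a)) B.
  pose f0 : {ptws 'I_n -> alphabet a} := fun i => at_ x (p + i%:Z).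
  have FF : Filter (nbhs f0) := nbhs_filter f0.
  have : nbhs f0 [set f | forall i : 'I_n, agree M (val (f i)) (val (at_ x (p + i%:Z)))].
    have H : forall i : 'I_n, \forall f \near f0, agree M (val (f i)) (val (at_ x (p + i%:Z))).
      move=> i; exact: (@ptws_proj_continuous _ (fun=> alphabet a : topologicalType) i f0 _
        (near_agree_letter (at_ x (p + i%:Z)) M)).
    exact: (@filter_forall _ _ (fun (i : 'I_n) f => agree M (val (f i)) (val (at_ x (p + i%:Z)))) _ FF H).
  move=> h; have : nbhs f0 ((fun f => existT (fun n => {ptws 'I_n -> alphabet a}) n f) @^-1` B).
    by apply: filterS h => f hf; exists f.
  exact.
move=> /(_ _ nB)[w [[s [k [c hs]] <-] [f [e hf]]]].
exists s, k, c; split=> //; first exact: (congr1 (@projT1 _ _) e).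
have sn : size s = n := congr1 (@projT1 _ _) e.
move: f e hf; rewrite -sn => f e hf d i hi.
have fe : f = tnth (in_tuple s).
  exact: (esym (Eqdep_dec.inj_pair2_eq_dec _ PeanoNat.Nat.eq_dec (fun n => 'I_n -> alphabet a) _ _ _ e)).
by have := hf (Ordinal hi); rewrite fe (tnth_nth d).
Qed.

Hypothesis a_gt0 : forall n, (0 < a n)%N.

(** A window of [y] is, up to far entries, a factor of a supertile of [letter a 0], and
this supertile occurs in every long window of [x]. *)
Theorem subshift_minimal : minimal_action (subshift_act a).
Proof.
move=> x O [y Oy] oO.
have [M hM] := nbhs_sagree (open_nbhs_nbhs (conj oO Oy)).
have [s [k [c [hs ss ys]]]] := language_window y (- M%:Z) (2 * M).+1 M.
have [K [s' [hs' ass']]] := infix_letter0 M hs.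
have [w [k' [c' [hw sw xw]]]] := language_window x 0 (2 * N.+2 ^ K.+1).+1 M.
have /infixP[p [q ew]] : infix s' w.
  apply: infix_trans hs' _; apply: (long_word_contains a_gt0 hw).
  by rewrite sw.
exists (subshift_act a (size p + M)%N%:Z x); split; last by exists (size p + M)%N%:Z.
apply: hM => j hj.
pose d := letter a 0; pose i := absz (j + M%:Z).
have ei : j = - M%:Z + i%:Z by rewrite /i; lia.
have hi : (i < (2 * M).+1)%N by rewrite /i; lia.
have ss' : size s' = (2 * M).+1 by rewrite -(word_agree_size ass').
have h1 := ys d _ hi; rewrite -ei in h1.
have h2 := word_agree_nth d ass' (i := i); rewrite ss in h2.
have hw' : (size p + i < (2 * N.+2 ^ K.+1).+1)%N.
  by rewrite -sw ew !size_cat ss'; lia.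
have h3 := xw d _ hw'.
have e3 : nth d w (size p + i) = nth d s' i.
  by rewrite ew nth_cat ltnNge leq_addr /= addKn nth_cat ss' hi.
rewrite e3 add0r in h3.
have -> : at_ (subshift_act a (size p + M)%N%:Z x) j = at_ x (size p + i)%N.
  by rewrite /at_ /= /shift; congr (val x _); lia.
apply: agree_trans (agree_sym h3) _; apply: agree_trans (agree_sym (h2 hi)) _.
exact: h1.
Qed.

(** * Uniform Birkhoff averages *)

Definition word_match M (w : seq (alphabet a)) (x : X) :=
  size w = (2 * M).+1 /\
  forall d i, (i < (2 * M).+1)%N -> agree M (val (nth d w i)) (val (at_ x (i%:Z - M%:Z))).

Lemma word_match_sagree M w x y : word_match M w x -> word_match M w y -> sagree M x y.
Proof.
move=> [_ hx] [_ hy] j hj; pose i := absz (j + M%:Z).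
have hi : (i < (2 * M).+1)%N by rewrite /i; lia.
have := agree_trans (agree_sym (hx (letter a 0) _ hi)) (hy (letter a 0) _ hi).
by rewrite (_ : i%:Z - M%:Z = j) //; rewrite /i; lia.
Qed.

Section Averages.
Context {R : realType}.

Definition sumf (g : X -> R) n x : R := \sum_(i < n) g (subshift_act a i%:Z x).

(** An approximation of [g] by a function of words. Factors of supertiles need not
occur in points of the subshift, so [g] is evaluated at any point that matches the
word up to far entries, and 0 is taken if there is none. *)
Definition window_value M (g : X -> R) (w : seq (alphabet a)) : R :=
  if pselect (exists x, word_match M (take (2 * M).+1 w) x) is left h
  then g (projT1 (cid h)) else 0.

Fixpoint window_sum M g (w : seq (alphabet a)) : R :=
  if w is _ :: w' then window_value M g w + window_sum M g w' else 0.

Lemma window_value_le M g B w : 0 <= B -> (forall x, `|g x| <= B) -> `|window_value M g w| <= B.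
Proof. by move=> B0 gB; rewrite /window_value; case: pselect => // h; rewrite normr0. Qed.

(** Only the windows that start in [u] and reach over its end contribute to the
defect. *)
Lemma window_sum_cat M g B : (forall x, `|g x| <= B) -> 0 <= B -> forall u v,
  `|window_sum M g (u ++ v) - window_sum M g u - window_sum M g v| <= (2 * M).+1%:R * (2 * B).
Proof.
move=> gB B0 u v.
have B2 : 0 <= 2 * B by rewrite mulr_ge0.
have : `|window_sum M g (u ++ v) - window_sum M g u - window_sum M g v| <=
    (minn (size u) (2 * M).+1)%:R * (2 * B).
  elim: u => [|c u IH] /=; first by rewrite subr0 subrr normr0 mulr_ge0.
  have [le_u|gt_u] := leqP (2 * M).+1 (size (c :: u)).
    have -> : window_value M g (c :: u ++ v) = window_value M g (c :: u).
      by rewrite /window_value -cat_cons takel_cat.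
    rewrite opprD addrACA subrr add0r; apply: (le_trans IH).
    by rewrite ler_wpM2r // ler_nat geq_minr.
  rewrite /= -natr1 mulrDl mul1r.
  have hs : (minn (size u) (2 * M).+1)%:R * (2 * B) <= (size u)%:R * (2 * B).
    by rewrite ler_wpM2r // ler_nat geq_minl.
  have := le_trans IH hs.
  have := window_value_le M (c :: u ++ v) B0 gB; have := window_value_le M (c :: u) B0 gB.
  move: (window_value _ _ _) (window_value _ _ _) (window_sum _ _ _) (window_sum _ _ _) (window_sum _ _ _).
  move=> x y z t r h1 h2 h3.
  have -> : x + r - (y + t) - z = (r - t - z) + (x - y) by ring.
  apply: le_trans (ler_normD _ _) _; apply: lerD => //.
  by apply: le_trans (ler_normB _ _) _; rewrite mulr_natl mulr2n lerD.
move/le_trans; apply; by rewrite ler_wpM2r // ler_nat geq_minr.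
Qed.

Lemma window_sum_short M g w : (size w <= 2 * M)%N -> window_sum M g w = 0.
Proof.
elim: w => //= c w IH sw; rewrite IH ?addr0; last exact: ltnW.
rewrite /window_value; case: pselect => // h; exfalso; have [y [+ _]] := h.
by rewrite take_oversize /=; [move=> e; move: sw; rewrite e ltnn | exact: leqW].
Qed.

Lemma window_sum_window M g e (x : X) n w :
  (forall y z, sagree M y z -> `|g y - g z| <= e) -> size w = (n + 2 * M)%N ->
  (forall d i, (i < n + 2 * M)%N -> agree M (val (nth d w i)) (val (at_ x (- M%:Z + i%:Z)))) ->
  `|window_sum M g w - sumf g n x| <= e * n%:R.
Proof.
move=> ge; elim: n x w => [|n IH] x w sw hw.
  by rewrite window_sum_short ?sw // /sumf big_ord0 subr0 normr0 mulr0.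
case: w sw hw => // c w [sw] hw /=.
rewrite /sumf big_ord_recl /=.
have e0 : subshift_act a 0 x = x by apply/val_inj; rewrite /= Defs.shift0.
rewrite e0.
have -> : \sum_(i < n) g (subshift_act a (bump 0 i)%:Z x) = sumf g n (subshift_act a 1 x).
  apply: eq_bigr => i _; congr g; apply/val_inj; rewrite /= shiftD.
  by have -> : (bump 0 i)%:Z = i%:Z + 1 by rewrite /bump; lia.
have h2 := IH (subshift_act a 1 x) w sw.
have hm : word_match M (take (2 * M).+1 (c :: w)) x.
  split; first by rewrite size_takel //= sw; lia.
  move=> d i hi; rewrite nth_take //; have := hw d i; rewrite addrC; apply; lia.
have h1 : `|window_value M g (c :: w) - g x| <= e.
  rewrite /window_value; case: pselect => [h|[]]; last by exists x.
  apply: ge; case: cid => y /= hy; exact: word_match_sagree hy hm.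
rewrite opprD addrACA -natr1 mulrDr mulr1 addrC.
apply: le_trans (ler_normD _ _) _; apply: lerD => //; apply: h2.
move=> d i hi; have := hw d i.+1; rewrite addSn ltnS => /(_ hi) /=.
by rewrite /at_ /= /shift (_ : - M%:Z + i%:Z + 1 = - M%:Z + i.+1%:Z) //; lia.
Qed.

Variables (l : alphabet a -> R) (lambda : R).
Hypotheses (nl : natural_tile_length l lambda) (a0_gt1 : (1 < a 0)%N).

(** The averages of [quasi_additive_average] are relative to the weight. The size of a
word is itself quasi-additive, which turns them into averages per letter. *)
Lemma word_average (S : seq (alphabet a) -> R) (B D : R) :
  (forall u v, `|S (u ++ v) - S u - S v| <= D) -> (forall c, `|S [:: c]| <= B) ->
  exists kappa : R, forall e : R, 0 < e -> exists n0 : nat, forall n (c : alphabet a) w,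
    infix w (iter n (subst_word a) [:: c]) -> (n0 <= size w)%N ->
    `|S w - kappa * (size w)%:R| <= e * (size w)%:R.
Proof.
move=> Sq Sl.
have [lo [lo0 lo_le]] := natural_tile_length_ge a_gt0 a0_gt1 nl.
have [cl l0 lambda1 leig] := nl.
have [hi lhi] := continuous_letter_bounded cl.
have le_hi c : l c <= hi by apply: le_trans (lhi c); exact: ler_norm.
have hi0 : 0 < hi by apply: lt_le_trans (le_hi (letter a 0)).
have QA := quasi_additive_average (size_subst (a := a)) (letter0_subst a_gt0) lo0 lo_le le_hi lambda1 leig.
have [k hk] := QA S B D Sq Sl.
have [k1 hk1] : exists kappa : R, forall e : R, 0 < e -> exists n0 : nat, forall n (c : alphabet a) w,
    infix w (iter n (subst_word a) [:: c]) -> (n0 <= size w)%N ->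
    `|(size w)%:R - kappa * weight l w| <= e * weight l w.
  apply: (QA (fun w => (size w)%:R) 1 0) => [u v|c]; last by rewrite normr1.
  by rewrite size_cat natrD addrAC addrK subrr normr0.
have w_ge w : (size w)%:R * lo <= weight l w := weight_ge lo_le w.
have w_le w : weight l w <= (size w)%:R * hi := weight_le le_hi w.
have ih : 0 < hi^-1 by rewrite invr_gt0.
have k1_gt : 0 < k1.
  have [n0 hn0] := hk1 (hi^-1 / 2) (divr_gt0 ih (ltr0Sn R 1)).
  pose n := n0.+1.
  have [v ev sv] := iter_subst_letter1 a n.
  set w := iter _ _ _ in ev.
  have sw : (n0 < size w)%N by rewrite ev size_cat addn1 ltnS ltnW.
  have := hn0 n (letter a 1) w (infix_refl _) (ltnW sw).
  rewrite ler_norml => /andP[_ h].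
  have sw0 : 0 < (size w)%:R :> R by rewrite ltr0n; exact: leq_ltn_trans sw.
  have wp : 0 < weight l w by apply: lt_le_trans (w_ge w); rewrite mulr_gt0.
  have h2 : hi^-1 * weight l w <= (size w)%:R by rewrite ler_pdivrMl // mulrC.
  rewrite -(pmulr_lgt0 _ wp); lra.
exists (k / k1) => e e0.
have C0 : 0 < 1 + `|k / k1| by rewrite ltr_pwDl.
have e'0 : 0 < e / ((1 + `|k / k1|) * hi) * 1 by rewrite mulr1 divr_gt0 // mulr_gt0.
set e' := _ * 1 in e'0.
have e'E : e' * hi * (1 + `|k / k1|) = e.
  by rewrite /e'; field; rewrite !lt0r_neq0.
suff : exists n0, forall n (c : alphabet a) w, infix w (iter n (subst_word a) [:: c]) ->
    (n0 <= size w)%N -> `|S w - k / k1 * (size w)%:R| <= e' * weight l w + `|k / k1| * (e' * weight l w).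
  move=> [n0 hn0]; exists n0 => n c w iw sw; apply: le_trans (hn0 n c w iw sw) _.
  rewrite -e'E.
  have : e' * weight l w <= e' * ((size w)%:R * hi) by rewrite ler_pM2l.
  move=> h; have := ler_wpM2l (ltW C0) h; lra.
have [n1 h1] := hk _ e'0; have [n2 h2] := hk1 _ e'0.
exists (maxn n1 n2) => n c w iw; rewrite geq_max => /andP[/h1 - /(_ n c iw) H1 /h2 - /(_ n c iw) H2].
have -> : S w - k / k1 * (size w)%:R = (S w - k * weight l w) - k / k1 * ((size w)%:R - k1 * weight l w).
  by field; rewrite lt0r_neq0.
apply: le_trans (ler_normB _ _) _; apply: lerD => //.
by rewrite normrM ler_wpM2l.
Qed.

Lemma uniform_average_approx (g : X -> R) (B : R) : (forall x, `|g x| <= B) ->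
  (forall e : R, 0 < e -> exists M, forall x y, sagree M x y -> `|g x - g y| <= e) ->
  forall e : R, 0 < e -> exists kappa, exists n0, forall n, (n0 <= n)%N -> forall x,
    `|sumf g n x - kappa * n%:R| <= e * n%:R.
Proof.
move=> gB gu e e0.
have B0 : 0 <= B by apply: le_trans (gB point).
have e40 : 0 < e / 4 by rewrite divr_gt0.
have [M hM] := gu _ e40.
have [k hk] : exists kappa : R, forall e : R, 0 < e -> exists n0 : nat, forall n (c : alphabet a) w,
    infix w (iter n (subst_word a) [:: c]) -> (n0 <= size w)%N ->
    `|window_sum M g w - kappa * (size w)%:R| <= e * (size w)%:R.
  apply: (@word_average _ B); first exact: window_sum_cat.
  by move=> c /=; rewrite addr0; exact: window_value_le.
have [n0 hn0] := hk _ e40.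
pose C := (`|k| + e / 4) * (2 * M)%:R.
have C0 : 0 <= C by rewrite mulr_ge0 // addr_ge0 // ltW.
exists k, (maxn n0 (Num.bound (C / (e / 4)))) => n; rewrite geq_max => /andP[n0n Cn] x.
have hC : C <= e / 4 * n%:R.
  have : C / (e / 4) < n%:R.
    apply: lt_le_trans (archi_boundP _) _; last by rewrite ler_nat.
    by rewrite divr_ge0 // ltW.
  by rewrite ltr_pdivrMr // => h; rewrite mulrC ltW.
have [w [j [c [iw sw hw]]]] := language_window x (- M%:Z) (n + 2 * M) M.
have h1 := window_sum_window hM sw hw.
have h2 : `|window_sum M g w - k * (size w)%:R| <= e / 4 * (size w)%:R.
  by apply: hn0 iw _; rewrite sw; exact: leq_trans (leq_addr _ _).
rewrite sw natrD in h2.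
have -> : sumf g n x - k * n%:R = (window_sum M g w - k * (n%:R + (2 * M)%:R)) -
    (window_sum M g w - sumf g n x) + k * (2 * M)%:R by ring.
apply: le_trans (ler_normD _ _) _; apply: le_trans (lerD (ler_normB _ _) (lexx _)) _.
have h3 : `|k * (2 * M)%:R| + e / 4 * (2 * M)%:R <= C by rewrite normrM [`|_%:R|]ger0_norm // /C mulrDl.
lra.
Qed.

(** For each precision there is one approximate mean; the averages at a fixed point
form a Cauchy sequence, whose limit is within that precision of each of them. *)
Theorem uniform_average (g : X -> R) (B : R) : (forall x, `|g x| <= B) ->
  (forall e : R, 0 < e -> exists M, forall x y, sagree M x y -> `|g x - g y| <= e) ->
  exists kappa, forall e : R, 0 < e -> exists n0, forall n, (n0 <= n)%N -> forall x,
    `|sumf g n x - kappa * n%:R| <= e * n%:R.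
Proof.
move=> gB gu; have H := uniform_average_approx gB gu.
pose u n := sumf g n.+1 point / n.+1%:R.
have n0 n : 0 < n.+1%:R :> R by [].
have dv (k e : R) n : `|sumf g n.+1 point - k * n.+1%:R| <= e * n.+1%:R -> `|u n - k| <= e.
  rewrite -ler_pdivrMr // -[X in _ / X]ger0_norm // -normf_div.
  by rewrite (_ : _ / n.+1%:R = u n - k) // /u mulrBl mulfK ?lt0r_neq0.
have cu : cvgn u.
  apply: cauchy_cvg.
  apply/cauchy_exP => e e0; have e20 : 0 < e / 2 by rewrite divr_gt0.
  have [k [m hm]] := H _ e20; exists k; exists m => // n /= mn.
  rewrite /ball /= distrC; apply: (@le_lt_trans _ _ (e / 2)).
    by apply: dv; apply: hm; exact: leqW.
  by rewrite ltr_pdivrMr // ltr_pMr // ltr1n.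
exists (limn u) => e e0; have e20 : 0 < e / 2 by rewrite divr_gt0.
have [k [m hm]] := H _ e20.
have hk : `|limn u - k| <= e / 2.
  have cn : `|u n - k| @[n --> \oo] --> `|limn u - k|.
    by apply: cvg_norm; apply: cvgB => //; exact: cvg_cst.
  rewrite -(cvg_lim _ cn) //; apply: limr_le; first by apply/cvg_ex; eexists; exact: cn.
  by exists m => // n /= mn; apply: dv; apply: hm; exact: leqW.
exists m => n mn x; have := hm n mn x.
have -> : sumf g n x - limn u * n%:R = (sumf g n x - k * n%:R) - (limn u - k) * n%:R by ring.
move=> h; apply: le_trans (ler_normB _ _) _; rewrite normrM [`|n%:R|]ger0_norm //.
have : `|limn u - k| * n%:R <= e / 2 * n%:R by rewrite ler_wpM2r.
lra.
Qed.

End Averages.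

End Subshift.

(** * Probability measures on compact spaces with a clopen base *)

Lemma compact_set_type (T : topologicalType) (A : set T) : compact A -> compact [set: A].
Proof.
move=> cA F PF FT.
have [p [Ap clp]] : (A `&` cluster ((val : A -> T) @ F)) !=set0.
  by apply: cA; apply: (@filterS _ F _ setT) => // c _; exact: (set_valP c).
exists (SigSub (mem_set Ap)); split=> // B C FB [_ [[V oV <-] Vp] VC].
have [_ [[c Bc <-] Vc]] : ((val : A -> T) @` B) `&` V !=set0.
  apply: clp; last exact: open_nbhs_nbhs.
  by apply: (@filterS _ F _ B) => // c Bc; exists c.
by exists c; split=> //; exact: VC.
Qed.

Lemma measurable_preimage_generated d (T : measurableType d) (T' : Type) (G : set (set T')) (f : T -> T') :
  (forall A, G A -> measurable (f @^-1` A)) -> forall A, <<s G >> A -> measurable (f @^-1` A).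
Proof.
move=> fG; apply: (@smallest_sub _ _ _ [set A | measurable (f @^-1` A)]) => //; split.
- by rewrite /= preimage_set0.
- by move=> B /= mB; rewrite setTD preimage_setC; exact: measurableC.
- by move=> F /= mF; rewrite preimage_bigcup; exact: bigcupT_measurable.
Qed.

Section ClopenBase.
Context {R : realType} {T : ptopologicalType}.
Variable G : set (set T).
Hypotheses (G0 : G set0) (GU : setU_closed G) (GC : setC_closed G).
Hypotheses (Gopen : forall A, G A -> open A)
  (Gbase : forall O, open O -> exists F : (set T)^nat, (forall i, G (F i)) /\ O = \bigcup_i F i).

Lemma clopen_base_sigma (A : set (borel T)) : measurable A -> <<s G >> A.
Proof.
apply: smallest_sub; first exact: smallest_sigma_algebra.
move=> O oO; have [F [GF ->]] := Gbase oO.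
by apply: sigma_algebra_bigcup => i; apply: sub_sigma_algebra; exact: GF.
Qed.

Lemma clopen_base_measurable A : G A -> measurable (A : set (borel T)).
Proof. by move=> /Gopen oA; exact: sub_sigma_algebra. Qed.

Lemma clopen_baseI : setI_closed G.
Proof. by move=> A B GA GB; rewrite -[_ `&` _]setCK setCI; apply: GC; apply: GU; exact: GC. Qed.

(** By compactness, a clopen set that is a countable disjoint union of clopen sets is
a finite one, so that [m] is countably additive on the algebra of clopen sets and
the Caratheodory extension applies. *)
Theorem clopen_base_extension (m : set T -> R) : compact [set: T] ->
  (forall A, 0 <= m A) ->
  (forall A B, G A -> G B -> A `&` B = set0 -> m (A `|` B) = m A + m B) ->
  m setT = 1 ->
  exists mu : probability (borel T) R, forall A, G A -> mu A = (m A)%:E.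
Proof.
move=> cT m_ge0 m_add mT.
pose cylT : algebraOfSetsType default_measure_display :=
  HB.pack (Pointed.sort T) (isAlgebraOfSets.Build default_measure_display T G0 GU GC).
pose f : set cylT -> \bar R := fun A => (m A)%:E.
have m0 : m set0 = 0.
  have := m_add _ _ G0 G0 (setI0 _); rewrite setU0 => /eqP.
  by rewrite -subr_eq0 opprD addrA subrr add0r oppr_eq0 => /eqP.
have f0 : f set0 = 0%E by rewrite /f m0.
have fge0 A : (0 <= f A)%E by rewrite lee_fin.
have GUn (F : (set T)^nat) n : (forall i, G (F i)) -> G (\big[setU/set0]_(i < n) F i).
  by move=> GF; elim/big_ind: _ => // A B; exact: GU.
have mUn (F : (set T)^nat) n : (forall i, G (F i)) -> trivIset setT F ->
    m (\big[setU/set0]_(i < n) F i) = \sum_(i < n) m (F i).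
  move=> GF tF; elim: n => [|n IH]; first by rewrite !big_ord0.
  rewrite !big_ord_recr /= m_add ?IH //; first exact: GUn.
  by apply: (@trivIset_bigsetUI _ predT) => //; apply: sub_trivIset tF.
have fsa : semi_sigma_additive f.
  move=> F mF tF mUF.
  have : compact (\bigcup_i F i : set T).
    apply: (subclosed_compact _ cT) => //.
    by rewrite -[\bigcup_i F i]setCK closedC; apply: Gopen; exact: GC.
  rewrite compact_cover => /(_ _ setT (F : nat -> set T)).
  case=> [i _|//|D _ UD]; first by apply: Gopen; exact: mF.
  pose n0 := (\max_(i <- finmap.enum_fset D) i).+1.
  have eU n : (n0 <= n)%N -> \bigcup_i F i = \big[setU/set0]_(i < n) F i.
    move=> n0n; apply/seteqP; split.
      move=> x /UD[i /= iD Fi]; rewrite -bigcup_mkord; exists i => //=.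
      apply: leq_trans n0n; rewrite ltnS; exact: (leq_bigmax_seq (F := id)).
    by rewrite -bigcup_mkord => x [i _ Fi]; exists i.
  apply: cvg_near_cst; exists n0 => // n /= /eU ->.
  by rewrite /f mUn // -sumEFin big_mkord.
pose M : {measure set cylT -> \bar R} :=
  HB.pack f (isMeasure.Build _ cylT R f f0 fge0 fsa).
pose E := @measure_extension _ cylT R M.
pose mu : set (borel T) -> \bar R := fun A => E A.
have muG A : G A -> mu A = (m A)%:E.
  by move=> GA; rewrite /mu /E /measure_extension measurable_mu_extE.
have mu0 : mu set0 = 0%E by rewrite muG // m0.
have mu_ge0 A : (0 <= mu A)%E by exact: measure_ge0.
have mu_sa : semi_sigma_additive mu.
  move=> F mF tF mUF; apply: (@measure_semi_sigma_additive _ _ _ E) => //.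
    by move=> i; exact: clopen_base_sigma.
  exact: clopen_base_sigma.
have muT : mu setT = 1%E.
  by rewrite muG ?mT // -setC0; exact: GC.
pose mu1 : {measure set (borel T) -> \bar R} :=
  HB.pack mu (isMeasure.Build _ (borel T) R mu mu0 mu_ge0 mu_sa).
pose P := HB.pack_for (probability (borel T) R) (Measure.sort mu1)
  (Measure_isProbability.Build _ (borel T) R (Measure.sort mu1) muT).
by exists P.
Qed.

End ClopenBase.

Section InvariantAverages.
Context {R : realType} {T : ptopologicalType} {Gr : Type}.
Variable act : Gr -> T -> T.
Hypothesis mact : forall g (A : set (borel T)), measurable A -> measurable (act g @^-1` A : set (borel T)).

Lemma sum_probability_le (nu : probability (borel T) R) n (B : nat -> set (borel T)) (c : R) :
  (forall i, measurable (B i)) -> (forall x, \sum_(i < n) \1_(B i) x <= c) ->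
  (\sum_(i < n) nu (B i) <= c%:E)%E.
Proof.
move=> mB Bc.
have -> : (\sum_(i < n) nu (B i) = \int[nu]_x (\sum_(i < n) (\1_(B i) x)%:E))%E.
  rewrite ge0_integral_sum //; last by move=> i; apply/measurable_EFinP; exact: measurable_indic.
  by apply: eq_bigr => i _; rewrite integral_indic // setIT.
have -> : c%:E = (\int[nu]_x (cst c%:E x))%E.
  rewrite integral_cst //.
  exact: (eq_ind_r (fun z => c%:E = c%:E * z)%E (esym (mule1 _)) (probability_setT nu)).
apply: ge0_le_integral => //.
- by move=> x _; apply: sume_ge0 => i _; rewrite lee_fin.
- by apply: emeasurable_sum => i; apply/measurable_EFinP; exact: measurable_indic.
- by move=> x _; rewrite sumEFin lee_fin.
Qed.

Lemma invariant_average_le (nu : probability (borel T) R) (A : set (borel T)) (g : nat -> Gr) n (c : R) :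
  invariant_measure act nu -> measurable A -> (0 < n)%N ->
  (forall x, \sum_(i < n) \1_A (act (g i) x) <= c * n%:R) -> (nu A <= c%:E)%E.
Proof.
move=> inv mA n0 h.
have := @sum_probability_le nu n (fun i => act (g i) @^-1` A) (c * n%:R)
  (fun i => mact (g i) mA).
have -> : (\sum_(i < n) nu (act (g i) @^-1` A) = nu A * n%:R%:E)%E.
  rewrite (eq_bigr (fun=> nu A)); last by move=> i _; exact: inv.
  elim: (n) => [|m IH]; first by rewrite big_ord0 mule0.
  by rewrite big_ord_recr /= IH !mule_natr muleS addeC.
rewrite EFinM => /(_ _)/wrap[]; first by move=> x; apply: le_trans (h x); apply: ler_sum.
by rewrite lee_pmul2r // lte_fin ltr0n.
Qed.

(** The measure of [A] is the integral of the average of the translates of its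
indicator, for [A] and for its complement. *)
Lemma invariant_average (nu : probability (borel T) R) (A : set (borel T)) (g : nat -> Gr) n (k e : R) :
  invariant_measure act nu -> measurable A -> (0 < n)%N ->
  (forall x, `|\sum_(i < n) \1_A (act (g i) x) - k * n%:R| <= e * n%:R) ->
  `|fine (nu A) - k| <= e.
Proof.
move=> inv mA n0 h.
have fA : nu A \is a fin_num by exact: fin_num_measure.
have h1 : (nu A <= (k + e)%:E)%E.
  apply: (invariant_average_le (g := g) inv mA n0) => x.
  by have := h x; rewrite ler_norml => /andP[_]; lra.
have h2 : (nu (~` A) <= (1 - k + e)%:E)%E.
  apply: (invariant_average_le (g := g) inv _ n0); first exact: measurableC.
  move=> x; have -> : \sum_(i < n) \1_(~` A) (act (g i) x) = n%:R - \sum_(i < n) \1_A (act (g i) x) :> R.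
    rewrite -[in n%:R](card_ord n) -sumr_const -sumrB; apply: eq_bigr => i _.
    rewrite !indicE in_setC; by case: (_ \in _); rewrite ?subrr ?subr0.
  by have := h x; rewrite ler_norml => /andP[]; lra.
rewrite probability_setC // -(fineK fA) -EFinB lee_fin in h2.
rewrite -(fineK fA) lee_fin in h1.
by rewrite ler_norml; apply/andP; split; lra.
Qed.

(** Uniform averages determine the value of every invariant measure on [G], and the
values on a pi-system determine the measure. *)
Lemma uniquely_ergodic_from_averages (G : set (set (borel T))) (mu nu : probability (borel T) R) :
  (forall A, G A -> measurable A) -> setI_closed G -> G setT ->
  (forall A : set (borel T), measurable A -> <<s G >> A) ->
  (forall A, G A -> forall e : R, 0 < e -> exists (k : R) n (g : nat -> Gr), (0 < n)%N /\
    forall x, `|\sum_(i < n) \1_A (act (g i) x) - k * n%:R| <= e * n%:R) ->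
  invariant_measure act mu -> invariant_measure act nu ->
  forall A : set (borel T), measurable A -> nu A = mu A.
Proof.
move=> Gm GI GT sG H imu inu A /sG.
apply: (g_sigma_algebra_measure_unique G Gm (fun=> setT)) => //.
- by rewrite bigcup_const //; exists 0%N.
- move=> B GB.
  have fnu : nu B \is a fin_num by apply: fin_num_measure; exact: Gm.
  have fmu : mu B \is a fin_num by apply: fin_num_measure; exact: Gm.
  suff e : fine (nu B) = fine (mu B) by rewrite -[LHS]fineK // -[RHS]fineK // e.
  apply/eqP.
  rewrite -subr_eq0 -normr_le0; apply/ler_addgt0Pr => e e0.
  have [k [n [g [n0 h]]]] := H _ GB _ (divr_gt0 e0 (ltr0Sn R 1)).
  have h1 := invariant_average inu (Gm _ GB) n0 h.
  have h2 := invariant_average imu (Gm _ GB) n0 h.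
  rewrite add0r (_ : fine (nu B) - fine (mu B) = (fine (nu B) - k) - (fine (mu B) - k)); last by ring.
  by apply: le_trans (ler_normB _ _) _; lra.
- by move=> k; exact: (eq_ind_r (fun z => (z < +oo)%E) (ltry 1) (probability_setT nu)).
Qed.

End InvariantAverages.

(** * Unique ergodicity of the subshift *)

Section SubshiftMeasure.
Context {R : realType} {N : nat}.
Variable a : nat -> 'I_N.+1.
Local Notation X := (subshift_space a).

Definition cylinder_set : set (set X) :=
  [set C | exists M, forall x y, sagree M x y -> C x -> C y].

Lemma cylinder_set0 : cylinder_set set0. Proof. by exists 0%N. Qed.

Lemma cylinder_setU : setU_closed cylinder_set.
Proof.
move=> A B [M hM] [M' hM']; exists (maxn M M') => x y xy [Ax|Bx].
  by left; apply: hM Ax; apply: sagree_le xy; exact: leq_maxl.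
by right; apply: hM' Bx; apply: sagree_le xy; exact: leq_maxr.
Qed.

Lemma cylinder_setC : setC_closed cylinder_set.
Proof. by move=> A [M hM]; exists M => x y xy nAx Ay; apply: nAx; apply: hM Ay; exact: sagree_sym. Qed.

Lemma cylinder_setT : cylinder_set setT. Proof. by exists 0%N. Qed.

Lemma cylinder_set_open A : cylinder_set A -> open A.
Proof.
move=> [M hM]; rewrite openE => x Ax.
have FF : Filter (nbhs x) := nbhs_filter x.
by apply: filterS (near_sagree x M) => y /sagree_sym xy; exact: hM Ax.
Qed.

Lemma cylinder_set_base O : open O ->
  exists F : (set X)^nat, (forall i, cylinder_set (F i)) /\ O = \bigcup_i F i.
Proof.
move=> oO; exists (fun M => [set x | forall y, sagree M y x -> O y]); split.
  move=> M; exists M => x y xy h z zy; apply: h; apply: sagree_trans zy _; exact: sagree_sym.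
apply/seteqP; split=> [x Ox|x [M _ h]]; last exact: h.
by have [M hM] := nbhs_sagree (open_nbhs_nbhs (conj oO Ox)); exists M.
Qed.

Lemma subshift_compact : compact [set: X].
Proof.
apply: (@compact_set_type _ (subshift a)).
have cX : compact [set: {ptws int -> alphabet a}].
  have := @tychonoff int (fun=> alphabet a : topologicalType) (fun=> setT)
    (fun=> alphabet_compact (a := a)).
  by congr compact; apply/seteqP; split.
apply: (subclosed_compact _ cX) => //.
have -> : subshift a = \bigcap_(p in [set: int * nat])
    ((fun x : {ptws int -> alphabet a} => subword_at x p.1 p.2 : word (alphabet a)) @^-1` language a).
  by apply/seteqP; split=> [x h [m n] _|x h m n]; [exact: h | exact: (h (m, n))].
apply: closed_bigI => -[m n] _; apply: (@preimage_closed _ _ _ (language a)); last exact: closed_closure.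
by move=> x _; exact: subword_at_continuous.
Qed.

Lemma subshift_actD (j k : int) (x : X) :
  subshift_act a j (subshift_act a k x) = subshift_act a (j + k) x.
Proof. by apply/val_inj; rewrite /= shiftD. Qed.

Lemma subshift_act0 (x : X) : subshift_act a 0 x = x.
Proof. by apply/val_inj; rewrite /= Defs.shift0. Qed.

Lemma sagree_act M (k : int) (x y : X) : sagree (M + absz k) x y ->
  sagree M (subshift_act a k x) (subshift_act a k y).
Proof.
move=> h j hj; have := h (j + k); rewrite /at_ /= /shift => /(_ _)/wrap[]; first lia.
by apply: agree_le; exact: leq_addr.
Qed.

Lemma cylinder_set_act k A : cylinder_set A -> cylinder_set (subshift_act a k @^-1` A).
Proof.
by move=> [M hM]; exists (M + absz k)%N => x y /sagree_act; exact: hM.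
Qed.

Lemma subshift_act_measurable k (A : set (borel X)) : measurable A ->
  measurable (subshift_act a k @^-1` A : set (borel X)).
Proof.
move=> /(clopen_base_sigma cylinder_set_base); apply: measurable_preimage_generated => B.
move=> /(cylinder_set_act k); exact: (clopen_base_measurable cylinder_set_open).
Qed.

Hypotheses (a_gt0 : forall n, (0 < a n)%N) (a0_gt1 : (1 < a 0)%N).

Definition has_mean (g : X -> R) (k : R) := forall e : R, 0 < e -> exists n0,
  forall n, (n0 <= n)%N -> forall x, `|sumf g n x - k * n%:R| <= e * n%:R.

Lemma has_mean_unique g k k' : has_mean g k -> has_mean g k' -> k = k'.
Proof.
move=> h h'; apply/eqP; rewrite -subr_eq0 -normr_le0; apply/ler_addgt0Pr => e e0; rewrite add0r.
have [n hn] := h _ (divr_gt0 e0 (ltr0Sn R 1)); have [n' hn'] := h' _ (divr_gt0 e0 (ltr0Sn R 1)).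
pose m := (maxn n n').+1.
have := hn m (leqW (leq_maxl _ _)) point; have := hn' m (leqW (leq_maxr _ _)) point.
have m0 : 0 < m%:R :> R by rewrite ltr0n.
move=> h1 h2; rewrite -(ler_pM2r m0).
have -> : `|k - k'| * m%:R = `|(k - k') * m%:R| by rewrite normrM (ger0_norm (ltW m0)).
rewrite (_ : (k - k') * m%:R = (sumf g m point - k' * m%:R) - (sumf g m point - k * m%:R)); last by ring.
by apply: le_trans (ler_normB _ _) _; lra.
Qed.

Lemma has_meanD g g' k k' : has_mean g k -> has_mean g' k' -> has_mean (g \+ g') (k + k').
Proof.
move=> h h' e e0.
have [n hn] := h _ (divr_gt0 e0 (ltr0Sn R 1)); have [n' hn'] := h' _ (divr_gt0 e0 (ltr0Sn R 1)).
exists (maxn n n') => m; rewrite geq_max => /andP[/hn h1 /hn' h2] x.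
have -> : sumf (g \+ g') m x - (k + k') * m%:R = (sumf g m x - k * m%:R) + (sumf g' m x - k' * m%:R).
  by rewrite /sumf big_split /=; ring.
by apply: le_trans (ler_normD _ _) _; have := h1 x; have := h2 x; lra.
Qed.

Lemma has_mean_ge0 g k : (forall x, 0 <= g x) -> has_mean g k -> 0 <= k.
Proof.
move=> g0 h; rewrite leNgt; apply/negP => k0.
have [n hn] : exists n0, forall n, (n0 <= n)%N -> forall x, `|sumf g n x - k * n%:R| <= (- k / 2) * n%:R.
  by apply: h; rewrite divr_gt0 // oppr_gt0.
have := hn n.+1 (leqnSn n) point; rewrite ler_norml => /andP[_].
have s0 : 0 <= sumf g n.+1 point by apply: sumr_ge0.
have m0 : 0 < n.+1%:R :> R by rewrite ltr0n.
by nra.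
Qed.

Lemma has_mean1 : has_mean (fun=> 1) 1.
Proof.
move=> e e0; exists 0%N => n _ x.
by rewrite /sumf sumr_const card_ord mul1r subrr normr0 mulr_ge0 // ltW.
Qed.

Lemma has_mean_shift g k (j : int) : has_mean g k -> has_mean (g \o subshift_act a j) k.
Proof.
move=> h e /h[n hn]; exists n => m nm x.
have -> : sumf (g \o subshift_act a j) m x = sumf g m (subshift_act a j x).
  by apply: eq_bigr => i _; rewrite /= !subshift_actD addrC.
exact: hn.
Qed.

Lemma has_mean_continuous (g : X -> R) (B : R) : (forall x, `|g x| <= B) ->
  (forall e : R, 0 < e -> exists M, forall x y, sagree M x y -> `|g x - g y| <= e) ->
  exists k, has_mean g k.
Proof.
have [l [lambda [nl _]]] := @natural_tile_length_exists R _ _ a_gt0.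
exact: (uniform_average a_gt0 nl a0_gt1).
Qed.

Lemma has_mean_cylinder A : cylinder_set A -> exists k, has_mean \1_A k.
Proof.
move=> [M hM]; apply: (@has_mean_continuous _ 1).
  by move=> x; rewrite indicE; case: (_ \in _); rewrite ?normr1 ?normr0.
move=> e e0; exists M => x y xy; rewrite !indicE.
suff -> : (x \in A) = (y \in A) by rewrite subrr normr0 ltW.
by apply/idP/idP; rewrite !inE; apply: hM => //; exact: sagree_sym.
Qed.

(** By [frequencyE] no other value is possible for an invariant measure of a cylinder
set. *)
Definition frequency (A : set X) : R := xget 0 [set k | has_mean \1_A k].

Lemma frequencyP A : cylinder_set A -> has_mean \1_A (frequency A).
Proof. by move=> /has_mean_cylinder[k hk]; rewrite /frequency; case: xgetP => // /(_ k). Qed.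

Lemma frequencyE A k : has_mean \1_A k -> frequency A = k.
Proof.
move=> hk; apply: (has_mean_unique _ hk).
exact: (@xgetI _ 0 [set k | has_mean \1_A k] k hk).
Qed.

Lemma frequency_ge0 A : 0 <= frequency A.
Proof.
by rewrite /frequency; case: xgetP => // k _ /has_mean_ge0; apply => x; rewrite indicE.
Qed.

(** Frequencies are additive and invariant under the shift, whence the measure; that
they are uniform limits makes it the only one. *)
Theorem subshift_uniquely_ergodic : uniquely_ergodic R (subshift_act a).
Proof.
have [mu hmu] : exists mu : probability (borel X) R,
    forall A, cylinder_set A -> mu A = (frequency A)%:E.
  apply: (clopen_base_extension cylinder_set0 cylinder_setU cylinder_setC
    cylinder_set_open cylinder_set_base) => //.
  - exact: subshift_compact.
  - exact: frequency_ge0.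
  - move=> A B cA cB AB; apply: frequencyE.
    have -> : \1_(A `|` B) = (\1_A : X -> R) \+ \1_B.
      apply/funext => x; rewrite /= !indicE in_setU.
      have : ~ (A x /\ B x) by move=> [? ?]; have : (A `&` B) x by []; rewrite AB.
      case: (boolP (x \in A)); case: (boolP (x \in B)); rewrite ?addr0 ?add0r // !inE => ? ? [].
      by split.
    by apply: has_meanD; exact: frequencyP.
  - apply: frequencyE; rewrite (_ : \1_setT = fun=> 1); first exact: has_mean1.
    by apply/funext => x; rewrite indicE in_setT.
have mcyl := clopen_base_measurable cylinder_set_open.
have scyl := clopen_base_sigma cylinder_set_base.
have icyl := clopen_baseI cylinder_setU cylinder_setC.
have imu : invariant_measure (subshift_act a) mu.
  move=> k A mA.
  pose f (x : borel X) : borel X := subshift_act a k x.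
  have mf : measurable_fun setT f.
    by move=> _ B mB; rewrite setTI; exact: subshift_act_measurable.
  have := @g_sigma_algebra_measure_unique _ R (borel X) cylinder_set mcyl (fun=> setT)
    (fun=> cylinder_setT) (bigcup_const _ (ex_intro _ 0%N I)) (pushforward mu f) mu icyl.
  rewrite /pushforward; apply.
  - move=> B cB; apply: etrans (hmu _ (cylinder_set_act k cB)) _.
    apply: etrans _ (esym (hmu _ cB)); congr EFin; apply: frequencyE.
    exact: (has_mean_shift k (frequencyP cB)).
  - by move=> ?; exact: (eq_ind_r (fun z => (z < +oo)%E) (ltry 1) (probability_setT mu)).
  - exact: scyl.
exists mu => // nu inu A mA.
apply: (uniquely_ergodic_from_averages subshift_act_measurable (G := cylinder_set)) => //.
  exact: cylinder_setT.
move=> B cB e e0; have [n hn] := frequencyP cB e0.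
by exists (frequency B), n.+1, (fun i => i%:Z); split=> // x; exact: hn.
Qed.

Theorem subshift_strictly_ergodic : strictly_ergodic R (subshift_act a).
Proof. by split; [exact: subshift_minimal | exact: subshift_uniquely_ergodic]. Qed.

End SubshiftMeasure.

(** * The suspension as a quotient of X * R *)

Lemma borel_preimage (T T' : ptopologicalType) (f : T -> T') (A : set (borel T')) :
  (forall O : set T', open O -> open (f @^-1` O)) -> measurable A ->
  measurable (f @^-1` A : set (borel T)).
Proof.
move=> fo; apply: (measurable_preimage_generated (T := borel T)) => O oO.
by apply: sub_sigma_algebra; exact: fo.
Qed.

Lemma continuous_pair (A B C : topologicalType) (f : A -> B) (g : A -> C) :
  continuous f -> continuous g -> continuous (fun p => (f p, g p)).
Proof.
move=> cf cg p O [[V W] /= [nV nW] VW].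
have FF : Filter (nbhs p) := nbhs_filter p.
have H : nbhs p ((f @^-1` V) `&` (g @^-1` W)).
  by apply: filterI; [exact: cf | exact: cg].
apply: (@filterS _ _ FF _ _ _ H) => q [Vq Wq].
exact: (VW (f q, g q)).
Qed.

Lemma continuous_fst (A B : topologicalType) : continuous (fst : A * B -> A).
Proof. by move=> p; exact: cvg_fst. Qed.

Lemma continuous_snd (A B : topologicalType) : continuous (snd : A * B -> B).
Proof. by move=> p; exact: cvg_snd. Qed.

Section Suspension.
Context {R : realType} {N : nat}.
Variable a : nat -> 'I_N.+1.
Local Notation X := (subshift_space a).
Hypotheses (a_gt0 : forall n, (0 < a n)%N) (a0_gt1 : (1 < a 0)%N).
Variables (l : alphabet a -> R) (lambda : R).
Hypothesis nl : natural_tile_length l lambda.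
Local Notation Om := (tiling_space l).
Local Notation pi := (\pi_Om : (X * R)%type -> Om).

Definition roof (x : X) : R := l (at_ x 0).

Lemma roof_gt0 x : 0 < roof x.
Proof. by case: nl => _ l0 _ _; exact: l0. Qed.

Lemma roof_ge : exists lo, 0 < lo /\ forall x, lo <= roof x.
Proof.
have [lo [lo0 hlo]] := natural_tile_length_ge a_gt0 a0_gt1 nl.
by exists lo; split=> // x; exact: hlo.
Qed.

Lemma roof_le : exists hi, 0 < hi /\ forall x, roof x <= hi.
Proof.
have [cl _ _ _] := nl; have [hi hhi] := continuous_letter_bounded cl.
have h x : roof x <= hi by apply: le_trans (hhi _); exact: ler_norm.
by exists hi; split=> //; exact: lt_le_trans (roof_gt0 point) (h point).
Qed.

Lemma roof_agree (e : R) : 0 < e -> exists M, forall x y, sagree M x y -> `|roof x - roof y| <= e.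
Proof.
move=> e0; have [M hM] := natural_tile_length_agree a_gt0 a0_gt1 nl e0.
by exists M => x y xy; apply: hM; exact: xy.
Qed.

Lemma roof_continuous : continuous roof.
Proof.
have [cl _ _ _] := nl; move=> x.
exact: (continuous_comp (at_continuous (j := 0) (x := x)) (cl (at_ x 0))).
Qed.

(** Generator of the deck group of the projection to the tiling space. *)
Definition deck (p : X * R) : X * R := (subshift_act a 1 p.1, p.2 - roof p.1).
Definition undeck (p : X * R) : X * R :=
  (subshift_act a (-1) p.1, p.2 + roof (subshift_act a (-1) p.1)).

Lemma deckK : cancel deck undeck.
Proof.
move=> [x t]; rewrite /deck /undeck /= subshift_actD (_ : -1 + 1 = 0 :> int) //.
by rewrite subshift_act0 subrK.
Qed.

Lemma undeckK : cancel undeck deck.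
Proof.
move=> [x t]; rewrite /deck /undeck /= subshift_actD (_ : 1 + -1 = 0 :> int) //.
by rewrite subshift_act0 addrK.
Qed.

Lemma deck_inj : injective deck. Proof. exact: can_inj deckK. Qed.

Lemma susp_stepE p q : susp_step l p q <-> q = deck p.
Proof.
split=> [[x [t [-> ->]]]|->]; first by rewrite /deck /= addrK.
by exists p.1, (p.2 - roof p.1); rewrite /roof /at_ subrK; split=> //; case: p.
Qed.

Lemma iterK_deck n p : iter n undeck (iter n deck p) = p.
Proof. by elim: n p => // n IH p; rewrite iterSr [iter n.+1 deck p]iterS deckK IH. Qed.

(** As [deck] is a bijection, equivalent points have a common forward iterate. *)
Lemma pi_eqP p q : pi p = pi q <-> exists n m, iter n deck p = iter m deck q.
Proof.
split=> [/eqquotP/asboolP|[n [m e]]].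
  elim=> {p q} [p q /susp_stepE ->|p|p q _ [n [m e]]|p q r _ [n [m e]] _ [n' [m' e']]].
  - by exists 1%N, 0%N.
  - by exists 0%N, 0%N.
  - by exists m, n.
  - exists (n' + n)%N, (m + m')%N.
    by rewrite iterD e -iterD addnC iterD e' -iterD.
have H k r : pi (iter k deck r) = pi r.
  elim: k => //= k <-; apply/eqquotP/asboolP; apply: rst_sym; apply: rst_step.
  exact/susp_stepE.
by rewrite -(H n p) e H.
Qed.

Lemma pi_deck p : pi (deck p) = pi p.
Proof. by apply/pi_eqP; exists 0%N, 1%N. Qed.

Lemma pi_undeck p : pi (undeck p) = pi p.
Proof. by rewrite -[in RHS](undeckK p) pi_deck. Qed.

(** A fundamental domain for [deck]: the tilings whose tile of index 0 covers the
origin. *)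
Definition in_box (p : X * R) := 0 <= p.2 /\ p.2 < roof p.1.

Lemma pi_box_ge0 (p : X * R) : 0 <= p.2 -> exists q, in_box q /\ pi q = pi p.
Proof.
have [lo [lo0 hlo]] := roof_ge.
have H n : forall p : X * R, 0 <= p.2 -> p.2 < n%:R * lo -> exists q, in_box q /\ pi q = pi p.
  elim: n => [|n IH] q q0; first by rewrite mul0r ltNge q0.
  rewrite -natr1 mulrDl mul1r => hq.
  have [h|h] := ltP q.2 (roof q.1); first by exists q.
  rewrite -(pi_deck q); apply: IH; rewrite /= ?subr_ge0 //.
  by have := hlo q.1; lra.
move=> p0; apply: (H (Num.bound (p.2 / lo))) => //.
by rewrite -ltr_pdivrMr //; apply: archi_boundP; rewrite divr_ge0 // ltW.
Qed.

Lemma pi_box (w : Om) : exists q, in_box q /\ pi q = w.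
Proof.
have [lo [lo0 hlo]] := roof_ge.
suff [p [p0 <-]] : exists p : X * R, 0 <= p.2 /\ pi p = w by exact: pi_box_ge0.
have [p <-] : exists p : X * R, pi p = w by exists (repr w); rewrite reprK.
pose n := Num.bound (`|p.2| / lo).
exists (iter n undeck p); split; last by elim: n => //= n IH; rewrite pi_undeck.
have : p.2 + n%:R * lo <= (iter n undeck p).2.
  elim: n => [|n IH] /=; first by rewrite mul0r addr0.
  by have := hlo (subshift_act a (-1) (iter n undeck p).1); rewrite -natr1; lra.
apply: le_trans; rewrite -lerBlDl sub0r.
apply: le_trans (ler_norm _) _; rewrite normrN -ler_pdivrMr //.
by apply/ltW/archi_boundP; rewrite divr_ge0 // ltW.
Qed.

Lemma pi_box_inj p q : in_box p -> in_box q -> pi p = pi q -> p = q.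
Proof.
have H n r : in_box r -> (iter n.+1 deck r).2 < 0.
  move=> [_ hr]; elim: n => [|n IH]; first by rewrite /= subr_lt0.
  rewrite iterS /=; have := roof_gt0 (iter n.+1 deck r).1; move: IH => /=; lra.
move=> hp hq /pi_eqP[n [m]].
elim: n m => [|n IH] [|m] // e; last by apply: (IH m); apply: deck_inj.
- by have := H m q hq; rewrite -e ltNge /=; case: hp => ->.
- by have := H n p hp; rewrite e ltNge /=; case: hq => ->.
Qed.

Lemma act_continuous (k : int) : continuous (subshift_act a k : X -> X).
Proof.
move=> x O /nbhs_sagree[M hM].
have FF : Filter (nbhs x) := nbhs_filter x.
by apply: filterS (near_sagree x (M + absz k)) => y /sagree_act; exact: hM.
Qed.

Lemma height_continuous (f : X -> R) (g : X -> X) : continuous f -> continuous g ->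
  continuous (fun p : X * R => p.2 + f (g p.1)).
Proof.
move=> cf cg p; apply: (@continuousD _ _ _ (fun p : X * R => p.2)); first exact: continuous_snd.
apply: (@continuous_comp _ _ _ (fun p : X * R => p.1) (f \o g)); first exact: continuous_fst.
by apply: continuous_comp; [exact: cg | exact: cf].
Qed.

Lemma deck_continuous : continuous deck.
Proof.
apply: continuous_pair.
  by move=> p; apply: (@continuous_comp _ _ _ fst); [exact: continuous_fst | exact: act_continuous].
apply: (@height_continuous (fun x => - roof x) id); last by move=> x; exact: cvg_id.
by move=> x; apply: continuousN; exact: roof_continuous.
Qed.

Lemma undeck_continuous : continuous undeck.
Proof.
apply: continuous_pair.
  by move=> p; apply: (@continuous_comp _ _ _ fst); [exact: continuous_fst | exact: act_continuous].
by apply: height_continuous; [exact: roof_continuous | exact: act_continuous].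
Qed.

Lemma pi_open (V : set (X * R)) : open V -> open (pi @` V).
Proof.
move=> oV; rewrite /open /= /quotient_open.
have -> : pi @^-1` (pi @` V) = \bigcup_n \bigcup_m ((iter n undeck \o iter m deck) @^-1` V).
  apply/seteqP; split=> q.
    move=> [p Vp /pi_eqP[n [m e]]]; exists n => //; exists m => //=.
    by rewrite -e iterK_deck.
  move=> [n _ [m _ /= Vq]]; exists (iter n undeck (iter m deck q)) => //.
  have U k r : pi (iter k undeck r) = pi r by elim: k => //= k IH; rewrite pi_undeck.
  have V' k r : pi (iter k deck r) = pi r by elim: k => //= k IH; rewrite pi_deck.
  by rewrite U V'.
have itc (f : X * R -> X * R) : continuous f -> forall n, continuous (iter n f).
  move=> cf; elim=> [|n IH] /= p; first exact: cvg_id.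
  by apply: (continuous_comp (IH p)); exact: cf.
apply: bigcup_open => n _; apply: bigcup_open => m _.
apply: open_comp => // p _; apply: continuous_comp; first exact: itc deck_continuous _ _.
exact: itc undeck_continuous _ _.
Qed.

(** These sets form a pi-system that generates the Borel sets, and their indicators
can be averaged along the flow tile by tile. *)
Definition box_slice (C : set X) (t : R) : set (borel Om) :=
  [set w | exists p, [/\ in_box p, C p.1, p.2 < t & pi p = w]].

Lemma box_sliceE C t p : in_box p -> box_slice C t (pi p) <-> C p.1 /\ p.2 < t.
Proof.
move=> hp; split=> [[q [hq Cq qt /(pi_box_inj hq hp) <-]]//|[Cp pt]].
by exists p.
Qed.

(** The fundamental domain is not open, but the slice is the intersection of the
images of open sets that extend it slightly below height 0. *)
Lemma box_slice_measurable C t : cylinder_set C -> measurable (box_slice C t).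
Proof.
move=> cC.
pose V n := [set p : X * R | C p.1 /\ - n.+1%:R^-1 < p.2 < t /\ p.2 < roof p.1].
have -> : box_slice C t = \bigcap_n (pi @` V n).
  apply/seteqP; split=> w.
    move=> [p [[p0 pr] Cp pt <-]] n _; exists p => //; split=> //; split=> //.
    by rewrite pt andbT (lt_le_trans _ p0) // oppr_lt0 invr_gt0.
  have [q [hq <-]] := pi_box w => hw; apply/(box_sliceE _ _ hq).
  have [lo [lo0 hlo]] := roof_ge.
  pose d := Num.min lo (roof q.1 - q.2).
  have d0 : 0 < d by rewrite lt_min lo0 subr_gt0; case: hq.
  pose n := Num.bound d^-1.
  have hn : n.+1%:R^-1 < d.
    rewrite -[d]invrK ltf_pV2 ?posrE ?invr_gt0 ?ltr0n //.
    apply: lt_le_trans (archi_boundP _) _; first by rewrite invr_ge0 ltW.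
    by rewrite ler_nat.
  have [p [Cp [/andP[pn pt] pr]] pq] := hw n I.
  have [p0|p0] := leP 0 p.2.
    by rewrite -(pi_box_inj (p := p) _ hq pq).
  have hu : in_box (undeck p).
    split=> /=; last by lra.
    have := hlo (subshift_act a (-1) p.1).
    have dlo : d <= lo by rewrite ge_min lexx.
    have {}pn : - lo < p.2.
      by apply: lt_trans pn; rewrite ltrN2; exact: lt_le_trans hn dlo.
    lra.
  have uq : undeck p = q by apply: pi_box_inj => //; rewrite pi_undeck.
  have dq : d <= roof q.1 - q.2 by rewrite ge_min lexx orbT.
  have q2 : q.2 = p.2 + roof q.1 by rewrite -uq.
  by exfalso; move: (n.+1%:R^-1) hn pn dq => z; move: (d : R) => d'; lra.
apply: bigcapT_measurable => n; apply: sub_sigma_algebra; apply: pi_open.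
have -> : V n = ((fst : X * R -> X) @^-1` C) `&` ((snd : X * R -> R) @^-1` `]- n.+1%:R^-1, t[)
    `&` ((fun p : X * R => p.2 + (- roof p.1)) @^-1` [set x | x < 0]).
  apply/seteqP; split=> p /=; rewrite in_itv /= subr_lt0; first by move=> [? [? ?]].
  by move=> [[? ?] ?].
apply: openI; first apply: openI.
- by apply: open_comp; [move=> p _; exact: continuous_fst | exact: cylinder_set_open].
- by apply: open_comp; [move=> p _; exact: continuous_snd | exact: interval_open].
- apply: open_comp; last exact: open_lt.
  move=> p _; apply: (@height_continuous (fun x => - roof x) id).
    by move=> x; apply: continuousN; exact: roof_continuous.
  by move=> x; exact: cvg_id.
Qed.

Definition box_slices : set (set (borel Om)) :=
  [set A | exists C t, cylinder_set C /\ A = box_slice C t].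

Lemma box_slicesI : setI_closed box_slices.
Proof.
move=> _ _ [C [t [cC ->]]] [C' [t' [cC' ->]]].
exists (C `&` C'), (Num.min t t'); split.
  by apply: clopen_baseI => //; [exact: cylinder_setU | exact: cylinder_setC].
apply/seteqP; split=> w; have [q [hq <-]] := pi_box w.
  move=> [/(box_sliceE _ _ hq)[h1 h2] /(box_sliceE _ _ hq)[h3 h4]].
  by apply/(box_sliceE _ _ hq); rewrite lt_min h2 h4.
move=> /(box_sliceE _ _ hq)[[h1 h3]]; rewrite lt_min => /andP[h2 h4].
by split; apply/(box_sliceE _ _ hq).
Qed.

Lemma box_slicesT : box_slices setT.
Proof.
have [hi [_ hhi]] := roof_le.
exists setT, hi; split; first exact: cylinder_setT.
apply/seteqP; split=> // w _; have [q [hq <-]] := pi_box w.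
by apply/(box_sliceE _ _ hq); split=> //; case: hq => _ h; exact: lt_le_trans h (hhi _).
Qed.

(** An open set is a countable union of products of a cylinder and an interval of a
grid, and such a product is a difference of two slices. *)
Lemma box_slices_sigma (A : set (borel Om)) : measurable A -> <<s box_slices >> A.
Proof.
apply: smallest_sub; first exact: smallest_sigma_algebra.
move=> U oU.
pose grid n k := k%:R / n.+1%:R : R.
pose C n k M := [set x : X | forall y, sagree M y x -> forall u, grid n k <= u < grid n k.+1 -> U (pi (y, u))].
have cC n k M : cylinder_set (C n k M).
  exists M => x y xy h z zy; apply: h; apply: sagree_trans zy _; exact: sagree_sym.
have -> : U = \bigcup_n \bigcup_k \bigcup_M (box_slice (C n k M) (grid n k.+1) `\` box_slice (C n k M) (grid n k)).
  apply/seteqP; split=> w; have [[x u] [hq <-]] := pi_box w; last first.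
    move=> [n _ [k _ [M _ [/(box_sliceE _ _ hq)[/= Cx h1] h2]]]].
    apply: (Cx x (@sagree_refl _ _ _ _)); rewrite h1 andbT leNgt; apply/negP => h3.
    by apply: h2; apply/(box_sliceE _ _ hq).
  move=> Uw; have [u0 ur] := hq; rewrite /= in u0 ur.
  have nU : nbhs (x, u) (pi @^-1` U).
    by apply: open_nbhs_nbhs; split=> //; exact: oU.
  have [[V W] /= [/nbhs_sagree[M hM] /nbhs_ballP[e /= e0 eW]] VW] := nU.
  pose n := Num.bound e^-1; pose k := Num.truncn (u * n.+1%:R).
  have n0 : 0 < n.+1%:R :> R by rewrite ltr0n.
  have ne : n.+1%:R^-1 < e.
    rewrite -[e]invrK ltf_pV2 ?posrE ?invr_gt0 //.
    apply: lt_le_trans (archi_boundP _) _; first by rewrite invr_ge0 ltW.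
    by rewrite ler_nat.
  have /andP[k1 k2] : k%:R <= u * n.+1%:R < k.+1%:R by apply: truncn_itv; rewrite mulr_ge0 // ltW.
  exists n => //; exists k => //; exists M => //.
  have hC : C n k M x.
    move=> y yx u' /andP[h1 h2]; apply: (VW (y, u')); split; first exact: hM.
    apply: eW; rewrite /ball /= ltr_norml.
    move: h1 h2; rewrite /grid -[k.+1%:R]natr1 mulrDl mul1r => h1 h2.
    move: k1; rewrite -ler_pdivrMr // => k1.
    move: k2; rewrite -ltr_pdivlMr // -[k.+1%:R]natr1 mulrDl mul1r => k2.
    by move: (n.+1%:R^-1) (k%:R / _) ne h1 h2 k1 k2 => z z' ? ? ? ? ?; apply/andP; split; lra.
  split; first by apply/(box_sliceE _ _ hq); split=> //=; rewrite /grid ltr_pdivlMr.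
  by move=> /(box_sliceE _ _ hq)[_ /=]; rewrite /grid ltr_pdivlMr // ltNge k1.
have mG B : box_slices B -> @measurable _ (g_sigma_algebraType box_slices) B by exact: sub_sigma_algebra.
suff : @measurable _ (g_sigma_algebraType box_slices) (\bigcup_n \bigcup_k \bigcup_M
    (box_slice (C n k M) (grid n k.+1) `\` box_slice (C n k M) (grid n k))) by [].
apply: bigcupT_measurable => n; apply: bigcupT_measurable => k; apply: bigcupT_measurable => M.
have bs t : box_slices (box_slice (C n k M) t) by exists (C n k M), t; split.
by apply: measurableD; apply: mG; exact: bs.
Qed.

Lemma flow_pi s x t : tiling_flow l s (pi (x, t)) = pi (x, t + s).
Proof. exact: tiling_flow_pi. Qed.

Lemma flow_measurable s (A : set (borel Om)) : measurable A ->
  measurable (tiling_flow l s @^-1` A : set (borel Om)).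
Proof.
apply: borel_preimage => O oO; rewrite /open /= /quotient_open.
have -> : pi @^-1` (tiling_flow l s @^-1` O) = (fun p : X * R => (p.1, p.2 + s)) @^-1` (pi @^-1` O).
  by apply/seteqP; split=> -[x t]; rewrite /= flow_pi.
apply: open_comp => // p _; move: p; apply: continuous_pair; first exact: continuous_fst.
by move=> p; apply: continuousD; [exact: continuous_snd | exact: cst_continuous].
Qed.

Lemma pi_act (k : int) x : exists r, forall v, pi (subshift_act a k x, v) = pi (x, v + r).
Proof.
have H n : exists r, forall v, pi (subshift_act a n%:Z x, v) = pi (x, v + r).
  elim: n => [|n [r IH]]; first by exists 0 => v; rewrite subshift_act0 addr0.
  exists (roof (subshift_act a n%:Z x) + r) => v.
  rewrite addrA -IH -[in RHS]pi_deck /deck /= addrK subshift_actD.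
  by congr (pi (subshift_act a _ x, v)); lia.
have H' n : exists r, forall v, pi (subshift_act a (- n%:Z) x, v) = pi (x, v + r).
  elim: n => [|n [r IH]]; first by exists 0 => v; rewrite oppr0 subshift_act0 addr0.
  exists (- roof (subshift_act a (- n.+1%:Z) x) + r) => v.
  rewrite addrA -IH -[in RHS]pi_undeck /undeck /= subshift_actD.
  have -> : -1 + - n%:Z = - n.+1%:Z by lia.
  by rewrite subrK.
by case: k => n; [exact: H | rewrite NegzE; exact: H'].
Qed.

(** Shifting the sequence amounts to translating the tiling, so the density of an
orbit follows from that of the orbit of the sequence under the shift. *)
Theorem flow_minimal : minimal_action (tiling_flow l).
Proof.
move=> w O [w' Ow'] oO.
have [[x u] [_ ew]] := pi_box w; have [[y v] [_ ew']] := pi_box w'.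
have nV : nbhs y [set z | O (pi (z, v))].
  have nO : nbhs (y, v) (pi @^-1` O) by apply: open_nbhs_nbhs; split=> /=; [exact: oO | rewrite ew'].
  have [[V W] /= [nV nW] VW] := nO.
  apply: filterS nV => z Vz; apply: (VW (z, v)); split=> //=; exact: nbhs_singleton.
move: (nV); rewrite nbhsE => -[V [oV Vy] VO].
have [z [Vz [k _ kz]]] := subshift_minimal a_gt0 x (ex_intro V y Vy) oV.
have [r hr] := pi_act k x.
exists (tiling_flow l (v + r - u) w); split; last by exists (v + r - u).
rewrite -ew flow_pi addrC subrK -hr; apply: VO; by rewrite kz.
Qed.

End Suspension.

(** * Counting sampling times *)

Section Sampling.
Context {R : realType}.
Variable eta : R.
Hypothesis eta_gt0 : 0 < eta.

Definition samples_before n (p : R) : R := \sum_(j < n) (j%:R * eta < p)%R%:R.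

Definition clip n (p : R) : R := Num.max 0 (Num.min p (n%:R * eta)).

(** Each sampling time stands for an interval of length [eta]. *)
Lemma samples_before_clip n p :
  clip n p <= eta * samples_before n p <= clip n p + eta.
Proof.
have n0 m : 0 <= m%:R * eta by rewrite mulr_ge0 // ltW.
have le_n m : samples_before m p <= m%:R.
  rewrite -[X in _ <= X%:R]card_ord -sumr_const.
  by apply: ler_sum => j _; case: (_ < _); rewrite ?ler01.
elim: n => [|n IH].
  rewrite /samples_before big_ord0 mulr0 /clip mul0r.
  have -> : Num.max 0 (Num.min p 0) = 0 :> R by apply/max_idPl; rewrite ge_min lexx orbT.
  by rewrite lexx add0r ltW.
rewrite /samples_before big_ord_recr /= -/(samples_before n p).
have n1 : n.+1%:R * eta = n%:R * eta + eta by rewrite -natr1 mulrDl mul1r.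
have := n0 n; have := n0 n.+1; rewrite n1 => h1 h0.
have [hp|hp] := ltP (n%:R * eta) p.
  have e : eta * samples_before n p = n%:R * eta.
    apply/eqP; rewrite eq_le {1}mulrC ler_pM2r // le_n /=.
    move: IH => /andP[+ _]; apply: le_trans.
    by rewrite /clip (min_idPr (ltW hp)) (max_idPr h0).
  rewrite mulrDr mulr1 e /clip n1.
  have [h2|h2] := leP p (n%:R * eta + eta); rewrite ?(min_idPl h2).
    by rewrite (max_idPr (ltW (le_lt_trans h0 hp))); apply/andP; split; lra.
  by rewrite (max_idPr h1) ; apply/andP; split; lra.
rewrite mulr0n addr0; suff -> : clip n.+1 p = clip n p by [].
by rewrite /clip n1 (min_idPl hp) (min_idPl _) //; lra.
Qed.

Lemma clip_mono n p p' : p <= p' -> 0 <= clip n p' - clip n p <= p' - p.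
Proof.
move=> pp; have n0 : 0 <= n%:R * eta by rewrite mulr_ge0 // ltW.
rewrite /clip; move: (n%:R * eta) n0 => z z0.
have mE (y : R) : Num.max 0 (Num.min y z) = if y <= 0 then 0 else if y <= z then y else z.
  by case: (leP y z) => h1; case: (leP y 0) => h2 //; [apply/max_idPl; lra | apply/max_idPr].
rewrite !mE; case: (leP p 0) => ?; case: (leP p' 0) => ?; case: (leP p z) => ?;
  case: (leP p' z) => ?; apply/andP; split; lra.
Qed.

End Sampling.

(** * Uniform averages along the flow *)

Section FlowAverages.
Context {R : realType} {N : nat}.
Variable a : nat -> 'I_N.+1.
Local Notation X := (subshift_space a).
Hypotheses (a_gt0 : forall n, (0 < a n)%N) (a0_gt1 : (1 < a 0)%N).
Variables (l : alphabet a -> R) (lambda : R).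
Hypothesis nl : natural_tile_length l lambda.
Local Notation Om := (tiling_space l).
Local Notation pi := (\pi_Om : (X * R)%type -> Om).
Local Notation roof := (roof l).
Local Notation slice := (@box_slice R N a l).

Lemma sumf_recl (g : X -> R) n x : sumf g n.+1 x = g x + sumf g n (subshift_act a 1 x).
Proof.
rewrite /sumf big_ord_recl subshift_act0; congr (_ + _).
apply: eq_bigr => i _; rewrite subshift_actD; congr (g (subshift_act a _ x)).
by rewrite /= /bump; lia.
Qed.

Lemma sumf_recr (g : X -> R) n x : sumf g n.+1 x = sumf g n x + g (subshift_act a n%:Z x).
Proof. by rewrite /sumf big_ord_recr. Qed.

(** The time spent in the slice while crossing the tile at the origin. *)
Definition stay (C : set X) (t : R) (x : X) : R :=
  \1_C x * Num.max 0 (Num.min t (roof x)).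

Lemma stay_bound C t x : 0 <= stay C t x <= roof x.
Proof.
have r0 := roof_gt0 nl x.
rewrite /stay indicE; case: (x \in C); last by rewrite mul0r lexx ltW.
by rewrite mul1r; apply/andP; split; [rewrite le_max lexx | rewrite ge_max ge_min lexx orbT (ltW r0)].
Qed.

Lemma in_box_slice C t x u : in_box l (x, u) -> \1_(slice C t) (pi (x, u)) = (u < stay C t x)%R%:R :> R.
Proof.
move=> hb; have [/= u0 ur] := hb; rewrite indicE; congr (_%:R).
congr nat_of_bool; apply/idP/idP; rewrite inE.
  move=> /(box_sliceE nl _ _ hb)[/= Cx ut].
  by rewrite /stay indicE mem_set // mul1r lt_max lt_min ut ur orbT.
move=> h; apply/(box_sliceE nl _ _ hb) => /=; move: h.
rewrite /stay indicE; case: (boolP (x \in C)) => xC; rewrite ?mulr0n ?mulr1n ?mul0r ?mul1r; last by rewrite ltNge u0.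
by rewrite lt_max lt_min [_ < 0]ltNge u0 /= => /andP[ut _]; rewrite inE in xC.
Qed.

(** The orbit crosses the tiles one after the other; the only term that does not
cancel is that of the tile crossed at time [v]. *)
Lemma slice_visits C t I x v : 0 <= v -> v < sumf roof I x ->
  \1_(slice C t) (pi (x, v)) = \sum_(i < I) ((v < sumf roof i x + stay C t (subshift_act a i%:Z x))%R%:R
    - (v < sumf roof i x)%R%:R) :> R.
Proof.
elim: I x v => [|I IH] x v v0; first by rewrite /sumf big_ord0 ltNge v0.
move=> hv; rewrite big_ord_recl /= {1 2}/sumf !big_ord0 add0r subshift_act0 [v < 0]ltNge v0 subr0.
have sE (i : 'I_I) : sumf roof (bump 0 i) x = roof x + sumf roof i (subshift_act a 1 x).
  by rewrite /bump add1n sumf_recl.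
have aE (i : 'I_I) : subshift_act a (bump 0 i)%:Z x = subshift_act a i%:Z (subshift_act a 1 x).
  by rewrite subshift_actD; congr (subshift_act a _ x); rewrite /bump; lia.
have s0 i y : 0 <= sumf roof i y by apply: sumr_ge0 => j _; rewrite ltW // (roof_gt0 nl).
have [h|h] := ltP v (roof x).
  rewrite in_box_slice //; rewrite big1 ?addr0 // => i _.
  rewrite sE aE; have := s0 i (subshift_act a 1 x).
  have /andP[t0 _] := stay_bound C t (subshift_act a i (subshift_act a 1 x)) => h'.
  by rewrite !(lt_le_trans h) ?subrr //; lra.
have /andP[_ hs] := stay_bound C t x.
rewrite [v < stay _ _ _]ltNge (le_trans hs h) add0r.
have -> : pi (x, v) = pi (subshift_act a 1 x, v - roof x) by rewrite -[LHS]pi_deck.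
rewrite IH; first last.
- by move: hv; rewrite sumf_recl; lra.
- by rewrite subr_ge0.
by apply: eq_bigr => i _; rewrite sE aE -addrA !ltrBlDl.
Qed.

(** In each tile, the number of samples times [eta] differs from the time spent in the
slice by at most [eta]. Clipping takes care of the tiles crossed after the last
sample. *)
Lemma visit_count C t (eta : R) n I x u : in_box l (x, u) -> 0 < eta ->
  u + n%:R * eta <= sumf roof I x ->
  `|eta * (\sum_(j < n) \1_(slice C t) (pi (x, u + j%:R * eta))) - sumf (stay C t) I x|
    <= I%:R * eta + (sumf roof I x - n%:R * eta).
Proof.
move=> [/= u0 ur] e0 hI.
pose S i := sumf roof i x; pose len i := stay C t (subshift_act a i%:Z x).
pose K := samples_before eta n; pose cl := clip eta n.
have -> : \sum_(j < n) \1_(slice C t) (pi (x, u + j%:R * eta)) =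
    \sum_(i < I) (K (S i + len i - u) - K (S i - u)).
  rewrite (eq_bigr (fun j : 'I_n => \sum_(i < I) ((j%:R * eta < S i + len i - u)%R%:R - (j%:R * eta < S i - u)%R%:R : R))).
    by rewrite exchange_big; apply: eq_bigr => i _; rewrite sumrB.
  move=> j _; rewrite (slice_visits C t (I := I)).
  - by apply: eq_bigr => i _; rewrite !ltrBrDl.
  - by rewrite addr_ge0 // mulr_ge0 // ltW.
  - by apply: lt_le_trans hI; rewrite ltrD2l ltr_pM2r // ltr_nat.
have -> : sumf (stay C t) I x = \sum_(i < I) len i by [].
have clu : cl (- u) = 0.
  by rewrite /cl /clip; apply/max_idPl; rewrite ge_min oppr_le0 u0.
have clS : cl (S I - u) = n%:R * eta.
  rewrite /cl /clip (min_idPr _); first by apply/max_idPr; rewrite mulr_ge0 // ltW.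
  by rewrite lerBrDl.
have step i : `|eta * (K (S i + len i - u) - K (S i - u)) - len i| <=
    eta + ((S i.+1 - u - cl (S i.+1 - u)) - (S i - u - cl (S i - u))).
  have /andP[k1 k2] := samples_before_clip e0 n (S i + len i - u).
  have /andP[k3 k4] := samples_before_clip e0 n (S i - u).
  have /andP[l0 l1] := stay_bound C t (subshift_act a i%:Z x).
  have Si : S i.+1 = S i + roof (subshift_act a i%:Z x) by exact: sumf_recr.
  have /andP[c1 c2] := clip_mono e0 n (p := S i - u) (p' := S i + len i - u) ltac:(rewrite /len; lra).
  have /andP[c3 c4] := clip_mono e0 n (p := S i + len i - u) (p' := S i.+1 - u) ltac:(rewrite /len; lra).
  rewrite mulrBr -/cl in k1 k2 k3 k4 c1 c2 c3 c4 *; rewrite -/K in k1 k2 k3 k4 *.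
  move: l0 l1; rewrite -/(len i) => l0 l1; rewrite ler_norml; apply/andP; split; lra.
rewrite mulr_sumr -sumrB; apply: le_trans (ler_norm_sum _ _ _) _.
apply: (@le_trans _ _ (\sum_(i < I) (eta + ((S i.+1 - u - cl (S i.+1 - u)) - (S i - u - cl (S i - u)))))).
  by apply: ler_sum => i _; exact: step.
rewrite big_split /= sumr_const card_ord mulr_natl lerD2l.
rewrite -(big_mkord xpredT (fun i => (S i.+1 - u - cl (S i.+1 - u)) - (S i - u - cl (S i - u)))).
rewrite telescope_sumr // clS.
have -> : S 0%N = 0 by rewrite /S /sumf big_ord0.
by rewrite sub0r clu -/(S I); lra.
Qed.

Lemma clamp_lipschitz (t r r' : R) :
  `|Num.max 0 (Num.min t r) - Num.max 0 (Num.min t r')| <= `|r - r'|.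
Proof.
wlog rr : r r' / r <= r'.
  move=> H; have [/H//|/ltW/H] := leP r r'.
  by rewrite distrC [X in _ <= X]distrC.
rewrite distrC [X in _ <= X]distrC [X in _ <= X]ger0_norm ?subr_ge0 //.
have mE (y : R) : Num.max 0 (Num.min t y) = if Num.min t y <= 0 then 0 else Num.min t y.
  by case: (leP (Num.min t y) 0).
have nE (y : R) : Num.min t y = if t <= y then t else y.
  by case: (leP t y).
rewrite !mE !nE ler_norml; case: (leP t r) => ?; case: (leP t r') => ?; case: (leP t 0) => ?;
  case: (leP r 0) => ?; case: (leP r' 0) => ?; apply/andP; split; lra.
Qed.

Lemma stay_agree C t : cylinder_set C -> forall e : R, 0 < e ->
  exists M, forall x y, sagree M x y -> `|stay C t x - stay C t y| <= e.
Proof.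
move=> [M1 hM1] e e0; have [M2 hM2] := roof_agree a_gt0 a0_gt1 nl e0.
exists (maxn M1 M2) => x y xy; rewrite /stay !indicE.
have -> : (x \in C) = (y \in C).
  have xy1 := sagree_le (leq_maxl M1 M2) xy.
  by apply/idP/idP; rewrite !inE; apply: hM1 => //; exact: sagree_sym.
case: (y \in C); last by rewrite !mul0r subrr normr0 ltW.
rewrite !mulr1n !mul1r; apply: le_trans (clamp_lipschitz _ _ _) _.
by apply: hM2; exact: sagree_le (leq_maxr _ _) xy.
Qed.

Lemma stay_has_mean C t : cylinder_set C -> exists k, has_mean (stay C t) k.
Proof.
move=> cC; have [hi [hi0 hhi]] := roof_le nl.
apply: (has_mean_continuous a_gt0 a0_gt1 (B := hi)); last exact: stay_agree.
by move=> x; have /andP[h1 h2] := stay_bound C t x; rewrite ger0_norm // (le_trans h2).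
Qed.

Lemma roof_has_mean : exists k, 0 < k /\ has_mean roof k.
Proof.
have [hi [hi0 hhi]] := roof_le nl; have [lo [lo0 hlo]] := roof_ge a_gt0 a0_gt1 nl.
have [k hk] : exists k, has_mean roof k.
  apply: (has_mean_continuous a_gt0 a0_gt1 (B := hi)); last exact: (roof_agree a_gt0 a0_gt1 nl).
  by move=> x; rewrite ger0_norm ?hhi // ltW // (roof_gt0 nl).
exists k; split=> //.
have [n hn] := hk _ (divr_gt0 lo0 (ltr0Sn R 1)).
have := hn n.+1 (leqnSn n) point; rewrite ler_norml => /andP[_].
have : lo * n.+1%:R <= sumf roof n.+1 point.
  by rewrite mulr_natr -[n.+1 in leLHS](card_ord n.+1) -sumr_const; apply: ler_sum.
have n0 : 0 < n.+1%:R :> R by rewrite ltr0n.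
by move=> h1 h2; rewrite -(pmulr_lgt0 _ n0); nra.
Qed.

(** By [visit_count] the average over the samples is, up to small errors, the quotient
of the Birkhoff averages of [stay] and [roof], which converge uniformly. *)
Lemma flow_average C t (e : R) : cylinder_set C -> 0 < e ->
  exists (k : R) n (g : nat -> R), (0 < n)%N /\
    forall w, `|\sum_(i < n) \1_(slice C t) (tiling_flow l (g i) w) - k * n%:R| <= e * n%:R.
Proof.
move=> cC e0.
have [hi [hi0 hhi]] := roof_le nl; have [lo [lo0 hlo]] := roof_ge a_gt0 a0_gt1 nl.
have [kg hkg] := stay_has_mean t cC; have [kr [kr0 hkr]] := roof_has_mean.
pose k := kg / kr; pose c := 1 + `|k|.
have c0 : 0 < c by rewrite /c ltr_pwDl.
(* One sampling step per tile has to be a small share of the length of a tile. *)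
pose eta := e * lo / 4; have eta0 : 0 < eta by rewrite divr_gt0 // mulr_gt0.
pose d := eta / c; have d0 : 0 < d by rewrite divr_gt0.
have dc : d * c = eta by rewrite /d divfK // lt0r_neq0.
have [I1 hI1] := hkg _ d0; have [I2 hI2] := hkr _ d0.
pose n1 := Num.bound ((e * hi + 2 * hi * c) / (e * eta / 2)).
pose n2 := Num.bound ((maxn I1 I2)%:R * hi / eta).
pose n := (maxn n1 n2).+1.
have e1 : 0 < e * eta / 2 by rewrite divr_gt0 // mulr_gt0.
have hn1 : e * hi + 2 * hi * c <= e * eta / 2 * n%:R.
  have h : (e * hi + 2 * hi * c) / (e * eta / 2) < n1%:R.
    by apply: archi_boundP; rewrite divr_ge0 ?(ltW e1) // addr_ge0 // ?mulr_ge0 // ltW.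
  rewrite [leRHS]mulrC -ler_pdivrMr //; apply: le_trans (ltW h) _; rewrite ler_nat.
  exact: leqW (leq_maxl _ _).
have hn2 : (maxn I1 I2)%:R * hi <= n%:R * eta.
  have h : (maxn I1 I2)%:R * hi / eta < n2%:R.
    by apply: archi_boundP; rewrite divr_ge0 // ?mulr_ge0 // ltW.
  rewrite -ler_pdivrMr //; apply: le_trans (ltW h) _; rewrite ler_nat.
  exact: leqW (leq_maxr _ _).
exists k, n, (fun j => j%:R * eta); split=> // w.
have [[x u] [hb <-]] := pi_box a_gt0 a0_gt1 nl w.
under eq_bigr do rewrite flow_pi.
have [/= u0 ur] := hb.
have n0 : 0 < n%:R :> R by rewrite ltr0n.
have ex : exists I, u + n%:R * eta <= sumf roof I x.
  exists (Num.bound ((u + n%:R * eta) / lo)).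
  set m := Num.bound _.
  have : lo * m%:R <= sumf roof m x.
    by rewrite mulr_natr -[m in leLHS](card_ord m) -sumr_const; apply: ler_sum.
  move=> h; apply: le_trans h; rewrite [leRHS]mulrC -ler_pdivrMr //; apply/ltW/archi_boundP.
  by rewrite divr_ge0 ?addr_ge0 ?mulr_ge0 // ltW.
pose I := ex_minn ex.
have [hI minI] : u + n%:R * eta <= sumf roof I x /\ forall m, u + n%:R * eta <= sumf roof m x -> (I <= m)%N.
  by rewrite /I; case: ex_minnP.
have ne0 : 0 < n%:R * eta by rewrite mulr_gt0.
have SI : sumf roof I x <= n%:R * eta + 2 * hi.
  case: I hI minI => [|I] hI minI; first by move: hI; rewrite /sumf big_ord0; lra.
  have : ~ (u + n%:R * eta <= sumf roof I x) by move=> /minI; rewrite ltnn.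
  move/negP; rewrite -ltNge sumf_recr => h.
  by have := hhi (subshift_act a I%:Z x); have := hhi x; lra.
have Ilo : I%:R * lo <= sumf roof I x.
  by rewrite mulr_natl -[I in leLHS](card_ord I) -sumr_const; apply: ler_sum.
have Ihi : sumf roof I x <= I%:R * hi.
  by rewrite mulr_natl -[I in leRHS](card_ord I) -sumr_const; apply: ler_sum.
have II : (maxn I1 I2 <= I)%N.
  rewrite -(ler_nat R) -(ler_pM2r hi0); apply: le_trans hn2 _.
  by apply: le_trans Ihi; lra.
have g1 := hI1 I (leq_trans (leq_maxl _ _) II) x.
have g2 := hI2 I (leq_trans (leq_maxr _ _) II) x.
have g0 := visit_count C t hb eta0 hI.
rewrite -(ler_pM2l eta0).
set A := \sum_(i < n) _ in g0 *.
have -> : eta * `|A - k * n%:R| = `|eta * (A - k * n%:R)| by rewrite normrM (gtr0_norm eta0).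
set G := sumf (stay C t) I x in g0 g1 *; set S := sumf roof I x in g0 g2 SI Ilo Ihi hI *.
have -> : eta * (A - k * n%:R) = (eta * A - G) + (G - kg * I%:R) - k * (S - kr * I%:R) + k * (S - n%:R * eta).
  by rewrite /k; field; rewrite lt0r_neq0.
have t1 : `|k * (S - kr * I%:R)| <= `|k| * (d * I%:R) by rewrite normrM ler_wpM2l.
have t2 : `|k * (S - n%:R * eta)| <= `|k| * (S - n%:R * eta).
  by rewrite normrM ler_wpM2l // ger0_norm //; lra.
have t3 : `|k| * (S - n%:R * eta) <= `|k| * (2 * hi) by rewrite ler_wpM2l //; lra.
have q1 := ler_normD (eta * A - G + (G - kg * I%:R) - k * (S - kr * I%:R)) (k * (S - n%:R * eta)).
have q2 := ler_normB (eta * A - G + (G - kg * I%:R)) (k * (S - kr * I%:R)).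
have q3 := ler_normD (eta * A - G) (G - kg * I%:R).
have I0 : 0 <= I%:R :> R by [].
have s1 : d * I%:R + `|k| * (d * I%:R) = eta * I%:R by rewrite -dc /c; ring.
have s2 : eta * I%:R <= e / 4 * (n%:R * eta + 2 * hi).
  have -> : eta * I%:R = e / 4 * (I%:R * lo) by rewrite /eta; field.
  by rewrite ler_wpM2l ?(le_trans Ilo) // divr_ge0 // ltW.
move: hn1; rewrite /c => hn1.
have s3 : e * eta / 2 * n%:R = e / 2 * (n%:R * eta) by field.
rewrite s3 in hn1; have s4 : eta * (e * n%:R) = e * (n%:R * eta) by ring.
rewrite s4; move: (n%:R * eta) => z in t2 t3 g0 SI hI hn1 s2 q1 *.
lra.
Qed.

End FlowAverages.

(** * An invariant measure for the flow *)

Lemma lebesgue_measure_translation (R : realType) (r : R) (A : set (measurableTypeR R)) :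
  measurable A -> lebesgue_measure ((fun u => u - r) @^-1` A) = lebesgue_measure A.
Proof.
move=> mA; pose f (u : measurableTypeR R) : measurableTypeR R := u - r.
have mf : measurable_fun setT f by exact: measurable_funB.
have := @lebesgue_measure_unique R (pushforward lebesgue_measure f).
rewrite /pushforward => /(_ mf)/(_ _ A mA)/wrap[]//.
move=> _ [[x y]] _ <- /=.
rewrite /pushforward; have -> : f @^-1` `]x, y] = `]x + r, y + r]%classic.
  by apply/seteqP; split=> u; rewrite /f /= !in_itv /= ltrBrDr lerBlDr.
by rewrite !lebesgue_measure_itv /= !lte_fin ltrD2r; congr (if _ then _ else _); rewrite -!EFinB; congr EFin; ring.
Qed.

Lemma continuous_borel_measurable (R : realType) (T : ptopologicalType) (f : T -> R) :
  continuous f -> measurable_fun setT (f : borel T -> R).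
Proof.
move=> cf; move=> mT; apply: (measurability _ (RGenOpens.measurableE R)) => //; move: mT => _.
move=> _ [_ [x [y ->]] <-]; rewrite setTI; apply: sub_sigma_algebra.
by apply: open_comp; [move=> p _; exact: cf | exact: interval_open].
Qed.

Lemma measurable_set_lt d (T : measurableType d) (R : realType) (f g : T -> R) :
  measurable_fun setT f -> measurable_fun setT g -> measurable [set x | f x < g x].
Proof.
move=> mf mg; have := measurable_fun_ltr mf mg measurableT (Y := [set true]).
move=> /(_ I); rewrite setTI; congr measurable.
Qed.

Lemma measurable_set_le d (T : measurableType d) (R : realType) (f g : T -> R) :
  measurable_fun setT f -> measurable_fun setT g -> measurable [set x | f x <= g x].
Proof.
move=> mf mg; rewrite (_ : [set x | _] = ~` [set x | g x < f x]).
  by apply: measurableC; exact: measurable_set_lt.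
by apply/seteqP; split=> x /=; [move=> h; apply/negP; rewrite -leNgt | move=> /negP; rewrite -leNgt].
Qed.

Section FlowMeasure.
Context {R : realType} {N : nat}.
Variable a : nat -> 'I_N.+1.
Local Notation X := (subshift_space a).
Hypotheses (a_gt0 : forall n, (0 < a n)%N) (a0_gt1 : (1 < a 0)%N).
Variables (l : alphabet a -> R) (lambda : R).
Hypothesis nl : natural_tile_length l lambda.
Local Notation Om := (tiling_space l).
Local Notation pi := (\pi_Om : (X * R)%type -> Om).
Local Notation roof := (roof l).
Local Notation slice := (@box_slice R N a l).
Local Notation deck := (deck l).
Local Notation undeck := (undeck l).
Local Notation XR := (borel X * measurableTypeR R)%type.

(** This form covers both [deck] and the translations of the second coordinate. *)
Definition skew (k : int) (f : X -> R) (p : XR) : XR := (subshift_act a k p.1, p.2 - f p.1).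

Lemma snd_measurable : measurable_fun setT (fun p : XR => p.2 : R).
Proof. exact: measurable_snd. Qed.

Lemma fst_measurable (f : borel X -> R) : measurable_fun setT f ->
  measurable_fun setT (fun p : XR => f p.1).
Proof. by move=> mf; apply: (measurableT_comp mf); exact: measurable_fst. Qed.

Lemma skew_measurable k f : measurable_fun setT (f : borel X -> R) ->
  measurable_fun setT (skew k f).
Proof.
move=> mf; apply: measurable_fun_pair.
  have mk : measurable_fun setT (subshift_act a k : borel X -> borel X).
    by move=> _ A mA; rewrite setTI; exact: subshift_act_measurable.
  by apply: (measurableT_comp mk); exact: measurable_fst.
by apply: measurable_funB; [exact: snd_measurable | exact: fst_measurable].
Qed.

Lemma roof_measurable : measurable_fun setT (roof : borel X -> R).
Proof. by apply: continuous_borel_measurable; exact: (roof_continuous nl). Qed.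

Lemma deck_measurable : measurable_fun setT (deck : XR -> XR).
Proof. exact: (skew_measurable 1 roof_measurable). Qed.

Lemma undeck_measurable : measurable_fun setT (undeck : XR -> XR).
Proof.
have -> : undeck = skew (-1) (fun x => - roof (subshift_act a (-1) x)).
  by apply/funext => p; rewrite /skew opprK.
apply: skew_measurable; apply: measurable_funN; apply: (measurableT_comp roof_measurable).
by move=> _ A mA; rewrite setTI; exact: subshift_act_measurable.
Qed.

Lemma base_measurable C t : cylinder_set C ->
  measurable ([set p | [/\ in_box l p, C p.1 & p.2 < t]] : set XR).
Proof.
move=> cC.
have -> : [set p | [/\ in_box l p, C p.1 & p.2 < t]] =
  [set p : XR | cst 0 p <= p.2] `&` [set p : XR | p.2 < roof p.1] `&` [set p : XR | p.2 < cst t p]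
    `&` (fst @^-1` C).
  apply/seteqP; split=> p /=; first by move=> [[? ?] ? ?].
  by move=> [[[? ?] ?] ?].
apply: measurableI; first apply: measurableI; first apply: measurableI.
- by apply: measurable_set_le; [exact: measurable_cst | exact: snd_measurable].
- by apply: measurable_set_lt; [exact: snd_measurable | apply: fst_measurable; exact: roof_measurable].
- by apply: measurable_set_lt; [exact: snd_measurable | exact: measurable_cst].
- rewrite -[X in measurable X]setTI; apply: measurable_fst => //.
  exact: (clopen_base_measurable (@cylinder_set_open N a)).
Qed.

Lemma box_measurable : measurable ([set p | in_box l p] : set XR).
Proof.
have [hi [hi0 hhi]] := roof_le nl.
have := base_measurable hi (@cylinder_setT N a); congr measurable.
apply/seteqP; split=> p /=; first by move=> [].
by move=> h; split=> //; case: h => _ h; exact: lt_le_trans h (hhi _).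
Qed.

Lemma pi_measurable (A : set (borel Om)) : measurable A -> measurable (pi @^-1` A : set XR).
Proof.
move=> /(box_slices_sigma a_gt0 a0_gt1 nl).
apply: measurable_preimage_generated.
move=> _ [C [t [cC ->]]] /=.
pose S := [set p | [/\ in_box l p, C p.1 & p.2 < t]] : set XR.
have piU k r : pi (iter k undeck r) = pi r by elim: k => //= k IH; rewrite pi_undeck.
have piD k r : pi (iter k deck r) = pi r by elim: k => //= k IH; rewrite pi_deck.
have -> : pi @^-1` (slice C t) = \bigcup_n \bigcup_m ((fun p => iter n undeck (iter m deck p)) @^-1` S).
  apply/seteqP; split=> p.
    move=> [q [hq Cq qt /pi_eqP[n [m e]]]]; exists n => //; exists m => //=.
    by rewrite -e iterK_deck.
  move=> [n _ [m _ /= [h1 h2 h3]]]; exists (iter n undeck (iter m deck p)); split=> //.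
  by rewrite piU piD.
apply: bigcupT_measurable => n; apply: bigcupT_measurable => m.
have mi (f : XR -> XR) k : measurable_fun setT f -> measurable_fun setT (iter k f).
  move=> mf; elim: k => [|k IH]; first exact: measurable_id.
  exact: (measurableT_comp mf IH).
rewrite -[X in measurable X]setTI.
apply: (measurableT_comp (mi _ n undeck_measurable) (mi _ m deck_measurable)) => //.
exact: base_measurable.
Qed.

Variable mu : probability (borel X) R.
Hypothesis imu : invariant_measure (subshift_act a) mu.

Let M : {measure set XR -> \bar R} := (mu \x (@lebesgue_measure R : {sigma_finite_measure set (measurableTypeR R) -> \bar R}))%E.

(** Invariance of the Lebesgue measure moves the fibres, invariance of [mu] the base. *)
Lemma skew_invariant k f (A : set XR) : measurable_fun setT (f : borel X -> R) -> measurable A ->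
  M (skew k f @^-1` A) = M A.
Proof.
move=> mf mA; pose ak : borel X -> borel X := subshift_act a k.
have mk : measurable_fun setT ak.
  by move=> _ B mB; rewrite setTI; exact: subshift_act_measurable.
pose phi := (@lebesgue_measure R \o xsection A).
rewrite /M /= /product_measure1.
have -> : (\int[mu]_x (lebesgue_measure \o xsection (skew k f @^-1` A)) x = \int[mu]_x (phi \o ak) x)%E.
  apply: eq_integral => x _; rewrite /phi /=.
  rewrite -[RHS](lebesgue_measure_translation (f x)); last exact: measurable_xsection.
  by congr lebesgue_measure; apply/seteqP; split=> u; rewrite /xsection /= !inE.
have mphi : measurable_fun setT phi by exact: measurable_fun_xsection.
have := ge0_integral_pushforward mk mu measurableT mphi.
rewrite preimage_setT => <-; last by move=> x _; exact: measure_ge0.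
apply: eq_measure_integral => B mB _; exact: imu.
Qed.

Let m0 (A : set (borel Om)) : \bar R := M ([set p | in_box l p] `&` pi @^-1` A).

(** Translation turns the fundamental domain into [s <= u < roof x + s], which is also
obtained from it by moving the strip [0 <= u < s] with [deck]. The lift of [A] is
invariant under [deck], so its parts in both domains have the same measure. *)
Lemma base_flow_small s (A : set (borel Om)) : (forall x, s <= roof x) -> 0 <= s -> measurable A ->
  m0 (tiling_flow l s @^-1` A) = m0 A.
Proof.
move=> sr s0 mA; have mB := pi_measurable mA; set B := pi @^-1` A in mB.
pose L := [set p : XR | cst 0 p <= p.2] `&` [set p : XR | p.2 < cst s p].
pose K := [set p : XR | cst s p <= p.2] `&` [set p : XR | p.2 < roof p.1].
have mL : measurable L.
  apply: measurableI; first by apply: measurable_set_le; [exact: measurable_cst | exact: snd_measurable].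
  by apply: measurable_set_lt; [exact: snd_measurable | exact: measurable_cst].
have mK : measurable K.
  apply: measurableI; first by apply: measurable_set_le; [exact: measurable_cst | exact: snd_measurable].
  by apply: measurable_set_lt; [exact: snd_measurable | apply: fst_measurable; exact: roof_measurable].
have mU : measurable (skew 1 roof @^-1` (L `&` B)).
  rewrite -[X in measurable X]setTI; apply: (skew_measurable 1 roof_measurable) => //.
  exact: measurableI.
have LK : [set p | in_box l p] = L `|` K :> set XR.
  apply/seteqP; split=> p /=.
    by move=> [h1 h2]; have [h|h] := ltP p.2 s; [left | right]; split.
  by move=> [[h1 h2]|[h1 h2]]; split=> //; [exact: lt_le_trans h2 (sr _) | exact: le_trans h1].
have -> : m0 A = (M (L `&` B) + M (K `&` B))%E.
  rewrite /m0 LK -/B setIUl -measureU //; [exact: measurableI|exact: measurableI|].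
  by apply/seteqP; split=> // p [[[_ /= h1] _] [[/= h2 _] _]]; move: h1; rewrite ltNge h2.
rewrite -(skew_invariant 1 roof_measurable (measurableI _ _ mL mB)).
rewrite -measureU //; [|exact: measurableI|]; last first.
  apply/seteqP; split=> // p [[[/= h1 _] _] [[_ /= h2] _]].
  by move: h1; rewrite leNgt subr_lt0 h2.
have mLK : measurable (skew 1 roof @^-1` (L `&` B) `|` K `&` B).
  by apply: measurableU => //; exact: measurableI.
apply: etrans _ (skew_invariant 0 (f := fun=> - s) (measurable_cst _) mLK).
rewrite /m0; congr (M _); apply/seteqP; split=> -[x u]; rewrite /skew /= opprK subshift_act0.
  move=> [[/= u0 ur]]; rewrite flow_pi => Au.
  have [h|h] := leP (roof x) (u + s).
    left; split; first by split=> /=; lra.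
    by rewrite /B /= -[X in A X](@pi_deck _ _ _ l (x, u + s)) in Au *.
  by right; split=> //; split=> //=; lra.
move=> [[[/= h1 h2] h3]|[[/= h1 h2] h3]]; split; try (split=> /=; have := sr x; lra); rewrite flow_pi.
- by rewrite -[X in A X]pi_deck.
- by [].
Qed.

Lemma flow_flow s t w : tiling_flow l s (tiling_flow l t w) = tiling_flow l (t + s) w.
Proof.
by have [[x u] [_ <-]] := pi_box a_gt0 a0_gt1 nl w; rewrite !flow_pi addrA.
Qed.

Lemma base_flow s (A : set (borel Om)) : measurable A ->
  m0 (tiling_flow l s @^-1` A) = m0 A.
Proof.
have [lo [lo0 hlo]] := roof_ge a_gt0 a0_gt1 nl.
have pos t (B : set (borel Om)) : 0 <= t -> measurable B -> m0 (tiling_flow l t @^-1` B) = m0 B.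
  move=> t0 mB; pose n := (Num.bound (t / lo)).+1; pose d := t / n%:R.
  have n0 : 0 < n%:R :> R by rewrite ltr0n.
  have d0 : 0 <= d by rewrite divr_ge0 // ltW.
  have dlo : d <= lo.
    rewrite /d ler_pdivrMr // mulrC -ler_pdivrMr //; apply/ltW.
    apply: lt_le_trans (archi_boundP _) _; first by rewrite divr_ge0 // ltW.
    by rewrite ler_nat.
  have -> : t = n%:R * d by rewrite mulrC divfK // lt0r_neq0.
  elim: (n) => [|k IH].
    rewrite mul0r; congr m0; apply/seteqP; split=> w /=;
      by have [[x u] [_ <-]] := pi_box a_gt0 a0_gt1 nl w; rewrite flow_pi addr0.
  rewrite -natr1 mulrDl mul1r addrC.
  have -> : tiling_flow l (d + k%:R * d) @^-1` B = tiling_flow l d @^-1` (tiling_flow l (k%:R * d) @^-1` B).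
    by apply/seteqP; split=> w /=; rewrite flow_flow.
  rewrite base_flow_small //; last exact: flow_measurable.
  by move=> x; exact: le_trans dlo (hlo x).
move=> mA; have [/pos/(_ mA)//|s0] := leP 0 s.
rewrite -(pos (- s)); last exact: flow_measurable; last by lra.
congr m0; apply/seteqP; split=> w /=; rewrite flow_flow addNr;
  by have [[x u] [_ <-]] := pi_box a_gt0 a0_gt1 nl w; rewrite flow_pi addr0.
Qed.

Lemma flow_invariant_exists : exists nu : probability (borel Om) R, invariant_measure (tiling_flow l) nu.
Proof.
have m00 : m0 set0 = 0%E by rewrite /m0 preimage_set0 setI0 measure0.
have m0ge A : (0 <= m0 A)%E by exact: measure_ge0.
have m0sa : semi_sigma_additive m0.
  move=> F mF tF mUF; rewrite /m0 preimage_bigcup setI_bigcupr.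
  apply: (@measure_semi_sigma_additive _ _ _ M).
  - by move=> i; apply: measurableI; [exact: box_measurable | exact: pi_measurable].
  - apply/trivIsetP => i j _ _ ij; move/trivIsetP : tF => /(_ i j I I ij) e.
    by apply/seteqP; split=> // p [[_ /= h1] [_ /= h2]]; have : (F i `&` F j) (pi p) by []; rewrite e.
  - by apply: bigcupT_measurable => i; apply: measurableI; [exact: box_measurable | exact: pi_measurable].
pose nu0 : {measure set (borel Om) -> \bar R} :=
  HB.pack m0 (isMeasure.Build _ (borel Om) R m0 m00 m0ge m0sa).
have [lo [lo0 hlo]] := roof_ge a_gt0 a0_gt1 nl; have [hi [hi0 hhi]] := roof_le nl.
have secE x : lebesgue_measure (xsection [set p | in_box l p] x) = (roof x)%:E :> \bar R.
  rewrite (_ : xsection _ x = `[0, roof x[%classic).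
    by rewrite lebesgue_measure_itv /= lte_fin (roof_gt0 nl) sube0.
  by apply/seteqP; split=> u; rewrite /xsection /= inE in_itv /= => /andP.
have m0T : m0 setT = (\int[mu]_x (roof x)%:E)%E.
  rewrite /m0 preimage_setT setIT; apply: eq_integral => x _; exact: secE.
have cE (c : R) : (\int[mu]_x c%:E = c%:E)%E.
  rewrite integral_cst //.
  exact: (eq_ind_r (fun z => c%:E * z = c%:E)%E (mule1 _) (probability_setT mu)).
have mr : measurable_fun setT (fun x : borel X => (roof x)%:E).
  by apply/measurable_EFinP; exact: roof_measurable.
have ge_lo : (lo%:E <= m0 setT)%E.
  rewrite m0T -cE; apply: ge0_le_integral => //.
  - by move=> x _; rewrite lee_fin ltW.
  - by move=> x _; rewrite lee_fin.
have le_hi : (m0 setT <= hi%:E)%E.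
  rewrite m0T -cE; apply: ge0_le_integral => //.
  - by move=> x _; rewrite lee_fin ltW // (roof_gt0 nl).
  - by move=> x _; rewrite lee_fin.
have nz : ((nu0 setT == 0) || (nu0 setT == +oo))%E = false.
  apply/negbTE; rewrite negb_or gt_eqF ?lt_eqF //.
    by apply: le_lt_trans le_hi _; rewrite ltry.
  by apply: lt_le_trans ge_lo; rewrite lte_fin.
have nuE A : mnormalize nu0 (dirac point) A = (nu0 A * ((fine (nu0 setT))^-1)%:E)%E.
  by rewrite /mnormalize nz.
exists (mnormalize nu0 (dirac point)) => s A mA.
apply: etrans (nuE _) _; apply: etrans _ (esym (nuE _)).
exact: (congr1 (fun z => (z * _)%E) (base_flow s mA)).
Qed.

End FlowMeasure.

Theorem flow_strictly_ergodic (R : realType) N (a : nat -> 'I_N.+1) (l : alphabet a -> R) lambda :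
  (forall n, (0 < a n)%N) -> (1 < a 0)%N -> natural_tile_length l lambda ->
  strictly_ergodic R (tiling_flow l).
Proof.
move=> a_gt0 a0_gt1 nl; split; first exact: (flow_minimal a_gt0 a0_gt1 nl).
have [mu imu _] := @subshift_uniquely_ergodic R N a a_gt0 a0_gt1.
have [nu inu] := flow_invariant_exists a_gt0 a0_gt1 nl imu.
exists nu => // nu' inu' A mA.
apply: (uniquely_ergodic_from_averages (@flow_measurable R N a l) (G := @box_slices R N a l)) => //.
- by move=> _ [C [t [cC ->]]]; exact: (box_slice_measurable a_gt0 a0_gt1 nl).
- exact: (box_slicesI a_gt0 a0_gt1 nl).
- exact: (box_slicesT a_gt0 a0_gt1 nl).
- exact: (box_slices_sigma a_gt0 a0_gt1 nl).
- by move=> _ [C [t [cC ->]]] e e0; exact: (flow_average a_gt0 a0_gt1 nl).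
Qed.

(** * Lengths of integer polynomials *)

(** The l^1 norm of the coefficients; it is submultiplicative, see [poly_lenM]. *)
Definition poly_len (p : {poly int}) : int := \sum_(i < size p) `|p`_i|.

Lemma poly_len_wide n (p : {poly int}) : (size p <= n)%N -> poly_len p = \sum_(i < n) `|p`_i|.
Proof.
move=> pn; rewrite -(big_mkord xpredT (fun i => `|p`_i|)) (big_cat_nat (n := size p)) //=.
rewrite big_mkord [X in _ + X]big_nat [X in _ + X]big1 ?addr0 // => i /andP[h _].
by rewrite nth_default ?normr0.
Qed.

Lemma poly_len_ge0 p : 0 <= poly_len p.
Proof. by apply: sumr_ge0 => i _; exact: normr_ge0. Qed.

Lemma coef_le_len (p : {poly int}) i : `|p`_i| <= poly_len p.
Proof.
have [h|h] := ltnP i (size p); last by rewrite nth_default // normr0 poly_len_ge0.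
rewrite /poly_len (bigD1 (Ordinal h)) //= lerDl; apply: sumr_ge0 => j _; exact: normr_ge0.
Qed.

Lemma poly_lenD p q : poly_len (p + q) <= poly_len p + poly_len q.
Proof.
pose n := maxn (size p) (size q).
rewrite (poly_len_wide (leq_trans (size_polyD p q) (leqnn n))).
rewrite (poly_len_wide (leq_maxl (size p) (size q))) (poly_len_wide (leq_maxr (size p) (size q))).
rewrite -big_split /=; apply: ler_sum => i _; rewrite coefD; exact: ler_normD.
Qed.

Lemma poly_len_C c : poly_len c%:P = `|c|.
Proof.
by rewrite (poly_len_wide (size_polyC_leq1 c)) big_ord_recl big_ord0 coefC addr0.
Qed.

Lemma poly_len_Cmul c p : poly_len (c%:P * p) = `|c| * poly_len p.
Proof.
have h : (size (c%:P * p)%R <= size p)%N by rewrite mul_polyC; exact: size_scale_leq.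
by rewrite (poly_len_wide h) mulr_sumr; apply: eq_bigr => i _; rewrite coefCM normrM.
Qed.

Lemma poly_len_mulX p : poly_len (p * 'X) = poly_len p.
Proof.
have h : (size (p * 'X)%R <= (size p).+1)%N.
  by apply: leq_trans (size_polyMleq _ _) _; rewrite size_polyX addn2.
rewrite (poly_len_wide h) big_ord_recl coefMX /= normr0 add0r.
by apply: eq_bigr => i _; rewrite coefMX.
Qed.

Lemma poly_lenM p q : poly_len (p * q) <= poly_len p * poly_len q.
Proof.
elim/poly_ind: p => [|p c IH].
  by rewrite mul0r -[0]/(0%:P) poly_len_C normr0 mul0r.
have -> : poly_len (p * 'X + c%:P) = poly_len p + `|c|.
  have h : (size (p * 'X + c%:P)%R <= (size p).+1)%N by rewrite size_MXaddC; case: ifP.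
  rewrite (poly_len_wide h) big_ord_recl coefD coefMX coefC /= add0r addrC; congr (_ + _).
  by apply: eq_bigr => i _; rewrite coefD coefMX coefC /= addr0.
rewrite mulrDl mulrAC; apply: le_trans (poly_lenD _ _) _.
by rewrite poly_len_mulX poly_len_Cmul mulrDl lerD2r.
Qed.

Lemma poly_lenX p n : poly_len (p ^+ n) <= poly_len p ^+ n.
Proof.
elim: n => [|n IH]; first by rewrite !expr0 -[1]/(1%:P) poly_len_C normr1.
rewrite !exprS; apply: le_trans (poly_lenM _ _) _.
by rewrite ler_wpM2l // poly_len_ge0.
Qed.

Lemma poly_len_sum (I : finType) (F : I -> {poly int}) :
  poly_len (\sum_i F i) <= \sum_i poly_len (F i).
Proof.
elim/big_rec2: _ => [|i y x _ h]; first by rewrite -[0]/(0%:P) poly_len_C normr0.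
by apply: le_trans (poly_lenD _ _) _; rewrite lerD2l.
Qed.

Lemma poly_len_Xn n : poly_len 'X^n = 1.
Proof.
elim: n => [|n IH]; first by rewrite expr0 -[1]/(1%:P) poly_len_C.
by rewrite exprSr poly_len_mulX.
Qed.

(** * The value of an integer polynomial at an algebraic number *)

Section Evaluation.
Variables (R : comNzRingType) (x : R).
Implicit Types p r : {poly int}.

Lemma evalzM p r : evalz (p * r) x = evalz p x * evalz r x.
Proof. by rewrite rmorphM hornerM. Qed.

Lemma evalzD p r : evalz (p + r) x = evalz p x + evalz r x.
Proof. by rewrite rmorphD hornerD. Qed.

Lemma evalzC c : evalz c%:P x = c%:~R.
Proof. by rewrite map_polyC hornerC. Qed.

Lemma evalzXn n : evalz 'X^n x = x ^+ n.
Proof. by rewrite map_polyXn hornerXn. Qed.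

Lemma evalz_exp p n : evalz (p ^+ n) x = evalz p x ^+ n.
Proof. by rewrite rmorphXn horner_exp. Qed.

Lemma evalz_sum (I : finType) (F : I -> {poly int}) :
  evalz (\sum_i F i) x = \sum_i evalz (F i) x.
Proof. by rewrite rmorph_sum horner_sum. Qed.

End Evaluation.

Lemma horner_len (R : realFieldType) (p : {poly int}) (x : R) k :
  0 <= x <= 1 -> (forall h, (h < k)%N -> p`_h = 0) -> `|(evalz p x)| <= (poly_len p)%:~R * x ^+ k.
Proof.
move=> /andP[x0 x1] pk; rewrite horner_coef size_map_inj_poly ?rmorph0 //; last exact: intr_inj.
rewrite /poly_len rmorph_sum mulr_suml; apply: le_trans (ler_norm_sum _ _ _) _.
apply: ler_sum => i _; rewrite coef_map /= normrM -intr_norm normrX (ger0_norm x0).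
have [h|h] := ltnP i k; first by rewrite pk // normr0 !mul0r.
by rewrite ler_wpM2l ?ler0z // ler_wiXn2l.
Qed.

Lemma det_le (R : numDomainType) n (A : 'M[R]_n) b : 0 <= b -> (forall i j, `|A i j| <= b) ->
  `|\det A| <= n`!%:R * b ^+ n.
Proof.
move=> b0 Ab; apply: le_trans (ler_norm_sum _ _ _) _.
have -> : n`!%:R * b ^+ n = \sum_(s : 'S_n) b ^+ n by rewrite sumr_const card_Sn mulr_natl.
apply: ler_sum => s _; rewrite normrM normrX normrN1 expr1n mul1r normr_prod.
by rewrite -[n in leRHS]card_ord -prodr_const; apply: ler_prod => i _; rewrite normr_ge0 Ab.
Qed.

Lemma clear_denominators d (w : 'rV[rat]_d) : exists (c : int) (u : 'rV[int]_d),
  c != 0 /\ map_mx intr u = c%:~R *: w.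
Proof.
have [W [c c0 e]] := rat_poly_scale (\poly_(i < d) (if insub i is Some j then w 0 j else 0)).
exists c, (\row_i W`_i); split=> //; apply/rowP => i; rewrite !mxE.
have := congr1 (fun p : {poly rat} => p`_i) e.
by rewrite coef_poly ltn_ord coefZ coef_map /= valK => ->; rewrite mulVKf // intr_eq0.
Qed.

Section Liouville.
Variables (R : realFieldType) (q : R).

Lemma algebraic_minimal : algebraicOver (ratr : rat -> R) q ->
  exists P : {poly int}, [/\ (1 < size P)%N, (evalz P q) = 0 &
    forall g : {poly int}, (size g < size P)%N -> (evalz g q) = 0 -> g = 0].
Proof.
move=> [p0 p0n0 rp0].
have ex : exists n, `[< exists P : {poly int}, [/\ P != 0, (evalz P q) = 0 & size P = n] >].
  have [P [c c0 e]] := rat_poly_scale p0.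
  exists (size P); apply/asboolP; exists P; split=> //.
    apply: contra_neq p0n0 => P0; by rewrite e P0 map_poly0 scaler0.
  move: rp0; rewrite e map_polyZ -map_poly_comp /root hornerZ mulf_eq0.
  rewrite (eq_map_poly (g := intr)); last by move=> x /=; rewrite ratr_int.
  move=> /orP[|/eqP //].
  by rewrite fmorph_eq0 invr_eq0 intr_eq0 (negbTE c0).
have [n /asboolP[P [Pn0 Pq sP]] nmin] := ex_minnP ex.
exists P; split=> //.
  rewrite ltnNge; apply/negP => /size1_polyC e; move: Pq Pn0; rewrite e map_polyC hornerC.
  by move=> /eqP; rewrite intr_eq0 polyC_eq0 => ->.
move=> g sg gq; apply/eqP/negPn/negP => gn0.
have : (n <= size g)%N by apply: nmin; apply/asboolP; exists g.
by rewrite -sP leqNgt sg.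
Qed.

Variable P : {poly int}.
Hypotheses (sP : (1 < size P)%N) (Pq : (evalz P q) = 0)
  (Pmin : forall g : {poly int}, (size g < size P)%N -> (evalz g q) = 0 -> g = 0).
Let d := (size P).-1.
Let D := lead_coef P.
Let B := `|D| + poly_len P.

(** Multiplication by [D X], followed by the subtraction of a multiple of [P], keeps
the degree below that of [P] and enlarges the coefficients at most by the factor
[B]. *)
Lemma power_reduction j : exists b : {poly int},
  [/\ (size b <= d)%N, (evalz b q) = D%:~R ^+ j * q ^+ j & forall i, `|b`_i| <= B ^+ j].
Proof.
have dE : size P = d.+1 by rewrite /d prednK // ltnW.
have B0 : 0 <= B by rewrite addr_ge0 // poly_len_ge0.
elim: j => [|j [b [sb bq bB]]].
  exists 1; rewrite size_poly1 /d -subn1 subn_gt0; split=> //.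
    by rewrite rmorph1 hornerC !expr0 mulr1.
  by move=> i; rewrite expr0 coef1; case: (i == 0)%N.
exists (D%:P * (b * 'X) - (b`_d.-1)%:P * P); split.
- apply/leq_sizeP => i di; rewrite coefB !coefCM coefMX.
  have i0 : (i == 0)%N = false by apply/negbTE; rewrite -lt0n (leq_trans _ di) // /d -subn1 subn_gt0.
  rewrite i0; move: di; rewrite leq_eqVlt => /predU1P[<-|di].
    by rewrite /D /lead_coef -/d mulrC subrr.
  rewrite [b`_i.-1]nth_default; last by apply: leq_trans sb _; move: di i0; lia.
  by rewrite [P`_i]nth_default ?dE // !mulr0 subrr.
- rewrite rmorphB !rmorphM /= !map_polyC map_polyX hornerD hornerN !hornerM !hornerC hornerX bq Pq.
  by rewrite mulr0 subr0 !exprS; ring.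
- move=> i; rewrite coefB !coefCM coefMX exprS /B mulrDl.
  apply: le_trans (ler_normB _ _) _; rewrite !normrM; apply: lerD.
    by rewrite ler_wpM2l //; case: eqP => _; rewrite ?normr0 ?exprn_ge0.
  by rewrite mulrC ler_pM // coef_le_len.
Qed.

Lemma multiple_reduction L (F : {poly int}) k : (size F <= L.+1)%N -> (k < d)%N ->
  exists g : {poly int}, [/\ (size g <= d)%N, (evalz g q) = D%:~R ^+ (L + d) * (q ^+ k * (evalz F q))
    & forall i, `|g`_i| <= poly_len F * B ^+ (L + d)].
Proof.
move=> sF kd.
have [b hb] := choice power_reduction.
have DB : `|D| <= B by rewrite /B lerDl poly_len_ge0.
have B0 : 0 <= B by apply: le_trans DB.
exists (\sum_(j < L.+1) (F`_j * D ^+ (L + d - (k + j)))%:P * b (k + j)%N); split.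
- apply: leq_trans (size_sum _ _ _) _; apply/bigmax_leqP => j _.
  by rewrite mul_polyC; apply: leq_trans (size_scale_leq _ _) _; case: (hb (k + j)%N).
- rewrite evalz_sum.
  have -> : (evalz F q) = \sum_(j < L.+1) (F`_j)%:~R * q ^+ j.
    rewrite (@horner_coef_wide _ L.+1) ?size_map_inj_poly ?rmorph0 //; last exact: intr_inj.
    by apply: eq_bigr => j _; rewrite coef_map.
  rewrite !mulr_sumr; apply: eq_bigr => j _; have [_ e _] := hb (k + j)%N.
  rewrite evalzM evalzC e rmorphM rmorphXn /= [q ^+ (k + j)]exprD.
  have -> : D%:~R ^+ (L + d) = D%:~R ^+ (L + d - (k + j)) * D%:~R ^+ (k + j) :> R.
    by rewrite -exprD subnK //; have := ltn_ord j; lia.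
  by ring.
- move=> i; rewrite coef_sum (poly_len_wide sF) mulr_suml.
  apply: le_trans (ler_norm_sum _ _ _) _; apply: ler_sum => j _.
  rewrite coefCM !normrM -mulrA ler_wpM2l // normrX.
  have [_ _ bB] := hb (k + j)%N.
  have -> : B ^+ (L + d) = B ^+ (L + d - (k + j)) * B ^+ (k + j).
    by rewrite -exprD subnK //; have := ltn_ord j; lia.
  by rewrite ler_pM // ?exprn_ge0 // lerXn2r // nnegrE.
Qed.

(** Multiplication by [D^(L + d) F(q)] on the basis [1, q, ..., q^(d-1)] has an integer
matrix [M]. It is not singular, because a row vector that it kills would give a
linear relation between these powers of [q]. So its determinant is at least 1 in
absolute value, and the adjugate matrix writes it as the product of
[D^(L + d) F(q)] and a quantity controlled by the entries. *)
Lemma liouville_bound L (F : {poly int}) : 0 <= q <= 1 -> (size F <= L.+1)%N -> (evalz F q) != 0 ->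
  1 <= `|(evalz F q)| * (`|D|%:~R ^+ (L + d) * (d%:R * (d`!%:R * ((1 + poly_len F * B ^+ (L + d))%:~R) ^+ d))).
Proof.
move=> /andP[q0 q1] sF Fq.
have d0 : (0 < d)%N by rewrite /d -subn1 subn_gt0.
have hk (k : 'I_d) := multiple_reduction sF (ltn_ord k).
have [g hg] := choice hk.
pose M : 'M[int]_d := \matrix_(k, i) (g k)`_i.
pose v : 'cV[R]_d := \col_i q ^+ i.
pose xi := D%:~R ^+ (L + d) * (evalz F q).
have D0 : D != 0 by rewrite lead_coef_eq0 -size_poly_gt0 ltnW.
have xi0 : xi != 0 by rewrite mulf_neq0 // expf_neq0 // intr_eq0.
have Mv : map_mx intr M *m v = xi *: v.
  apply/matrixP => k j; rewrite !mxE; have [sg e _] := hg k.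
  rewrite /xi mulrAC -mulrA [q ^+ k * _]mulrC [(evalz F q) * _]mulrC in e *.
  rewrite -[RHS]e (@horner_coef_wide _ d) ?size_map_inj_poly ?rmorph0 //; last exact: intr_inj.
  by apply: eq_bigr => i _; rewrite !mxE coef_map.
have Mdet : \det M != 0.
  apply/negP => /eqP M0.
  have /det0P[w w0 wM] : \det (map_mx intr M : 'M[rat]_d) == 0 by rewrite det_map_mx M0.
  have [c [u [c0 uw]]] := clear_denominators w.
  have uM : map_mx intr u *m map_mx intr M = 0 :> 'rV[rat]_d.
    by rewrite uw -scalemxAl wM scaler0.
  have uM' : u *m M = 0.
    apply/rowP => i; apply: (@intr_inj rat); have /rowP/(_ i) := uM.
    by rewrite -map_mxM !mxE => ->.
  have : map_mx intr (u *m M) *m v = 0 by rewrite uM' map_mx0 mul0mx.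
  rewrite map_mxM -mulmxA Mv -scalemxAr => /eqP; rewrite scaler_eq0 (negbTE xi0) /= => /eqP.
  move=> /matrixP/(_ 0 0); rewrite !mxE => uv.
  pose U : {poly int} := \poly_(i < d) (if insub i is Some j then u 0 j else 0).
  have UE (i : 'I_d) : U`_i = u 0 i by rewrite coef_poly ltn_ord valK.
  have U0 : U = 0.
    apply: Pmin; first by apply: leq_ltn_trans (size_poly _ _) _; rewrite /d ltn_predL ltnW.
    rewrite (@horner_coef_wide _ d) ?size_map_inj_poly ?rmorph0 ?size_poly //; last exact: intr_inj.
    by rewrite -[RHS]uv; apply: eq_bigr => i _; rewrite coef_map /= UE !mxE.
  have u0 : u = 0 by apply/rowP => i; rewrite -UE U0 coef0 mxE.
  move: uw; rewrite u0 map_mx0 => /esym/eqP; rewrite scaler_eq0 intr_eq0 (negbTE c0).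
  by rewrite (negbTE w0).
pose b := poly_len F * B ^+ (L + d).
have B0 : 0 <= B by rewrite addr_ge0 // poly_len_ge0.
have b0 : 0 <= b by rewrite mulr_ge0 ?poly_len_ge0 // exprn_ge0.
have adjM (i : 'I_d) : `|(\adj M) (Ordinal d0) i| <= d`!%:R * (1 + b) ^+ d.
  rewrite mxE /cofactor normrM normrX normrN1 expr1n mul1r.
  apply: le_trans (@det_le _ _ _ (1 + b) _ _) _; first by rewrite addr_ge0.
    move=> k j; rewrite !mxE; have [_ _ h] := hg (lift i k).
    by apply: le_trans (h _) _; rewrite lerDr.
  rewrite ler_pM ?exprn_ge0 ?addr_ge0 //.
    by rewrite ler_nat; apply: leq_fact; exact: leq_pred.
  by rewrite ler_weXn2l ?leq_pred // lerDl.
have e : (\det M)%:~R = xi * \sum_(i < d) ((\adj M) (Ordinal d0) i)%:~R * q ^+ i.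
  have : map_mx intr (\adj M *m M) *m v = xi *: (map_mx intr (\adj M) *m v).
    by rewrite map_mxM -mulmxA Mv -scalemxAr.
  rewrite mul_adj_mx map_scalar_mx mul_scalar_mx => /matrixP/(_ (Ordinal d0) 0).
  rewrite !mxE /= expr0 mulr1 => ->; congr (_ * _).
  by apply: eq_bigr => i _; rewrite !mxE.
have det1 : 1 <= `|(\det M)%:~R| :> R.
  by rewrite -intr_norm -[1]/(1%:~R) ler_int -gtz0_ge1 normr_gt0.
apply: le_trans det1 _; rewrite e /xi !normrM normrX -intr_norm -!mulrA mulrCA.
rewrite !ler_wpM2l ?exprn_ge0 ?ler0z //.
apply: le_trans (ler_norm_sum _ _ _) _.
set Y := _ ^+ d; have -> : d%:R * (d`!%:R * Y) = \sum_(i < d) (d`!%:R * Y).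
  by rewrite sumr_const card_ord mulr_natl.
apply: ler_sum => i _; rewrite /Y normrM normrX (ger0_norm q0) -intr_norm.
rewrite -[leRHS]mulr1 ler_pM ?exprn_ge0 ?ler0z ?exprn_ile1 //.
by have := adjM i; rewrite -(ler_int R) rmorphM rmorphXn /= rmorph_nat.
Qed.

End Liouville.

Theorem liouville (R : realFieldType) (q : R) : 0 <= q <= 1 -> algebraicOver (ratr : rat -> R) q ->
  exists (C : R) (d : nat), 1 <= C /\ forall L (F : {poly int}) (S : R), 1 <= S ->
    (size F <= L.+1)%N -> (poly_len F)%:~R <= S -> (evalz F q) != 0 -> 1 <= `|(evalz F q)| * (C ^+ L.+1 * S ^+ d).
Proof.
move=> q01 /algebraic_minimal[P [sP Pq Pmin]].
pose d := (size P).-1; pose B : R := (`|lead_coef P| + poly_len P)%:~R.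
have d0 : (0 < d)%N by rewrite /d -subn1 subn_gt0.
have D1 : 1 <= `|lead_coef P|%:~R :> R.
  by rewrite -[1]/(1%:~R) ler_int -gtz0_ge1 normr_gt0 lead_coef_eq0 -size_poly_gt0 ltnW.
have DB : `|lead_coef P|%:~R <= B by rewrite /B ler_int lerDl poly_len_ge0.
have B1 : 1 <= B by apply: le_trans DB.
pose K : R := 2 * B.
have K1 : 1 <= K by rewrite /K; lra.
have K0 : 0 <= K by apply: le_trans K1.
have f1 : 1 <= (d * d`!)%:R :> R by rewrite ler1n muln_gt0 d0 fact_gt0.
exists (K ^+ (d.+1 * d.+1) * (d * d`!)%:R), d; split.
  by rewrite -[leLHS]mulr1 ler_pM // exprn_ege1.
move=> L F S S1 sF FS Fq; apply: le_trans (liouville_bound sP Pq Pmin q01 sF Fq) _.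
rewrite ler_wpM2l // -/d.
have S0 : 0 <= S by apply: le_trans S1.
have B0 : 0 <= B by apply: le_trans B1.
have h1 : `|lead_coef P|%:~R ^+ (L + d) <= K ^+ (L + d) by rewrite lerXn2r ?nnegrE ?ler0z // /K; lra.
have h2 : (1 + poly_len F * (`|lead_coef P| + poly_len P) ^+ (L + d))%:~R <= S * K ^+ (L + d).
  rewrite rmorphD rmorphM rmorphXn /= -/B rmorph1.
  apply: (@le_trans _ _ (S * 1 + S * B ^+ (L + d))).
    by rewrite mulr1 lerD // ler_wpM2r // exprn_ge0.
  rewrite -mulrDr ler_wpM2l // /K exprMn.
  have : 1 <= B ^+ (L + d) by rewrite exprn_ege1.
  have : 2 <= 2 ^+ (L + d) :> R by rewrite -[leLHS]expr1 ler_weXn2l ?ler1n // (leq_trans d0) // leq_addl.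
  by nra.
apply: (@le_trans _ _ (K ^+ (L + d) * (d%:R * (d`!%:R * (S * K ^+ (L + d)) ^+ d)))).
  rewrite ler_pM ?mulr_ge0 ?exprn_ge0 ?ler0z // ?addr_ge0 ?mulr_ge0 ?poly_len_ge0 ?exprn_ge0 ?addr_ge0 ?poly_len_ge0 //.
  rewrite !ler_wpM2l // lerXn2r // nnegrE ?mulr_ge0 ?exprn_ge0 //.
  by rewrite ler0z addr_ge0 // mulr_ge0 ?poly_len_ge0 ?exprn_ge0 // addr_ge0 ?poly_len_ge0.
have -> : K ^+ (L + d) * (d%:R * (d`!%:R * (S * K ^+ (L + d)) ^+ d)) =
    K ^+ ((L + d) * d.+1) * (d * d`!)%:R * S ^+ d.
  rewrite mulnS [K ^+ (_ + _ * _)]exprD exprM natrM; move: (K ^+ (L + d)) => Z.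
  by rewrite exprMn; ring.
rewrite ler_wpM2r ?exprn_ge0 // [(_ * _%:R) ^+ _]exprMn ler_pM ?exprn_ge0 //.
  have hL : ((L + d) * d.+1 <= d.+1 * d.+1 * L.+1)%N.
    by clear; move: d => e; rewrite -mulnA [leqRHS]mulnC leq_mul2r mulnS mulSn; lia.
  by rewrite -[leRHS]exprM; apply: ler_weXn2l.
by rewrite -[leLHS]expr1 ler_weXn2l.
Qed.

(** * The product of the factors 1 - x^(2^i) *)

Definition tm_poly m : {poly int} := \prod_(i < m) (1 - 'X^(2 ^ i)).

Lemma tm_polyS m : tm_poly m.+1 = tm_poly m * (1 - 'X^(2 ^ m)).
Proof. by rewrite /tm_poly big_ord_recr. Qed.

Lemma size_tm_poly m : (size (tm_poly m) <= 2 ^ m)%N.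
Proof.
elim: m => [|m IH]; first by rewrite /tm_poly big_ord0 size_poly1.
rewrite tm_polyS; apply: leq_trans (size_polyMleq _ _) _.
have h : (size (1 - 'X^(2 ^ m) : {poly int})%R <= (2 ^ m).+1)%N.
  by apply: leq_trans (size_polyD _ _) _; rewrite size_poly1 size_polyN size_polyXn geq_max leqnn.
by rewrite expnS; move: h IH; lia.
Qed.

Lemma poly_len_tm m : poly_len (tm_poly m) <= 2 ^+ m.
Proof.
elim: m => [|m IH]; first by rewrite /tm_poly big_ord0 -[1 in leLHS]/(1%:P) poly_len_C.
rewrite tm_polyS exprSr; apply: le_trans (poly_lenM _ _) _.
apply: ler_pM => //; rewrite ?poly_len_ge0 //.
have -> : 1 - 'X^(2 ^ m) = 1%:P + (-1)%:P * 'X^(2 ^ m) :> {poly int}.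
  by rewrite rmorphN1 mulN1r.
apply: le_trans (poly_lenD _ _) _.
by rewrite poly_len_C poly_len_Cmul poly_len_Xn.
Qed.

Lemma tm_poly_agree m m' h : (m <= m')%N -> (h < 2 ^ m)%N -> (tm_poly m)`_h = (tm_poly m')`_h.
Proof.
move=> /subnKC <- hm; elim: (m' - m)%N => [|k IH]; first by rewrite addn0.
rewrite addnS tm_polyS mulrBr mulr1 coefB coefMXn.
have -> : (h < 2 ^ (m + k))%N by apply: leq_trans hm _; rewrite leq_exp2l // leq_addr.
by rewrite subr0.
Qed.

Section Product.
Context {R : realType}.
Implicit Types x y : R.

Definition tm_prod m x : R := \prod_(i < m) (1 - x ^+ (2 ^ i)).

(** The generating function of the Thue-Morse sequence, by [thue_morse_sum]. *)
Definition tm_val x : R := lim (tm_prod ^~ x @ \oo).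

Lemma tm_prodS m x : tm_prod m.+1 x = tm_prod m x * (1 - x ^+ (2 ^ m)).
Proof. by rewrite /tm_prod big_ord_recr. Qed.

Lemma tm_prod0 x : tm_prod 0 x = 1. Proof. by rewrite /tm_prod big_ord0. Qed.

Lemma evalz_tm m x : evalz (tm_poly m) x = tm_prod m x.
Proof.
elim: m => [|m IH]; first by rewrite /tm_poly big_ord0 tm_prod0 rmorph1 hornerC.
rewrite tm_polyS tm_prodS evalzM IH; congr (_ * _).
have -> : 1 - 'X^(2 ^ m) = 1%:P + (-1)%:P * 'X^(2 ^ m) :> {poly int} by rewrite rmorphN1 mulN1r.
by rewrite evalzD evalzM !evalzC evalzXn mulN1r.
Qed.

Lemma tm_prodD k m x : tm_prod (k + m) x = tm_prod k x * tm_prod m (x ^+ (2 ^ k)).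
Proof.
elim: m => [|m IH]; first by rewrite addn0 tm_prod0 mulr1.
by rewrite addnS !tm_prodS IH expnD exprM mulrA.
Qed.

Lemma pow_itv x k : 0 <= x <= 1 -> 0 <= x ^+ k <= 1.
Proof. by move=> /andP[x0 x1]; rewrite exprn_ge0 // exprn_ile1. Qed.

Lemma tm_prod_itv m x : 0 <= x <= 1 -> 0 <= tm_prod m x <= 1.
Proof.
move=> x01; elim: m => [|m /andP[h0 h1]]; first by rewrite tm_prod0 ler01 lexx.
have /andP[p0 p1] := pow_itv (2 ^ m) x01.
by rewrite tm_prodS mulr_ge0 ?subr_ge0 // mulr_ile1 ?subr_ge0 //; lra.
Qed.

Lemma tm_prod_noninc x : 0 <= x <= 1 -> nonincreasing_seq (tm_prod ^~ x).
Proof.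
move=> x01; apply/nonincreasing_seqP => m; rewrite tm_prodS.
have /andP[h0 h1] := tm_prod_itv m x01; have /andP[p0 p1] := pow_itv (2 ^ m) x01.
by rewrite ler_piMr //; lra.
Qed.

Lemma tm_prod_cvg x : 0 <= x <= 1 -> tm_prod ^~ x @ \oo --> tm_val x.
Proof.
move=> x01; apply: nonincreasing_is_cvgn; first exact: tm_prod_noninc.
by exists 0 => _ [m _ <-]; have /andP[] := tm_prod_itv m x01.
Qed.

Lemma tm_val_le m x : 0 <= x <= 1 -> tm_val x <= tm_prod m x.
Proof.
move=> x01; apply: (nonincreasing_cvgn_ge (tm_prod_noninc x01)).
by apply/cvg_ex; exists (tm_val x); exact: tm_prod_cvg.
Qed.

Lemma tm_val_ge x (b : R) : 0 <= x <= 1 -> (forall m, b <= tm_prod m x) -> b <= tm_val x.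
Proof.
move=> x01 h; apply: limr_ge.
  by apply/cvg_ex; exists (tm_val x); exact: tm_prod_cvg.
by apply: nearW.
Qed.

Lemma tm_val_itv x : 0 <= x <= 1 -> 0 <= tm_val x <= 1.
Proof.
move=> x01; rewrite tm_val_ge //=; last by move=> m; have /andP[] := tm_prod_itv m x01.
by apply: le_trans (tm_val_le 0 x01) _; rewrite tm_prod0.
Qed.

Lemma tm_val_split k x : 0 <= x <= 1 -> tm_val x = tm_prod k x * tm_val (x ^+ (2 ^ k)).
Proof.
move=> x01; have h := tm_prod_cvg x01; rewrite -(cvg_shiftn k) in h.
have h2 : (fun m => tm_prod (m + k) x) @ \oo --> tm_prod k x * tm_val (x ^+ (2 ^ k)).
  under eq_fun do rewrite addnC tm_prodD.
  by apply: cvgM; [exact: cvg_cst | exact: tm_prod_cvg (pow_itv _ x01)].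
exact: (cvg_unique (@Rhausdorff R) h h2).
Qed.

(** By induction, since [(1 - x) (1 - 2 x^2) >= 1 - 2 x]. *)
Lemma tm_prod_ge m x : 0 <= x <= 1 / 2 -> 1 - 2 * x <= tm_prod m x.
Proof.
elim: m x => [|m IH] x x02; first by rewrite tm_prod0; lra.
rewrite -[m.+1]add1n tm_prodD tm_prodS tm_prod0 mul1r expn0 expn1 expr1 expr2.
have h : 0 <= x * x <= 1 / 2 by apply/andP; split; nra.
have := IH _ h; move: (tm_prod m _) => T hT; nra.
Qed.

Lemma tm_val_near m x : 0 <= x <= 1 / 2 -> `|tm_val x - tm_prod m x| <= 2 * x ^+ (2 ^ m).
Proof.
move=> x02; have x01 : 0 <= x <= 1 by lra.
rewrite (tm_val_split m x01) -[X in _ - X]mulr1 -mulrBr normrM.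
have h : 0 <= x ^+ (2 ^ m) <= 1 / 2.
  have /andP[-> _] := pow_itv (2 ^ m) x01.
  apply: (@le_trans _ _ (x ^+ 1)); last by rewrite expr1; lra.
  by apply: ler_wiXn2l; rewrite ?expn_gt0 //; lra.
have h1 : 1 - 2 * x ^+ (2 ^ m) <= tm_val (x ^+ (2 ^ m)).
  by apply: tm_val_ge; [exact: pow_itv | move=> k; exact: tm_prod_ge].
have /andP[_ h2] := tm_val_itv (pow_itv (2 ^ m) x01).
have /andP[h3 h4] := tm_prod_itv m x01.
rewrite distrC ger0_norm // [X in _ * X]ger0_norm ?subr_ge0 //.
set z := x ^+ (2 ^ m) in h h1 h2 *; set V := tm_val z in h1 h2 *; set T := tm_prod m x in h3 h4 *.
clearbody T V z; nra.
Qed.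

Lemma pow2_small x (e : R) : 0 < x < 1 -> 0 < e -> exists k0, forall k, (k0 <= k)%N -> x ^+ (2 ^ k) <= e.
Proof.
move=> /andP[x0 x1] e0; have [M hM] := geometric_small x0 x1 ler01 e0.
exists M => k Mk; rewrite -[leLHS]mul1r; apply: hM.
by apply: leq_trans Mk _; apply: ltnW; exact: ltn_expl.
Qed.

Lemma tm_prod_gt0 m x : 0 <= x < 1 -> 0 < tm_prod m x.
Proof.
move=> /andP[x0 x1]; apply: prodr_gt0 => i _.
by rewrite subr_gt0 exprn_ilt1 // -lt0n expn_gt0.
Qed.

Lemma tm_val_gt0 x : 0 < x < 1 -> 0 < tm_val x.
Proof.
move=> x01; have [k /(_ k (leqnn _)) hk] := pow2_small x01 (divr_gt0 ltr01 (ltr0Sn R 3)).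
have x01' : 0 <= x <= 1 by lra.
have x01'' : 0 <= x < 1 by lra.
rewrite (tm_val_split k x01') mulr_gt0 ?tm_prod_gt0 //.
have /andP[h0 h1] := pow_itv (2 ^ k) x01'.
apply: (@lt_le_trans _ _ (1 / 2)); first by lra.
apply: tm_val_ge; first by rewrite h0.
move=> m; have : 1 - 2 * x ^+ (2 ^ k) <= tm_prod m (x ^+ (2 ^ k)).
  by apply: tm_prod_ge; rewrite h0; lra.
by lra.
Qed.

(** As [m] is arbitrary, [tm_val] vanishes at 1 to infinite order. *)
Lemma tm_prod_near1 m : exists2 C : R, 0 <= C & forall x, 0 <= x <= 1 -> tm_prod m x <= C * (1 - x) ^+ m.
Proof.
elim: m => [|m [C C0 IH]]; first by exists 1 => // x _; rewrite tm_prod0 expr0 mulr1.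
exists (C * (2 ^ m)%:R) => [|x x01]; first by rewrite mulr_ge0.
have h : forall k, 1 - x ^+ k <= k%:R * (1 - x).
  elim=> [|k IHk]; first by rewrite expr0 subrr mul0r.
  have /andP[p0 p1] := pow_itv k x01.
  by rewrite exprS -natr1 mulrDl mul1r; nra.
rewrite tm_prodS exprSr; have /andP[p0 p1] := pow_itv (2 ^ m) x01.
have /andP[t0 t1] := tm_prod_itv m x01.
have -> : C * (2 ^ m)%:R * ((1 - x) ^+ m * (1 - x)) = (C * (1 - x) ^+ m) * ((2 ^ m)%:R * (1 - x)) by ring.
by apply: ler_pM; rewrite ?subr_ge0 ?IH ?h.
Qed.

End Product.

(** * Polynomials in two variables *)

Section Bipoly.
Variable n : nat.
Local Notation I := ('I_n.+1 * 'I_n.+1)%type.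
Variable W : I -> int.

(** The value at [Y = Q] of the polynomial in [X, Y] whose coefficient of [X^j Y^i] is
[W (i, j)]. *)
Definition bipoly (Q : {poly int}) : {poly int} := \sum_p (W p)%:P * ('X^(p.2) * Q ^+ p.1).

Definition bilen : int := \sum_p `|W p|.

Lemma bilen_ge0 : 0 <= bilen. Proof. by apply: sumr_ge0 => p _; exact: normr_ge0. Qed.

Definition bieval {R : realType} (x y : R) : R := \sum_p (W p)%:~R * (x ^+ p.2 * y ^+ p.1).

Lemma evalz_bipoly (R : realType) Q (x : R) : evalz (bipoly Q) x = bieval x (evalz Q x).
Proof.
rewrite /bipoly evalz_sum; apply: eq_bigr => p _.
by rewrite !evalzM evalzC evalzXn evalz_exp.
Qed.

Lemma bieval_lip (R : realType) (x y y' : R) : 0 <= x <= 1 -> 0 <= y <= 1 -> 0 <= y' <= 1 ->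
  `|bieval x y - bieval x y'| <= bilen%:~R * n%:R * `|y - y'|.
Proof.
move=> x01 y01 y01'.
have pw i : `|y ^+ i - y' ^+ i| <= i%:R * `|y - y'|.
  elim: i => [|i IH]; first by rewrite !expr0 subrr normr0 mul0r.
  have -> : y ^+ i.+1 - y' ^+ i.+1 = y * (y ^+ i - y' ^+ i) + y' ^+ i * (y - y') by rewrite !exprS; ring.
  apply: le_trans (ler_normD _ _) _; rewrite !normrM -natr1 mulrDl mul1r.
  have /andP[h0 h1] := pow_itv i y01'.
  rewrite (ger0_norm h0); have /andP[y0 y1] := y01; rewrite (ger0_norm y0).
  have z0 := normr_ge0 (y - y'); have z1 := normr_ge0 (y ^+ i - y' ^+ i).
  by apply: lerD; [apply: le_trans IH; rewrite ler_piMl | rewrite ler_piMl].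
rewrite /bieval -sumrB; apply: le_trans (ler_norm_sum _ _ _) _.
rewrite /bilen rmorph_sum !mulr_suml; apply: ler_sum => p _.
rewrite -mulrBr normrM -intr_norm -mulrA ler_wpM2l ?ler0z //.
rewrite -mulrBr normrM; have /andP[h0 h1] := pow_itv p.2 x01; rewrite (ger0_norm h0).
apply: le_trans (_ : `|y ^+ p.1 - y' ^+ p.1| <= _); first by rewrite ler_piMl.
apply: le_trans (pw _) _; rewrite ler_wpM2r // ler_nat.
by have := ltn_ord p.1; rewrite ltnS.
Qed.

Lemma coef_agreeM (e : nat) (p q p' q' : {poly int}) : (forall h, (h < e)%N -> p`_h = p'`_h) ->
  (forall h, (h < e)%N -> q`_h = q'`_h) -> forall h, (h < e)%N -> (p * q)`_h = (p' * q')`_h.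
Proof.
move=> hp hq h he; rewrite !coefM; apply: eq_bigr => j _.
by rewrite hp ?hq //; apply: leq_ltn_trans he; [exact: leq_subr | rewrite -ltnS].
Qed.

Lemma bipoly_agree e (Q Q' : {poly int}) : (forall h, (h < e)%N -> Q`_h = Q'`_h) ->
  forall h, (h < e)%N -> (bipoly Q)`_h = (bipoly Q')`_h.
Proof.
move=> hQ h he; rewrite /bipoly !coef_sum; apply: eq_bigr => p _; rewrite !coefCM; congr (_ * _).
apply: (coef_agreeM (e := e)) => // {h he}.
elim: (nat_of_ord p.1) => [|i IH] //.
by move=> h he; rewrite !exprS; apply: (coef_agreeM hQ IH).
Qed.

Lemma poly_len_bipoly Q (c : int) : 1 <= c -> poly_len Q <= c -> poly_len (bipoly Q) <= bilen * c ^+ n.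
Proof.
move=> c1 Qc; apply: le_trans (poly_len_sum _) _; rewrite /bilen mulr_suml.
apply: ler_sum => p _; rewrite poly_len_Cmul ler_wpM2l //.
apply: le_trans (poly_lenM _ _) _; rewrite poly_len_Xn mul1r.
apply: le_trans (poly_lenX _ _) _.
apply: (@le_trans _ _ (c ^+ p.1)).
  by apply: lerXn2r; rewrite ?nnegrE ?poly_len_ge0 // (le_trans _ c1).
by apply: ler_weXn2l => //; have := ltn_ord p.1; rewrite ltnS.
Qed.

Lemma bipoly_tm_agree m m' h : (h < 2 ^ m)%N -> (h < 2 ^ m')%N ->
  (bipoly (tm_poly m))`_h = (bipoly (tm_poly m'))`_h.
Proof.
wlog mm : m m' / (m <= m')%N.
  by move=> H hm hm'; have [/H->//|/ltnW/H->] := leqP m m'.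
by move=> hm _; apply: (bipoly_agree (e := 2 ^ m)) => // j hj; exact: tm_poly_agree.
Qed.

End Bipoly.

(** * The function P(x, T(x)) near 0 and 1 *)

Section Transcendental.
Context {R : realType}.
Variables (n : nat) (W : 'I_n.+1 * 'I_n.+1 -> int).

(** From [k] to [k.+1] the left-hand side is multiplied by [2^n x^(2^k)], which tends to
0. *)
Lemma pow2_pow_small (x : R) (e : R) : 0 < x < 1 -> 0 < e ->
  exists k0, forall k, (k0 <= k)%N -> (2 ^+ k) ^+ n * x ^+ (2 ^ k) <= e.
Proof.
move=> x01 e0; have /andP[x0 x1] := x01.
pose u k : R := (2 ^+ k) ^+ n * x ^+ (2 ^ k).
have u0 k : 0 <= u k by rewrite mulr_ge0 ?exprn_ge0 // ltW.
have d0 : 0 < (2 ^+ n.+1)^-1 :> R by rewrite invr_gt0 exprn_gt0.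
have [k1 hk1] := pow2_small x01 d0.
have step k : (k1 <= k)%N -> u k.+1 <= u k * (1 / 2).
  move=> /hk1 h; rewrite /u exprS exprMn expnS mul2n -addnn exprD.
  have -> : 2 ^+ n * 2 ^+ k ^+ n * (x ^+ (2 ^ k) * x ^+ (2 ^ k)) = u k * (2 ^+ n * x ^+ (2 ^ k)).
    by rewrite /u; ring.
  rewrite ler_wpM2l //; apply: (@le_trans _ _ (2 ^+ n * (2 ^+ n.+1)^-1)).
    by rewrite ler_wpM2l // exprn_ge0.
  by rewrite exprSr invfM mulrA divff ?mul1r ?expf_neq0.
have [M hM] : exists M : nat, forall m, (M <= m)%N -> u k1 * (1 / 2) ^+ m <= e.
  by apply: geometric_small => //; lra.
exists (k1 + M)%N => k hk; rewrite -/(u k).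
have -> : k = (k1 + (k - k1))%N by rewrite subnKC //; lia.
apply: le_trans (hM (k - k1)%N _); last by lia.
elim: (k - k1)%N => [|j IH]; first by rewrite addn0 expr0 mulr1.
rewrite addnS exprSr [leRHS]mulrA; apply: le_trans (step _ _) _; first by rewrite leq_addr.
by rewrite ler_wpM2r.
Qed.

(** The polynomials [bipoly W (tm_poly m)] vanish at 0 to order [2^m], while their
lengths grow only like [(2^m)^n]. *)
Lemma bieval_zero : (forall m h, (h < 2 ^ m)%N -> (bipoly W (tm_poly m))`_h = 0) ->
  forall x : R, 0 < x < 1 -> bieval W x (tm_val x) = 0.
Proof.
move=> W0 x x01; apply/eqP; rewrite -normr_le0; apply/ler_addgt0Pr => e e0; rewrite add0r.
have x01' : 0 <= x <= 1 by lra.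
have L0 : 0 <= (bilen W)%:~R :> R by rewrite ler0z bilen_ge0.
pose c : R := (bilen W)%:~R * (1 + n%:R) + 1.
have c0 : 0 < c by rewrite /c ltr_wpDl // mulr_ge0 // addr_ge0.
pose d := e / (2 * c); have d0 : 0 < d by rewrite divr_gt0 // mulr_gt0.
have dc : d * c = e / 2 by rewrite /d; field; rewrite lt0r_neq0.
have [k1 hk1] := pow2_pow_small x01 d0.
have [k2 _ hk2] := (@cvgrPdist_le _ _ _ _ _ _ _).1 (tm_prod_cvg x01') _ d0.
pose k := maxn k1 k2.
have h1 := hk1 k (leq_maxl _ _); have /= h2 := hk2 k (leq_maxr _ _).
have h3 : `|bieval W x (tm_prod k x)| <= (bilen W)%:~R * d.
  rewrite -evalz_tm -evalz_bipoly; apply: le_trans (horner_len x01' (W0 k)) _.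
  apply: (@le_trans _ _ ((bilen W)%:~R * ((2 ^+ k) ^+ n * x ^+ (2 ^ k)))); last by rewrite ler_wpM2l.
  rewrite mulrA ler_wpM2r //; first by rewrite exprn_ge0 //; lra.
  have := poly_len_bipoly W (exprn_ege1 k (ler1n _ 2)) (poly_len_tm k).
  by rewrite -(ler_int R) rmorphM !rmorphXn.
have h4 := bieval_lip W x01' (tm_val_itv x01') (tm_prod_itv k x01').
have h5 : (bilen W)%:~R * n%:R * `|tm_val x - tm_prod k x| <= (bilen W)%:~R * n%:R * d.
  by rewrite ler_wpM2l // mulr_ge0.
rewrite -[bieval W x _](subrK (bieval W x (tm_prod k x))).
apply: le_trans (ler_normD _ _) _.
by move: dc; rewrite /c mulrDr mulrDr mulr1; move: ((bilen W)%:~R) h3 h4 h5 => Z; lra.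
Qed.

Lemma poly_lip1 (g : {poly R}) : exists2 H : R, 0 <= H & forall x, 0 <= x <= 1 ->
  `|g.[x] - g.[1]| <= H * (1 - x).
Proof.
have r : root (g - g.[1]%:P) 1 by rewrite /root hornerD hornerN hornerC subrr.
have /factor_theorem[h e] := r.
exists (\sum_(i < size h) `|h`_i|); first by apply: sumr_ge0.
move=> x x01; have : (g - g.[1]%:P).[x] = (h * ('X - 1%:P)).[x] by rewrite e.
rewrite hornerD hornerN hornerC => ->; rewrite hornerM hornerXsubC normrM.
rewrite [`|x - 1|]distrC [`|1 - x|]ger0_norm; last by lra.
rewrite ler_wpM2r //; first by lra.
rewrite horner_coef; apply: le_trans (ler_norm_sum _ _ _) _; apply: ler_sum => i _.
by have /andP[p0 p1] := pow_itv i x01; rewrite normrM (ger0_norm p0) ler_piMr.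
Qed.

(** The function [tm_val] is transcendental. Otherwise [P(x, T(x)) = 0] on ]0, 1[;
dividing by the lowest power of [T(x)] that occurs, one gets a nonzero polynomial
in [x] bounded by a multiple of [T(x)], which vanishes at 1 to infinite order. *)
Lemma bipoly_tm_neq0 : (exists p, W p != 0) ->
  exists m h, (h < 2 ^ m)%N /\ (bipoly W (tm_poly m))`_h != 0.
Proof.
move=> [p0 Wp0]; apply: contrapT => noh.
have Ez : forall x : R, 0 < x < 1 -> bieval W x (tm_val x) = 0.
  apply: bieval_zero => m h hm; apply/eqP/negPn/negP => c; apply: noh; by exists m, h.
pose P i : {poly R} := \sum_(j < n.+1) (W (i, j))%:~R%:P * 'X^j.
have coefP i (j : 'I_n.+1) : (P i)`_j = (W (i, j))%:~R.
  rewrite coef_sum (bigD1 j) //= big1 ?addr0; first by rewrite coefCM coefXn eqxx mulr1.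
  by move=> k kj; rewrite coefCM coefXn eq_sym (_ : (k == j :> nat) = false) ?mulr0 //; apply/negbTE.
have PnE : exists i, P i != 0.
  exists p0.1; apply: contra Wp0 => /eqP Pz; have := coefP p0.1 p0.2.
  by rewrite Pz coef0 -surjective_pairing => /esym/eqP; rewrite intr_eq0.
have [i1 Pi1] := PnE; case: (@arg_minnP _ i1 (fun i => P i != 0) (fun i : 'I_n.+1 => nat_of_ord i) Pi1) => i0 Pi0 imin.
have Plow (i : 'I_n.+1) : (i < i0)%N -> P i = 0.
  by move=> h; apply/eqP/negPn/negP => /imin; rewrite leqNgt h.
have evalE x y : bieval W x y = \sum_i (P i).[x] * y ^+ i.
  transitivity (\sum_(i < n.+1) \sum_(j < n.+1) (W (i, j))%:~R * (x ^+ j * y ^+ i)).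
    by rewrite pair_big; apply: eq_bigr => -[].
  apply: eq_bigr => i _; rewrite /P horner_sum mulr_suml; apply: eq_bigr => j _.
  by rewrite hornerM hornerC hornerXn mulrA.
have L0 : 0 <= (bilen W)%:~R :> R by rewrite ler0z bilen_ge0.
have Pbound x : 0 < x < 1 -> `|(P i0).[x]| <= (bilen W)%:~R * tm_val x.
  move=> x01; have x01' : 0 <= x <= 1 by lra.
  have T0 := tm_val_gt0 x01; have /andP[_ T1] := tm_val_itv x01'.
  have := Ez x x01; rewrite evalE (bigD1 i0) //= => /eqP; rewrite addr_eq0 => /eqP e.
  rewrite -(ler_pM2r (exprn_gt0 i0 T0)).
  have -> : `|(P i0).[x]| * tm_val x ^+ i0 = `|(P i0).[x] * tm_val x ^+ i0|.
    by rewrite normrM normrX (gtr0_norm T0).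
  rewrite e normrN -mulrA -exprS; apply: le_trans (ler_norm_sum _ _ _) _.
  have -> : bilen W = \sum_(i < n.+1) \sum_(j < n.+1) `|W (i, j)|.
    by rewrite pair_big; apply: eq_bigr => -[].
  rewrite rmorph_sum mulr_suml [leRHS](bigD1 i0) //=.
  apply: ler_wpDl.
    by rewrite mulr_ge0 ?ler0z ?exprn_ge0 ?(ltW T0) //; apply: sumr_ge0.
  apply: ler_sum => i ii0; have [h|h] := ltnP i i0.
    by rewrite Plow // horner0 mul0r normr0 mulr_ge0 ?ler0z ?exprn_ge0 ?(ltW T0) //; apply: sumr_ge0.
  rewrite normrM; apply: ler_pM => //.
    rewrite horner_sum; apply: le_trans (ler_norm_sum _ _ _) _; rewrite rmorph_sum; apply: ler_sum => j _.
    rewrite hornerM hornerC hornerXn normrM -intr_norm.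
    by have /andP[q0 q1] := pow_itv j x01'; rewrite (ger0_norm q0) ler_piMr ?ler0z.
  rewrite ger0_norm ?exprn_ge0 ?(ltW T0) //; apply: ler_wiXn2l => //; first exact: ltW.
  by rewrite ltn_neqAle h andbT eq_sym.
have [r [g gn0 ge]] := multiplicity_XsubC (P i0) 1.
move: gn0; rewrite Pi0 /= => /negP; apply.
have [C C0 hC] := @tm_prod_near1 R r.+1.
have [H H0 hH] := poly_lip1 g.
rewrite /root -normr_le0; apply/ler_addgt0Pr => e e0; rewrite add0r.
pose K := (bilen W)%:~R * C + H + 1.
have K0 : 0 < K by rewrite /K ltr_wpDl // addr_ge0 // mulr_ge0.
pose y := Num.min (1 / 2) (e / K).
have y0 : 0 < y by rewrite lt_min divr_gt0 // divr_gt0.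
have y1 : y <= 1 / 2 by rewrite ge_min lexx.
have yK : y * K <= e by rewrite -ler_pdivlMr // ge_min lexx orbT.
pose x := 1 - y; have x01 : 0 < x < 1 by rewrite /x; apply/andP; split; lra.
have x01' : 0 <= x <= 1 by lra.
have xy : 1 - x = y by rewrite /x; ring.
have h1 : `|g.[x]| <= (bilen W)%:~R * C * y.
  have yr : 0 < y ^+ r by exact: exprn_gt0.
  rewrite -(ler_pM2r yr).
  have -> : `|g.[x]| * y ^+ r = `|(P i0).[x]|.
    rewrite ge hornerM horner_exp hornerXsubC normrM normrX; congr (_ * _ ^+ _).
    by rewrite distrC xy ger0_norm // ltW.
  apply: le_trans (Pbound x x01) _; rewrite -!mulrA ler_wpM2l //.
  apply: le_trans (tm_val_le r.+1 x01') _; apply: le_trans (hC _ x01') _.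
  by rewrite xy exprS.
have := hH x x01'; rewrite xy => h2.
have h3 := ler_normB g.[x] (g.[x] - g.[1]).
have -> : g.[1] = g.[x] - (g.[x] - g.[1]) by ring.
apply: le_trans h3 _; apply: le_trans yK; rewrite /K.
move: ((bilen W)%:~R * C) h1 => Z h1; nra.
Qed.

(** Near 0 the value is equivalent to the first nonzero term [e x^h0] of the power
series, and [h0 >= K]. *)
Lemma bieval_small K : (K < 2 ^ K)%N -> (exists p, W p != 0) ->
  (forall h, (h < K)%N -> (bipoly W (tm_poly K))`_h = 0) ->
  exists (C d : R), [/\ 0 <= C, 0 < d & forall x : R, 0 < x <= d ->
    bieval W x (tm_val x) != 0 /\ `|bieval W x (tm_val x)| <= C * x ^+ K].
Proof.
move=> K2 Wn0 Wlow.
have ex : exists h, `[< exists m, (h < 2 ^ m)%N /\ (bipoly W (tm_poly m))`_h != 0 >].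
  by have [m [h hm]] := bipoly_tm_neq0 Wn0; exists h; apply/asboolP; exists m.
have [h0 /asboolP[m [hm nz]] hmin] := ex_minnP ex.
set F := bipoly W (tm_poly m) in nz.
have Flow h : (h < h0)%N -> F`_h = 0.
  move=> hh0; apply/eqP/negPn/negP => c.
  have : (h0 <= h)%N by apply: hmin; apply/asboolP; exists m; split=> //; exact: ltn_trans hm.
  by rewrite leqNgt hh0.
have Kh0 : (K <= h0)%N.
  rewrite leqNgt; apply/negP => h; move/eqP: nz; apply.
  by rewrite /F (bipoly_tm_agree W (m' := K)) // ?Wlow //; exact: ltn_trans K2.
pose e : R := (F`_h0)%:~R; have e0 : e != 0 by rewrite intr_eq0.
pose F1 := F + (- F`_h0)%:P * 'X^h0.
pose L : R := (bilen W)%:~R * n%:R * 2 + (poly_len F1)%:~R.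
have L0 : 0 <= L.
  by rewrite addr_ge0 ?ler0z ?poly_len_ge0 // !mulr_ge0 ?ler0z ?bilen_ge0.
have asym x : 0 < x <= 1 / 2 -> `|bieval W x (tm_val x) - e * x ^+ h0| <= L * x ^+ h0.+1.
  move=> x02; have x01 : 0 <= x <= 1 by lra.
  have x02' : 0 <= x <= 1 / 2 by lra.
  have F1low h : (h < h0.+1)%N -> F1`_h = 0.
    rewrite ltnS leq_eqVlt /F1 coefD coefCM coefXn => /predU1P[->|h1].
      by rewrite eqxx mulr1 subrr.
    by rewrite (ltn_eqF h1) mulr0 addr0 Flow.
  have h1 := horner_len x01 F1low.
  have F1E : evalz F1 x = bieval W x (tm_prod m x) - e * x ^+ h0.
    by rewrite /F1 evalzD evalzM evalzC evalzXn /F evalz_bipoly evalz_tm rmorphN mulNr.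
  rewrite F1E in h1.
  have h2 := bieval_lip W x01 (tm_val_itv x01) (tm_prod_itv m x01).
  have h3 := tm_val_near m x02'.
  have h4 : x ^+ (2 ^ m) <= x ^+ h0.+1 by apply: ler_wiXn2l => //; lra.
  have BL0 : 0 <= (bilen W)%:~R * n%:R :> R by rewrite mulr_ge0 // ler0z bilen_ge0.
  have h5 : (bilen W)%:~R * n%:R * `|tm_val x - tm_prod m x| <= (bilen W)%:~R * n%:R * (2 * x ^+ h0.+1).
    by rewrite ler_wpM2l // (le_trans h3) // ler_wpM2l.
  have -> : bieval W x (tm_val x) - e * x ^+ h0 =
     (bieval W x (tm_val x) - bieval W x (tm_prod m x)) + (bieval W x (tm_prod m x) - e * x ^+ h0) by ring.
  apply: le_trans (ler_normD _ _) _; rewrite /L mulrDl; apply: lerD => //.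
  by apply: le_trans h2 _; apply: le_trans h5 _; rewrite mulrA.
pose d := Num.min (1 / 2) (`|e| / (2 * (L + 1))).
have L1 : 0 < L + 1 by rewrite ltr_wpDl.
have ne0 : 0 < `|e| by rewrite normr_gt0.
exists (`|e| + L), d; split.
- by rewrite addr_ge0.
- by rewrite lt_min !divr_gt0 // mulr_gt0.
move=> x /andP[x0 xd].
have x2 : x <= 1 / 2 by apply: le_trans xd _; rewrite ge_min lexx.
have xe : x * (2 * (L + 1)) <= `|e|.
  by rewrite -ler_pdivlMr ?mulr_gt0 //; apply: le_trans xd _; rewrite ge_min lexx orbT.
have h1 : `|bieval W x (tm_val x) - e * x ^+ h0| <= L * x ^+ h0.+1 by apply: asym; rewrite x0.
have xp : 0 < x ^+ h0 by rewrite exprn_gt0.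
have ex0 : `|e * x ^+ h0| = `|e| * x ^+ h0 by rewrite normrM (gtr0_norm xp).
rewrite exprS in h1.
have xL : x * L <= `|e| / 2 by move: xe; clear -x0; move: `|e| => z xe; nra.
have h2 : L * (x * x ^+ h0) <= `|e| / 2 * x ^+ h0 by rewrite mulrA ler_wpM2r ?(ltW xp) // mulrC.
split.
  apply/eqP => E0; move: h1; rewrite E0 sub0r normrN ex0 => h1.
  have : 0 < `|e| * x ^+ h0 by rewrite mulr_gt0.
  by move: h1 h2; move: (`|e|) (x ^+ h0) => z1 z2; nra.
have xK : x ^+ h0 <= x ^+ K by apply: ler_wiXn2l => //; lra.
apply: (@le_trans _ _ ((`|e| + L) * x ^+ h0)); last by rewrite ler_wpM2l // addr_ge0.
rewrite -[bieval _ _ _](subrK (e * x ^+ h0)); apply: le_trans (ler_normD _ _) _.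
rewrite ex0 mulrDl addrC lerD2l; apply: le_trans h1 _.
by rewrite ler_wpM2l // ler_piMl ?(ltW xp) //; lra.
Qed.

End Transcendental.

(** * The values of the Thue-Morse product at algebraic points *)

Lemma integer_relation (I : finType) k (f : I -> 'I_k -> int) : (k < #|I|)%N ->
  exists w : I -> int, (exists i, w i != 0) /\ forall h, \sum_i w i * f i h = 0.
Proof.
move=> kI; pose A : 'M[rat]_(#|I|, k) := \matrix_(i, h) (f (enum_val i) h)%:~R.
have kerA : kermx A != 0.
  by rewrite -mxrank_eq0 mxrank_ker -lt0n subn_gt0; exact: leq_ltn_trans (rank_leq_col A) kI.
have /rowV0Pn[v /sub_kermxP vA v0] := kerA.
have [c [u [c0 uv]]] := clear_denominators v.
have uA : map_mx intr u *m A = 0 by rewrite uv -scalemxAl vA scaler0.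
exists (fun i => u 0 (enum_rank i)); split.
  have /rV0Pn[i ui] : u != 0.
    apply: contra_neq v0 => u0; move: uv; rewrite u0 map_mx0 => /esym/eqP.
    by rewrite scaler_eq0 intr_eq0 (negbTE c0) => /eqP.
  by exists (enum_val i); rewrite enum_valK.
move=> h; apply: (@intr_inj rat); rewrite rmorph_sum rmorph0.
have /rowP/(_ h) := uA; rewrite mxE [in RHS]mxE => e; rewrite -[RHS]e.
rewrite (reindex_onto (fun i : 'I_#|I| => enum_val i) enum_rank) /=; last by move=> i _; exact: enum_rankK.
apply: eq_big => [i|i _]; first by rewrite enum_valK eqxx.
by rewrite rmorphM /= !mxE enum_valK.
Qed.

(** There are [n^2] linear conditions on [(n + 1)^2] coefficients. *)
Lemma auxiliary_polynomial n : exists W : 'I_n.+1 * 'I_n.+1 -> int, (exists p, W p != 0) /\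
  forall h, (h < n * n)%N -> (bipoly W (tm_poly (n * n)))`_h = 0.
Proof.
have nI : (n * n < #|{: 'I_n.+1 * 'I_n.+1}|)%N by rewrite card_prod !card_ord; lia.
have [W [Wn0 hW]] := integer_relation (fun (p : 'I_n.+1 * 'I_n.+1) (h : 'I_(n * n)) => ('X^(p.2) * tm_poly (n * n) ^+ p.1)`_h) nI.
exists W; split=> // h hn; rewrite coef_sum -[RHS](hW (Ordinal hn)).
by apply: eq_bigr => p _; rewrite coefCM.
Qed.

Lemma size_mul_le (p r : {poly int}) e e' : (size p <= e.+1)%N -> (size r <= e'.+1)%N ->
  (size (p * r)%R <= (e + e').+1)%N.
Proof. by move=> pe re; apply: leq_trans (size_polyMleq _ _) _; lia. Qed.

Lemma size_exp_le (p : {poly int}) e i : (size p <= e.+1)%N -> (size (p ^+ i) <= (e * i).+1)%N.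
Proof.
move=> pe; apply: leq_trans (size_poly_exp_leq _ _) _; rewrite ltnS leq_mul2r.
by apply/orP; right; lia.
Qed.

Lemma auxiliary_degree n s z i j : (i <= n)%N -> (j <= n)%N -> (0 < z)%N ->
  (z * j + (s * i + (s + z) * (n - i)) <= n * (z * s.+2))%N.
Proof.
move=> hi hj z0.
have i1 : (z * j <= z * n)%N by rewrite leq_mul2l hj orbT.
have i3 : (s * i + (s + z) * (n - i) <= (s + z) * n)%N.
  apply: (@leq_trans ((s + z) * i + (s + z) * (n - i))); last by rewrite -mulnDr subnKC.
  by rewrite leq_add2r leq_mul2r leq_addr orbT.
have i4 : (s * n <= z * s * n)%N by rewrite leq_mul2r leq_pmull ?orbT.
have -> : (n * (z * s.+2) = z * s * n + z * n + z * n)%N by rewrite -addn2 mulnDr; ring.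
by move: i3; rewrite [leqRHS]mulnDl; move: (s * i + _)%N (z * j)%N (z * n)%N (s * n)%N (z * s * n)%N i1 i4 => t u v w y; lia.
Qed.

(** Mahler's method. Let [P] be the auxiliary polynomial and [x = q^(2^k)]. If
[T(q) = T_k(q) T(x)] equals [A(q) / B(q)], then [P(x, T(x))] multiplied by
[(B(q) T_k(q))^n] is the value at [q] of an integer polynomial, whose degree is
at most a multiple of [n 2^k] and whose length is at most [c^(n 2^k)] up to a
constant. By [bieval_small] it is not 0 for large [k], so [liouville] bounds it
below by some [C^(- n 2^k)]; but it is at most a constant times [q^(n^2 2^k)]. For
[n] large this is impossible when [k] is large. *)
Theorem thue_morse_product_not_rational (R : realType) (q : R) (A B : {poly int}) :
  0 < q < 1 -> algebraicOver (ratr : rat -> R) q -> evalz B q != 0 ->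
  tm_val q * evalz B q <> evalz A q.
Proof.
move=> q01 qalg Bq eAB; have /andP[q0 q1] := q01; have q01' : 0 <= q <= 1 by lra.
have [C [d [C1 hC]]] := liouville q01' qalg.
pose c : int := 1 + poly_len A + poly_len B.
have Ac : poly_len A <= c by have := poly_len_ge0 B; rewrite /c; lia.
have Bc : poly_len B <= c by have := poly_len_ge0 A; rewrite /c; lia.
have c1 : 1 <= c by have := poly_len_ge0 A; have := poly_len_ge0 B; rewrite /c; lia.
pose s := maxn (size A) (size B).
have sA : (size A <= s.+1)%N by rewrite leqW // leq_maxl.
have sB : (size B <= s.+1)%N by rewrite leqW // leq_maxr.
pose G := C ^+ s.+2 * 2 ^+ d.
have G1 : 1 <= G by rewrite -[leLHS]mulr1 ler_pM // exprn_ege1 // ler1n.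
have G0 : 0 < G by lra.
(* For this [n] the order of vanishing beats the bound of [liouville]. *)
have [n [n0 hn]] : exists n, (0 < n)%N /\ q ^+ n * G <= 1 / 2.
  have [M hM] := geometric_small q0 q1 (ltW G0) (divr_gt0 ltr01 (ltr0Sn R 1)).
  by exists M.+1; split=> //; rewrite mulrC; exact: hM.
have [W [Wn0 hW]] := auxiliary_polynomial n.
have [C' [dl [C'0 dl0 small]]] := @bieval_small R n W _ (ltn_expl (n * n) (isT : (1 < 2)%N)) Wn0 hW.
have [k0 hk0] := pow2_small q01 dl0.
pose cR : R := c%:~R; have cR1 : 1 <= cR by rewrite -[1]/(1%:~R) ler_int.
pose S1 : R := (1 + bilen W)%:~R * cR ^+ n.
have S11 : 1 <= S1.
  by rewrite -[leLHS]mulr1 ler_pM // ?exprn_ege1 // -[1]/(1%:~R) ler_int lerDl bilen_ge0.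
pose K0 := C' * cR ^+ n * C * S1 ^+ d.
have main k : (k0 <= k)%N -> 1 <= K0 * (1 / 2) ^+ (2 ^ k).
  move=> /hk0 xdl; set x := q ^+ (2 ^ k) in xdl.
  have x0 : 0 < x by rewrite exprn_gt0.
  have [E0 Ele] : bieval W x (tm_val x) != 0 /\ `|bieval W x (tm_val x)| <= C' * x ^+ (n * n).
    by apply: small; rewrite x0.
  pose T := tm_poly k; have Tle := poly_len_tm k.
  pose F : {poly int} := \sum_p (W p)%:P * ('X^(2 ^ k * p.2) * (A ^+ p.1 * (B * T) ^+ (n - p.1))).
  have FE : evalz F q = bieval W x (tm_val x) * (evalz B q * tm_prod k q) ^+ n.
    rewrite /F evalz_sum /bieval mulr_suml; apply: eq_bigr => p _.
    rewrite !evalzM evalzC evalzXn !evalz_exp evalzM evalz_tm -eAB (tm_val_split k q01') -/x exprM -/x.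
    have pn : (p.1 <= n)%N by rewrite -ltnS.
    have -> : (evalz B q * tm_prod k q) ^+ n = (evalz B q * tm_prod k q) ^+ p.1 * (evalz B q * tm_prod k q) ^+ (n - p.1).
      by rewrite -exprD subnKC.
    have -> : tm_prod k q * tm_val x * evalz B q = tm_val x * (evalz B q * tm_prod k q) by ring.
    by rewrite exprMn; ring.
  have T0 : tm_prod k q != 0 by rewrite lt0r_neq0 // tm_prod_gt0 // ltW.
  have F0 : evalz F q != 0 by rewrite FE mulf_neq0 // expf_neq0 // mulf_neq0.
  pose L := (n * (2 ^ k * s.+2))%N.
  have k20 : (0 < 2 ^ k)%N by rewrite expn_gt0.
  have sF : (size F <= L.+1)%N.
    apply: leq_trans (size_sum _ _ _) _; apply/bigmax_leqP => p _.
    rewrite mul_polyC; apply: leq_trans (size_scale_leq _ _) _.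
    have h1 : (size ('X^(2 ^ k * p.2) : {poly int}) <= (2 ^ k * p.2).+1)%N by rewrite size_polyXn.
    have h2 := size_exp_le p.1 sA.
    have h3 : (size (B * T)%R <= (s + 2 ^ k).+1)%N by apply: size_mul_le => //; rewrite leqW // size_tm_poly.
    have h4 := size_exp_le (n - p.1) h3.
    apply: leq_trans (size_mul_le h1 (size_mul_le h2 h4)) _.
    by rewrite ltnS; apply: auxiliary_degree; rewrite // -ltnS.
  have lF : (poly_len F)%:~R <= S1 * (2 ^+ k) ^+ n :> R.
    have lF' : poly_len F <= bilen W * (c * 2 ^+ k) ^+ n.
      have ck1 : 1 <= 2 ^+ k :> int by rewrite exprn_ege1.
      have c0 : 0 <= c := le_trans ler01 c1.
      have cc : c <= c * 2 ^+ k by rewrite ler_peMr.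
      apply: le_trans (poly_len_sum _) _; rewrite /bilen mulr_suml; apply: ler_sum => p _.
      rewrite poly_len_Cmul ler_wpM2l //.
      apply: le_trans (poly_lenM _ _) _; rewrite poly_len_Xn mul1r.
      apply: le_trans (poly_lenM _ _) _.
      have pn : (p.1 <= n)%N by rewrite -ltnS.
      have -> : (c * 2 ^+ k) ^+ n = (c * 2 ^+ k) ^+ p.1 * (c * 2 ^+ k) ^+ (n - p.1) by rewrite -exprD subnKC.
      apply: ler_pM; rewrite ?poly_len_ge0 //.
        apply: le_trans (poly_lenX _ _) _; apply: lerXn2r; rewrite ?nnegrE ?poly_len_ge0 //.
          by rewrite (le_trans c0).
        exact: le_trans Ac cc.
      apply: le_trans (poly_lenX _ _) _; apply: lerXn2r; rewrite ?nnegrE ?poly_len_ge0 //.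
        by rewrite (le_trans c0).
      apply: le_trans (poly_lenM _ _) _; apply: ler_pM; rewrite ?poly_len_ge0 //.
    apply: (@le_trans _ _ (bilen W * (c * 2 ^+ k) ^+ n)%:~R); first by rewrite ler_int.
    rewrite rmorphM rmorphXn /= rmorphM rmorphXn /= -/cR exprMn /S1 mulrA.
    rewrite !ler_wpM2r ?exprn_ge0 //; first by rewrite (le_trans ler01).
    by rewrite ler_int lerDr.
  have ck1 : 1 <= 2 ^+ k ^+ n :> R by rewrite !exprn_ege1 // ler1n.
  have S1k : 1 <= S1 * (2 ^+ k) ^+ n by rewrite -[leLHS]mulr1 ler_pM.
  have := hC L F _ S1k sF lF F0.
  move=> low; apply: le_trans low _.
  have up : `|evalz F q| <= C' * x ^+ (n * n) * cR ^+ n.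
    rewrite FE normrM; apply: ler_pM => //.
    rewrite normrX; apply: lerXn2r; rewrite ?nnegrE //; first by lra.
    rewrite normrM; have /andP[t0 t1] := tm_prod_itv k q01'.
    rewrite [X in _ * X]ger0_norm // -[leRHS]mulr1; apply: ler_pM => //.
    apply: le_trans (horner_len (k := 0) q01' _) _ => //.
    by rewrite expr0 mulr1 ler_int.
  have C0 : 0 <= C by lra.
  have S10 : 0 <= S1 by lra.
  have cR0 : 0 <= cR by lra.
  have x0' := ltW x0.
  have CL : C ^+ L.+1 = C * (C ^+ s.+2) ^+ (n * 2 ^ k).
    by rewrite exprS -exprM; congr (_ * _ ^+ _); rewrite /L; ring.
  have S2 : (S1 * (2 ^+ k) ^+ n) ^+ d <= S1 ^+ d * (2 ^+ d) ^+ (n * 2 ^ k).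
    rewrite exprMn ler_wpM2l ?exprn_ge0 // -!exprM; apply: ler_weXn2l; rewrite ?ler1n //.
    have kk : (k <= 2 ^ k)%N by apply: ltnW; exact: ltn_expl.
    have -> : (k * n * d = d * n * k)%N by ring.
    by rewrite mulnA leq_mul2l kk orbT.
  have xq : x ^+ (n * n) = (q ^+ n) ^+ (n * 2 ^ k).
    by rewrite /x -!exprM; congr (_ ^+ _); ring.
  apply: (@le_trans _ _ ((C' * x ^+ (n * n) * cR ^+ n) *
      (C * (C ^+ s.+2) ^+ (n * 2 ^ k) * (S1 ^+ d * (2 ^+ d) ^+ (n * 2 ^ k))))).
    rewrite CL; apply: ler_pM => //.
      by apply: mulr_ge0; [apply: mulr_ge0 => //; rewrite !exprn_ge0 | rewrite exprn_ge0 // mulr_ge0 // !exprn_ge0].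
    by rewrite ler_wpM2l // mulr_ge0 // !exprn_ge0.
  have -> : C' * x ^+ (n * n) * cR ^+ n * (C * (C ^+ s.+2) ^+ (n * 2 ^ k) * (S1 ^+ d * (2 ^+ d) ^+ (n * 2 ^ k)))
     = K0 * (q ^+ n * G) ^+ (n * 2 ^ k).
    by rewrite xq /K0 /G !exprMn; ring.
  have K00 : 0 <= K0 by rewrite /K0 !mulr_ge0 ?exprn_ge0.
  rewrite ler_wpM2l //.
  have qG0 : 0 <= q ^+ n * G by rewrite mulr_ge0 ?exprn_ge0 // ltW.
  apply: (@le_trans _ _ ((1 / 2) ^+ (n * 2 ^ k))); first by apply: lerXn2r; rewrite ?nnegrE.
  by apply: ler_wiXn2l; rewrite ?leq_pmull //; lra.
have K00 : 0 < K0.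
  rewrite ltNge; apply/negP => K00; have := main k0 (leqnn _).
  have : 0 <= (1 / 2) ^+ (2 ^ k0) :> R by rewrite exprn_ge0.
  by move: (_ ^+ _) => z; nra.
have h2 : 0 < (1 / 2 : R) < 1 by apply/andP; split; lra.
have [k1 hk1] := pow2_small h2 (divr_gt0 ltr01 (mulr_gt0 (ltr0Sn R 1) K00)).
have m1 := main (maxn k0 k1) (leq_maxl _ _).
have m2 := hk1 (maxn k0 k1) (leq_maxr _ _).
have m3 : K0 * (1 / 2) ^+ (2 ^ maxn k0 k1) <= K0 * (1 / (2 * K0)) by rewrite ler_wpM2l // ltW.
have m4 : K0 * (1 / (2 * K0)) = 1 / 2 by field; rewrite lt0r_neq0.
by rewrite m4 in m3; lra.
Qed.

(** * The Thue-Morse sequence *)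

Lemma binary_ones_wide n k : (n < 2 ^ k)%N -> binary_ones n = (\sum_(i < k) ((n %/ 2 ^ i) %% 2))%N.
Proof.
have H a b : (n < 2 ^ a)%N -> (a <= b)%N ->
    (\sum_(i < b) ((n %/ 2 ^ i) %% 2) = \sum_(i < a) ((n %/ 2 ^ i) %% 2))%N.
  move=> na /subnKC <-; elim: (b - a)%N => [|c IH]; first by rewrite addn0.
  rewrite addnS big_ord_recr /= IH divn_small ?mod0n ?addn0 //.
  by apply: leq_trans na _; rewrite leq_exp2l // leq_addr.
move=> nk; rewrite /binary_ones; have nn : (n < 2 ^ n)%N by exact: ltn_expl.
by have [h|/ltnW h] := leqP n k; [rewrite (H _ _ nn h) | rewrite -(H _ _ nk h)].
Qed.

Lemma thue_morse_pow2D m j : (j < 2 ^ m)%N -> thue_morse (2 ^ m + j) = - thue_morse j.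
Proof.
move=> jm; rewrite /thue_morse (@binary_ones_wide _ m.+1); last first.
  by rewrite expnS mul2n -addnn ltn_add2l.
rewrite (binary_ones_wide jm) big_ord_recr /= divnDl ?dvdnn // divnn expn_gt0 /= divn_small // addn0.
rewrite exprD mulrN1; congr (- _ ^+ _); apply: eq_bigr => i _.
have im : (i.+1 <= m)%N by [].
rewrite divnDl ?dvdn_exp2l 1?ltnW //.
rewrite -expnB // 1?ltnW // -[(m - i)%N]prednK ?subn_gt0 // expnS.
by rewrite mulnC modnMDl.
Qed.

Lemma thue_morse_sum (R : realType) m (x : R) :
  \sum_(j < 2 ^ m) (thue_morse j)%:~R * x ^+ j = tm_prod m x.
Proof.
elim: m => [|m IH].
  by rewrite expn0 big_ord1 tm_prod0 /thue_morse /binary_ones big_ord0 expr0 mulr1.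
rewrite expnS mul2n -addnn big_split_ord /= IH tm_prodS mulrBr mulr1; congr (_ + _).
rewrite -IH mulr_suml -sumrN; apply: eq_bigr => j _.
by rewrite thue_morse_pow2D // exprD rmorphN; ring.
Qed.

Lemma tm_series (R : realType) m (q : R) :
  2 * (1 - q) * inflation_series tm_seq q (2 ^ m)%N =
  q * (3 * (1 - q ^+ (2 ^ m)) + (1 - q) * tm_prod m q).
Proof.
have geo M : (1 - q) * \sum_(j < M) q ^+ j = 1 - q ^+ M.
  elim: M => [|M IH]; first by rewrite big_ord0 expr0 mulr0 subrr.
  by rewrite big_ord_recr /= mulrDr IH exprS; ring.
rewrite -geo -thue_morse_sum [3 * _]mulrCA -mulrDr mulrCA [2 * _]mulrC -mulrA; congr (_ * _).
rewrite /inflation_series /series /= big_mkord mulr_sumr mulr_sumr -big_split /= mulr_sumr.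
apply: eq_bigr => j _.
have : (tm_seq j)%:R * 2 = 3 + (thue_morse j)%:~R :> R.
  rewrite (_ : (tm_seq j)%:R * 2 = ((tm_seq j)%:Z * 2)%:~R :> R); last by rewrite intrM.
  by rewrite tm_seqE intrD.
by rewrite exprS; move: (q ^+ j) => z e; transitivity ((tm_seq j)%:R * 2 * (q * z)); [ring | rewrite e; ring].
Qed.

(** The equation of [q] with [a_j = (3 + t_j) / 2] inserted. *)
Lemma tm_relation (R : realType) (q : R) : 0 < q -> q < 1 ->
  inflation_series tm_seq q @ \oo --> (1 : R) ->
  tm_val q * (q * (1 - q)) = 2 - 5 * q.
Proof.
move=> q0 q1 h; have q01 : 0 <= q <= 1 by lra.
have pw : (fun m => 2 ^ m)%N @ \oo --> \oo.
  move=> U [N _ hN]; exists N => // m /= Nm; apply: hN => /=.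
  by apply: leq_trans Nm (ltnW _); exact: ltn_expl.
have h1 : (fun m => 2 * (1 - q) * inflation_series tm_seq q (2 ^ m)%N) @ \oo --> 2 * (1 - q) * 1.
  by apply: cvgM; [exact: cvg_cst | exact: (cvg_comp _ _ pw h)].
have hq : (fun m => q ^+ (2 ^ m)%N) @ \oo --> (0 : R).
  apply: (cvg_comp _ _ pw); apply: cvg_expr; by rewrite ger0_norm // ltW.
have h2 : (fun m => q * (3 * (1 - q ^+ (2 ^ m)) + (1 - q) * tm_prod m q)) @ \oo -->
    q * (3 * (1 - 0) + (1 - q) * tm_val q).
  apply: cvgM; first exact: cvg_cst.
  apply: cvgD; apply: cvgM; try exact: cvg_cst; last exact: tm_prod_cvg.
  by apply: cvgB; [exact: cvg_cst | exact: hq].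
rewrite (_ : (fun m => _) = (fun m => 2 * (1 - q) * inflation_series tm_seq q (2 ^ m)%N)) in h2; last first.
  by apply/funext => m; rewrite tm_series.
have e : 2 * (1 - q) * 1 = q * (3 * (1 - 0) + (1 - q) * tm_val q).
  exact: (cvg_unique (@Rhausdorff R) h1 h2).
lra.
Qed.

(** The number [q] is a root of [X^2 - (q + q^-1) X + 1]. *)
Lemma algebraic_of_sum_inv (R : realType) (q : R) : q != 0 ->
  algebraicOver (ratr : rat -> R) (q + q^-1) -> algebraicOver (ratr : rat -> R) q.
Proof.
move=> q0 halg; apply/integral_algebraic.
have /integral_algebraic int_s := halg.
pose s := q + q^-1; pose p : {poly R} := Poly [:: 1; - s; 1].
have sp : p = [:: 1; - s; 1] :> seq R by rewrite (@PolyK _ 0) //= oner_neq0.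
apply: (@integral_root_monic _ _ _ _ p).
- by rewrite monicE lead_coefE sp.
- by rewrite /root horner_coef sp !big_ord_recr big_ord0 /=; apply/eqP; rewrite /s; field.
- rewrite sp => z; rewrite !inE => /or3P[]/eqP->; [exact: integral1 | | exact: integral1].
  exact: integral_opp.
Qed.

Theorem theorem6p2 (R : realType) :
  [/\
    strictly_ergodic R (subshift_act tm_seq) /\
    (forall (l : alphabet tm_seq -> R) (lambda : R),
       natural_tile_length l lambda -> strictly_ergodic R (tiling_flow l)),
    (exists l : alphabet tm_seq -> R,
       (exists lambda : R, natural_tile_length l lambda) /\
       (forall (l' : alphabet tm_seq -> R) (lambda' : R),
          natural_tile_length l' lambda' ->
          exists2 r : R, 0 < r & forall c : alphabet tm_seq, l' c = r * l c)) &
    (forall (l : alphabet tm_seq -> R) (lambda : R),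
       natural_tile_length l lambda ->
       ~ algebraicOver (ratr : rat -> R) lambda)].
Proof.
have a_gt0 n : (0 < tm_seq n)%N.
  by have := tm_seqE n; rewrite /thue_morse -signr_odd; case: odd => /=; lia.
have a0_gt1 : (1 < tm_seq 0)%N.
  by have := tm_seqE 0; rewrite /thue_morse /binary_ones big_ord0 expr0; lia.
have [l [lambda [nl _]]] := @natural_tile_length_exists R _ _ a_gt0.
split.
- split; first exact: subshift_strictly_ergodic.
  by move=> l' lambda'; exact: flow_strictly_ergodic.
- exists l; split; first by exists lambda.
  by move=> l' lambda' nl'; exact: (natural_tile_length_unique a_gt0 a0_gt1 nl nl').
- move=> l' lambda' nl'.
  have l2 := natural_inflation_gt2 nl' a0_gt1.
  have [q [q0 q1 -> hq]] := natural_inflation_root nl' l2.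
  move=> /(algebraic_of_sum_inv (lt0r_neq0 q0)) qalg.
  have q01 : 0 < q < 1 by rewrite q0.
  pose A : {poly int} := 2%:P + (- 5)%:P * 'X^1; pose B : {poly int} := 'X^1 + (- 1)%:P * 'X^2.
  have Ae : evalz A q = 2 - 5 * q by rewrite evalzD evalzM !evalzC evalzXn; ring.
  have Be : evalz B q = q * (1 - q) by rewrite evalzD evalzM !evalzC !evalzXn; ring.
  apply: (@thue_morse_product_not_rational R q A B q01 qalg).
    by rewrite Be mulf_neq0 ?lt0r_neq0 // subr_gt0.
  by rewrite Ae Be; exact: tm_relation.
Qed.
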